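(* Let $p$ be a prime and $F$ an algebraically closed field of characteristic $p$. Let $\lambda=\bigcup_q\lambda_q$ be the algebra, and $\mathcal{B}$, $\mathcal{B}_\lambda$ the sets, defined in the context. Then the set $\mathcal{B}_\lambda$ (the elements of $\mathcal{B}$ of height $0$), with product obtained by restriction from $\mathcal{B}$, forms a monomial basis for $\lambda$. Here a basis of an algebra is called monomial if it contains a complete set of primitive idempotents and the product of any two of its elements is either equal to $\pm$ another basis element or equal to zero.
   Context: Conventions: $\mathbb{N}=\{0,1,2,\dots\}$. $\Pi$ is the preprojective algebra of bi-infinite type $A$ (vertices $\mathbb{Z}$, arrows $x:s\to s+1$, $y:s+1\to s$, relations $xy-yx$), with basis $\mathcal{B}_\Pi=\{(s,\alpha,\beta):s\in\mathbb{Z},\alpha,\beta\in\mathbb{N}\}$, $(s,\alpha,\beta)$ denoting the path $x^\alpha y^\beta e_s$, and product $(s,\alpha,\beta)(s',\alpha',\beta')=(s,\alpha+\alpha',\beta+\beta')$ if $s'=s+\alpha-\beta$, and $0$ otherwise. Put $|(s,\alpha,\beta)|=\alpha+\beta$. $\Omega$ is the quotient of the subalgebra of $\Pi$ generated by arrows between vertices $\le p$ by the ideal generated by the idempotents $e_i$, $i\le0$; it has basis $\mathcal{B}_\Omega=\{(s,\alpha,\beta)\in\mathcal{B}_\Pi:1\le s\le p,\ \alpha\le\beta+p-s,\ \beta\le s-1\}$ (products taken in $\mathcal{B}_\Pi$, set to $0$ if not in $\mathcal{B}_\Omega$). $\Theta=\Omega/\Omega e_p\Omega$ has basis $\mathcal{B}_\Theta=\{(s,\alpha,\beta)\in\mathcal{B}_\Pi:1\le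 s\le p-1,\ \alpha\le p-s-1,\ \beta\le s-1\}$ (products not in $\mathcal{B}_\Theta$ set to $0$). $\sigma(s,\alpha,\beta)=(p-s,\beta,\alpha)$ is an involution of $\Pi$ inducing one of $\Theta$; $\Theta^\sigma$ is $\Theta$ as an $\Omega$-$\Omega$-bimodule via $\Omega\to\Theta$, with right action twisted by $\sigma$. $\Lambda=\mathbb{T}_\Omega(\Theta^\sigma)\otimes_F F[\zeta]$ (tensor algebra over $\Omega$, tensored with a polynomial ring). It has the basis $$\mathcal{B}_\Lambda=\{(b,n,h): n,h\in\mathbb{N},\ b\in\mathcal{B}_\Omega\text{ if }n=0,\ b\in\mathcal{B}_\Theta\text{ if }n>0\},$$ where $(b,n,h)$ lies in $(\Theta^\sigma)^{\otimes n}\otimes\zeta^h$, with product $(b,n,h)(b',n',h')=(bb',n+n',h+h')$ if $n$ is even and $(b\sigma(b'),n+n',h+h')$ if $n$ is odd, the first entry being computed in $\mathcal{B}_\Pi$ and the product being $0$ if that entry is $0$ or is not in $\mathcal{B}_\Omega$ (when $n+n'=0$), respectively not in $\mathcal{B}_\Theta$ (when $n+n'>0$). The trigrading on $\Lambda$ assigns to $\beta=(b,n,h)$ the degree $(|\beta|_i,|\beta|_j,|\beta|_k)=(n+h,\ ph+|b|,\ |b|+(p-1)h)$. For a trigraded algebra $\Gamma$ and a bigraded algebra $\Delta$, $\mathfrak{O}_\Gamma(\Delta)^{ik}=\bigoplus_{j,\,k_1+k_2=k}\Gamma^{ijk_1}\otimes_F\Delta^{jk_2}$, with product $(\gamma_1\otimes\delta_1)(\gamma_2\otimes\delta_2)=(-1)^{|\gamma_2|_k|\delta_1|_k}\gamma_1\gamma_2\otimes\delta_1\delta_2$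 (the $i$-degree of the output serves as $j$-degree in the next application). $F$ is trigraded in degree $(0,0,0)$ and $F[z]$ is bigraded with $z$ in $jk$-degree $(1,0)$. Put $\lambda_q=\mathfrak{O}_F\mathfrak{O}_\Lambda^q(F[z])$, a subalgebra of the super tensor product $\Lambda^{\otimes q}\otimes F[z]$. The embedding $F\to\Lambda$, $1\mapsto e_1\otimes1$, and $\mathfrak{O}_F^2=\mathfrak{O}_F$ give algebra embeddings $\lambda_q\to\lambda_{q+1}$; $\lambda$ is the union. $\mathcal{B}_q=\{[\beta_1,\dots,\beta_q,l]:\beta_s\in\mathcal{B}_\Lambda,\ l\in\mathbb{N}\}$, where $[\beta_1,\dots,\beta_q,l]$ is identified with $\beta_1\otimes\cdots\otimes\beta_q\otimes z^l$, with product $$[\beta_1,\dots,\beta_q,l][\beta_1',\dots,\beta_q',l']=(-1)^{\sum_{s'<s}|\beta_s|_k|\beta'_{s'}|_k}[\beta_1\beta_1',\dots,\beta_q\beta_q',l+l'].$$ The height of $[\beta_1,\dots,\beta_q,l]$ is $$(|\beta_1|_i,\ |\beta_2|_i-|\beta_1|_j,\ |\beta_3|_i-|\beta_2|_j,\dots,|\beta_q|_i-|\beta_{q-1}|_j,\ l-|\beta_q|_j).$$ With $\hat1=((1,0,0),0,0)\in\mathcal{B}_\Lambda$, there is a multiplicative, height-preserving embedding $\mathcal{B}_q\to\mathcal{B}_{q+1}$, $[\beta_1,\dots,\beta_q,l]\mapsto[\hat1,\beta_1,\dots,\beta_q,l]$, which restricts to the embedding $\lambda_q\to\lambda_{q+1}$.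 $\mathcal{B}$ is the union of the $\mathcal{B}_q$ along these embeddings, and $\mathcal{B}_\lambda\subset\mathcal{B}$ is the subset of elements of height $0$ (all entries zero). *)

(* Defs.v *)
From HB Require Import structures.
From mathcomp Require Import all_boot all_order all_algebra.
From mathcomp Require Import boolp.
From mathcomp Require Import finmap monalg.

Set Implicit Arguments.
Unset Strict Implicit.
Unset Printing Implicit Defensive.

Import Order.TTheory GRing.Theory Num.Theory.
Local Open Scope quotient_scope.
Local Open Scope ring_scope.

(* Several of the algebras below (the preprojective algebra, lambda) have no
   unit element, and MathComp has no structure of non-unital algebra; so an
   algebra is recorded here as an F-module with a multiplication.  All algebras
   below are explicit constructions, hence their axioms are facts about these
   constructions and are nowhere used as hypotheses.  The product of a quotient
   is computed on representatives. *)
Record nalg (F : fieldType) :=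
  Nalg { ncar :> lmodType F; nmul : ncar -> ncar -> ncar }.

Declare Scope nalg_scope.
Delimit Scope nalg_scope with A.
Notation "x * y" := (nmul x y) : nalg_scope.

Section LinearAlgebra.
Variables (F : fieldType) (V : lmodType F).

Inductive lspan (S : V -> Prop) : V -> Prop :=
| lspan0 : lspan S 0
| lspanS (a : F) (u v : V) : S u -> lspan S v -> lspan S (a *: u + v).

Definition lspan_pred (S : V -> Prop) : {pred V} := fun v => `[< lspan S v >].

Lemma lspan_closed S : submod_closed (lspan_pred S).
Proof.
have lspanZD a u v : lspan S u -> lspan S v -> lspan S (a *: u + v).
  move=> Su Sv; elim: Su => [|b w t Sw _ IH]; first by rewrite scaler0 add0r.
  by rewrite scalerDr scalerA -addrA; apply: lspanS.
split=> [|a u v]; rewrite !unfold_in; first exact/asboolP/lspan0.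
by move=> /asboolP Su /asboolP Sv; apply/asboolP/lspanZD.
Qed.

HB.instance Definition _ S :=
  GRing.isSubmodClosed.Build F V (lspan_pred S) (lspan_closed S).

Definition lquot (S : V -> Prop) : Type :=
  Quotient.quot (GRing.ZmodClosed.clone V (lspan_pred S) _).
HB.instance Definition _ S := GRing.Zmodule.on (lquot S).
HB.instance Definition _ S := EqQuotient.on (lquot S).

Section QuotientScale.
Variable S : V -> Prop.

Definition lproj (v : V) : lquot S := \pi_(lquot S) v.

Lemma lreprK (x : lquot S) : lproj (repr x) = x.
Proof. exact: reprK. Qed.

Lemma lproj_eq u v : (lproj u == lproj v) = (u - v \in lspan_pred S).
Proof. exact/esym/Quotient.idealrBE. Qed.

Lemma lprojD u v : lproj (u + v) = lproj u + lproj v.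
Proof. exact: Quotient.pi_add. Qed.

Definition lqscale (a : F) (x : lquot S) : lquot S := lproj (a *: repr x).

Lemma lqscaleE a v : lqscale a (lproj v) = lproj (a *: v).
Proof.
by apply/eqP; rewrite lproj_eq -scalerBr rpredZ // -lproj_eq lreprK.
Qed.

Lemma lqscaleA a b x : lqscale a (lqscale b x) = lqscale (a * b) x.
Proof. by rewrite -[x]lreprK !lqscaleE scalerA. Qed.

Lemma lqscale1 : left_id 1 lqscale.
Proof. by move=> x; rewrite -[x]lreprK !lqscaleE scale1r. Qed.

Lemma lqscaleDr : right_distributive lqscale +%R.
Proof.
move=> a x y; rewrite -[x]lreprK -[y]lreprK -lprojD !lqscaleE.
by rewrite scalerDr lprojD.
Qed.

Lemma lqscaleDl x : {morph lqscale^~ x : a b / a + b}.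
Proof. by move=> a b; rewrite -[x]lreprK !lqscaleE scalerDl lprojD. Qed.

HB.instance Definition _ := GRing.Zmodule_isLmodule.Build F (lquot S)
  lqscaleA lqscale1 lqscaleDr lqscaleDl.
End QuotientScale.

Definition lsub (S : V -> Prop) : Type := {x : V | x \in lspan_pred S}.
HB.instance Definition _ S := SubChoice.on (lsub S).
HB.instance Definition _ S := [SubChoice_isSubLmodule of lsub S by <:].

End LinearAlgebra.

Section Algebras.
Variable F : fieldType.
Implicit Types A B : nalg F.

(* Two-sided ideal generated by R, and subalgebra generated by G; as algebras
   need not be unital, neither contains more than what is listed. *)
Inductive nideal A (R : A -> Prop) : A -> Prop :=
| nideal0 : nideal R 0
| nidealP (a : F) u v : nideal R u -> nideal R v -> nideal R (a *: u + v)
| nideal_gen u : R u -> nideal R u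
| nidealMl u v : nideal R v -> nideal R (u * v)%A
| nidealMr u v : nideal R u -> nideal R (u * v)%A.

Inductive nsubalg A (G : A -> Prop) : A -> Prop :=
| nsubalg0 : nsubalg G 0
| nsubalgP (a : F) u v : nsubalg G u -> nsubalg G v -> nsubalg G (a *: u + v)
| nsubalg_gen u : G u -> nsubalg G u
| nsubalgM u v : nsubalg G u -> nsubalg G v -> nsubalg G (u * v)%A.

Definition nquot A (R : A -> Prop) : nalg F :=
  Nalg (fun x y : lquot (nideal R) => lproj (nideal R) (repr x * repr y)%A).

Definition nproj A (R : A -> Prop) : A -> nquot R := lproj (nideal R).

(* The default value of insubd is never used: the subalgebra is closed under
   products. *)
Definition nsub A (G : A -> Prop) : nalg F :=
  Nalg (fun x y : lsub (nsubalg G) =>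
          insubd (0 : lsub (nsubalg G)) (val x * val y)%A).

Definition malg_lift (K : choiceType) (V : lmodType F) (f : K -> V)
    (x : {malg F[K]}) : V :=
  \sum_(k <- msupp x) x@_k *: f k.

Definition malg_lift2 (K : choiceType) (V : lmodType F) (f : K -> K -> V)
    (x y : {malg F[K]}) : V :=
  malg_lift (fun k => malg_lift (f k) y) x.

(* The tensor product A (x) B over F, with the product
   (a (x) b)(a' (x) b') = aa' (x) bb'. *)
Section Tensor.
Variables A B : nalg F.

Definition tens_rel (v : {malg F[(A * B)%type]}) : Prop :=
  (exists (c : F) (x y : A) (z : B),
     v = << (c *: x + y, z) >> - c *: << (x, z) >> - << (y, z) >>) \/
  (exists (c : F) (x : A) (y z : B),
     v = << (x, c *: y + z) >> - c *: << (x, y) >> - << (x, z) >>).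

Definition tens (x : A) (y : B) : lquot tens_rel := lproj tens_rel << (x, y) >>.

Definition ntens : nalg F :=
  Nalg (fun u v : lquot tens_rel =>
          malg_lift2 (fun g h : A * B => tens (g.1 * h.1)%A (g.2 * h.2)%A)
            (repr u) (repr v)).
End Tensor.

(* The tensor algebra T_A(M) of an A-A-bimodule M, where A has unit e: the
   quotient of the free algebra F<A + M> by the relations that make A -> T_A(M)
   a morphism of unital algebras and M -> T_A(M) a morphism of A-A-bimodules. *)
Section TensorAlgebra.
Variables (A : nalg F) (e : A) (M : lmodType F).
Variables (lact : A -> M -> M) (ract : M -> A -> M).

Definition letter : choiceType := (A + M)%type.
Definition freealg : nalg F :=
  Nalg (fun x y : {malg F[{fmonom letter}]} => x * y).

Definition ltr (l : letter) : freealg := << fmu l >>.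

Inductive talg_rel : freealg -> Prop :=
| talg_linA (c : F) (x y : A) :
    talg_rel (ltr (inl (c *: x + y)) - c *: ltr (inl x) - ltr (inl y))
| talg_linM (c : F) (m n : M) :
    talg_rel (ltr (inr (c *: m + n)) - c *: ltr (inr m) - ltr (inr n))
| talg_one : talg_rel (ltr (inl e) - 1)
| talg_mulA x y :
    talg_rel (ltr (inl x) * ltr (inl y) - ltr (inl (x * y)%A))%A
| talg_lact x m :
    talg_rel (ltr (inl x) * ltr (inr m) - ltr (inr (lact x m)))%A
| talg_ract m x :
    talg_rel (ltr (inr m) * ltr (inl x) - ltr (inr (ract m x)))%A.

Definition talg : nalg F := nquot talg_rel.

Definition talg_word (w : seq letter) : talg :=
  nproj talg_rel << FMonom w >>.

(* For gradings of A and M, the degree of a word is (number of letters in M,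
   sum of the degrees of the letters). *)
Variables (Adeg : nat -> A -> Prop) (Mdeg : nat -> M -> Prop).

Definition letter_deg (l : letter) (n a : nat) : Prop :=
  match l with
  | inl x => n = 0%N /\ Adeg a x
  | inr m => n = 1%N /\ Mdeg a m
  end.

Inductive word_deg : seq letter -> nat -> nat -> Prop :=
| word_deg_nil : word_deg [::] 0 0
| word_deg_cons l w n a n' a' :
    letter_deg l n a -> word_deg w n' a' ->
    word_deg (l :: w) (n + n') (a + a').

Definition talg_deg (n a : nat) : talg -> Prop :=
  lspan (fun t => exists2 w, word_deg w n a & t = talg_word w).
End TensorAlgebra.

(* [trideg G i j k] and [bideg D j k] are the homogeneous components. *)
Record trialg :=
  Trialg { trialg_alg :> nalg F;
           trideg : int -> int -> int -> trialg_alg -> Prop }.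
Record bialg :=
  Bialg { bialg_alg :> nalg F; bideg : int -> int -> bialg_alg -> Prop }.

(* O_G(D)^{ik} is the direct sum over j and k1 + k2 = k of the tensor products
   G^{ijk1} (x) D^{jk2}. The direct sum of all of them is presented by the
   symbols ((i, j, k1, k2), (x, y)) with x in G^{ijk1} and y in D^{jk2},
   subject to bilinearity for each fixed (i, j, k1, k2). *)
Section OperatorO.
Variables (G : trialg) (D : bialg).

Definition odeg : Type := (int * int * int * int)%type.

Definition ohom (g : odeg * (G * D)) : Prop :=
  let: (i, j, k1, k2, (x, y)) := g in trideg i j k1 x /\ bideg j k2 y.

Definition osymb : Type := {g : odeg * (G * D) | `[< ohom g >]}.
HB.instance Definition _ := SubChoice.on osymb.

Definition otens_rel (v : {malg F[osymb]}) : Prop :=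
  exists (c : F) (g g1 g2 : osymb),
    [/\ (val g).1 = (val g1).1, (val g).1 = (val g2).1,
        v = << g >> - c *: << g1 >> - << g2 >> &
      let: (x, y) := (val g).2 in
      let: (x1, y1) := (val g1).2 in
      let: (x2, y2) := (val g2).2 in
      [/\ x = c *: x1 + x2, y = y1 & y = y2] \/
      [/\ x = x1, x = x2 & y = c *: y1 + y2]].

(* x (x) y in the summand with index d; it is only used for homogeneous x, y
   of the right degrees. *)
Definition otens (d : odeg) (x : G) (y : D) : lquot otens_rel :=
  if insub (d, (x, y)) is Some g then lproj otens_rel << g : osymb >> else 0.

Definition osymb_mul (g h : osymb) : lquot otens_rel :=
  let: (i, j, k1, k2, (x, y)) := val g in
  let: (i', j', k1', k2', (x', y')) := val h in
  (-1) ^ (k1' * k2) *: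
    otens (i + i', j + j', k1 + k1', k2 + k2') (x * x')%A (y * y')%A.

Definition oalg : nalg F :=
  Nalg (fun u v : lquot otens_rel => malg_lift2 osymb_mul (repr u) (repr v)).

Definition oalg_deg (i k : int) : oalg -> Prop :=
  lspan (fun u => exists j k1 k2 x y,
    [/\ trideg i j k1 x, bideg j k2 y, k1 + k2 = k
      & u = otens (i, j, k1, k2) x y]).

Definition opO : bialg := Bialg oalg_deg.
End OperatorO.

Definition triF : trialg :=
  Trialg (trialg_alg := Nalg (fun x y : F^o => x * y))
    (fun i j k x => x = 0 \/ [/\ i = 0, j = 0 & k = 0]).

Definition polyalg : nalg F := Nalg (fun x y : {poly F} => x * y).

Definition biFz : bialg :=
  Bialg (bialg_alg := polyalg)
    (fun j k => lspan (fun u => exists l : nat,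
       [/\ j = l%:Z, k = 0 & u = 'X^l])).

(* Direct limit of L_0 -> L_1 -> L_2 -> ... along the maps f q. *)
Section Colimit.
Variables (L : nat -> nalg F) (f : forall q, L q -> L q.+1).

Definition colim_symb : choiceType := {q : nat & L q}.
Definition csymb q (x : L q) : {malg F[colim_symb]} :=
  << (existT (fun q => L q) q x : colim_symb) >>.

Inductive colim_rel : {malg F[colim_symb]} -> Prop :=
| colim_lin q (c : F) (x y : L q) :
    colim_rel (csymb (c *: x + y) - c *: csymb x - csymb y)
| colim_step q (x : L q) : colim_rel (csymb (f x) - csymb x).

Definition colim_in q (x : L q) : lquot colim_rel := lproj colim_rel (csymb x).

Fixpoint colim_up m q (x : L q) : L (m + q) :=
  if m is m'.+1 then f (colim_up m' x) else x.

(* The product of x in L_q and y in L_r is computed in L_(q + r). *)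
Definition colim_symb_mul (g h : colim_symb) : lquot colim_rel :=
  colim_in (ecast n (L n) (addnC (tag h) (tag g)) (colim_up (tag h) (tagged g))
            * colim_up (tag g) (tagged h))%A.

Definition colim : nalg F :=
  Nalg (fun u v : lquot colim_rel =>
          malg_lift2 colim_symb_mul (repr u) (repr v)).
End Colimit.

Section MonomialBasis.
Variable A : nalg F.

Definition idempotent (e : A) : Prop := (e * e)%A = e.

Definition orthogonal (e f : A) : Prop := (e * f)%A = 0 /\ (f * e)%A = 0.

Definition primitive_idempotent (e : A) : Prop :=
  [/\ e <> 0, idempotent e &
      forall f g, idempotent f -> idempotent g -> orthogonal f g ->
        e = f + g -> f = 0 \/ g = 0].

(* If A is unital, the last condition says that E is finite with sum 1; in
   general, that the finite sums of elements of E are local units of A. *)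
Definition complete_primitive_idempotents (E : A -> Prop) : Prop :=
  [/\ forall e, E e -> primitive_idempotent e,
      forall e f, E e -> E f -> e <> f -> orthogonal e f &
      forall a, exists s : seq A,
        [/\ uniq s, forall e, e \in s -> E e,
            ((\sum_(e <- s) e) * a)%A = a & (a * (\sum_(e <- s) e))%A = a]].

Definition linearly_independent (S : A -> Prop) : Prop :=
  forall (s : seq A) (c : A -> F), uniq s -> (forall x, x \in s -> S x) ->
    \sum_(x <- s) c x *: x = 0 -> forall x, x \in s -> c x = 0.

Definition is_basis (S : A -> Prop) : Prop :=
  linearly_independent S /\ forall a, lspan S a.

Definition monomial_basis (S : A -> Prop) : Prop :=
  [/\ is_basis S,
      exists2 E : A -> Prop, complete_primitive_idempotents E &
        forall e, E e -> S e &
      forall x y, S x -> S y ->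
        (x * y)%A = 0 \/ exists2 z, S z & (x * y)%A = z \/ (x * y)%A = - z].
End MonomialBasis.

End Algebras.

Section Algebra_lambda.
Variables (F : fieldType) (p : nat).

(* The path algebra of the quiver with vertices the integers and arrows
   x : s -> s + 1, y : s + 1 -> s.  A path is its first vertex together with
   the word of its arrows in the order in which they are traversed, true for x
   and false for y; the product v w of paths is v followed by w. *)
Definition qpath : choiceType := (int * seq bool)%type.

Definition qpath_end (w : qpath) : int :=
  w.1 + \sum_(b <- w.2) (if b then 1 else -1).

Definition qpath_mul (v w : qpath) : {malg F[qpath]} :=
  if qpath_end v == w.1 then << ((v.1, v.2 ++ w.2) : qpath) >> else 0.

Definition pathalg : nalg F :=
  Nalg (fun x y : {malg F[qpath]} => malg_lift2 qpath_mul x y).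

Definition qpath_elt (w : qpath) : pathalg := << w >>.

Inductive Pi_rel : pathalg -> Prop :=
| Pi_rel_xy (s : int) :
    Pi_rel (qpath_elt (s, [:: true; false]) - qpath_elt (s, [:: false; true])).

Definition Pi : nalg F := nquot Pi_rel.
Definition Pi_path (w : qpath) : Pi := nproj Pi_rel (qpath_elt w).
Definition Pi_e (s : int) : Pi := Pi_path (s, [::]).

(* The idempotents and arrows of the full subquiver with set of vertices I. *)
Inductive Pi_gen (I : pred int) : Pi -> Prop :=
| Pi_gen_e s : I s -> Pi_gen I (Pi_e s)
| Pi_gen_x s : I s -> I (s + 1) -> Pi_gen I (Pi_path (s, [:: true]))
| Pi_gen_y s : I s -> I (s + 1) -> Pi_gen I (Pi_path (s + 1, [:: false])).

Definition Pi_sigma (u : Pi) : Pi :=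
  malg_lift (fun w : qpath => Pi_path (p%:Z - w.1, map negb w.2)) (repr u).

Definition Pi_le : nalg F := nsub (Pi_gen (fun s => s <= p%:Z)).

Inductive Omega_rel : Pi_le -> Prop :=
| Omega_rel_e (s : int) (u : Pi_le) : s <= 0 -> val u = Pi_e s -> Omega_rel u.

Definition Omega : nalg F := nquot Omega_rel.

(* Class in Omega of an element of Pi; 0 if u is not in the subalgebra Pi_le. *)
Definition toOmega (u : Pi) : Omega :=
  nproj Omega_rel (insubd (0 : Pi_le) u).

Inductive Theta_rel : Omega -> Prop :=
| Theta_rel_e : Theta_rel (toOmega (Pi_e p%:Z)).

Definition Theta : nalg F := nquot Theta_rel.
Definition Omega_Theta : Omega -> Theta := nproj Theta_rel.
Definition toTheta (u : Pi) : Theta := Omega_Theta (toOmega u).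

(* Every element of Theta lifts to the subalgebra of Pi generated by the arrows
   between the vertices 1, ..., p - 1, which is stable under sigma; the
   involution of Theta maps the class of u in it to the class of sigma(u). *)
Definition Pi_inner : Pi -> Prop :=
  nsubalg (Pi_gen (fun s => 1 <= s <= p%:Z - 1)).

Definition Theta_sigma (t : Theta) : Theta :=
  match pselect (exists u, Pi_inner u /\ toTheta u = t) with
  | left ex_u => toTheta (Pi_sigma (projT1 (cid ex_u)))
  | right _ => 0
  end.

Definition Omega_one : Omega := \sum_(1 <= s < p.+1) toOmega (Pi_e s%:Z).
Definition Theta_one : Theta := Omega_Theta Omega_one.

Definition Theta_lact (x : Omega) (m : Theta) : Theta := (Omega_Theta x * m)%A.
Definition Theta_ract (m : Theta) (x : Omega) : Theta :=
  (m * Theta_sigma (Omega_Theta x))%A.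

Definition T_Omega : nalg F := talg Omega_one Theta_lact Theta_ract.

Definition Omega_deg (a : nat) : Omega -> Prop :=
  lspan (fun x => exists2 w : qpath, size w.2 = a & x = toOmega (Pi_path w)).
Definition Theta_deg (a : nat) (m : Theta) : Prop :=
  exists2 x, Omega_deg a x & m = Omega_Theta x.

Definition Lambda : trialg F :=
  Trialg (trialg_alg := ntens T_Omega (polyalg F))
    (fun i j k => lspan (fun u => exists n a h : nat, exists t : T_Omega,
       [/\ talg_deg Omega_deg Theta_deg n a t,
           i = (n + h)%N%:Z, j = (p * h + a)%N%:Z, k = (a + p.-1 * h)%N%:Z
         & u = tens t ('X^h : polyalg F)])).

Definition Lambda_e1 : Lambda :=
  tens (talg_word Omega_one Theta_lact Theta_ract
          [:: inl (toOmega (Pi_e 1))] : T_Omega) (1 : polyalg F).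

(* lambdaO q = O_Lambda^q (F[z]) and lambda_ q = O_F O_Lambda^q (F[z]). *)
Definition lambdaO (q : nat) : bialg F := iter q (opO Lambda) (biFz F).
Definition lambda_ (q : nat) : nalg F := opO (triF F) (lambdaO q).

(* The embedding O_F(D) = O_F(O_F(D)) -> O_F(O_Lambda(D)), where D = lambdaO q:
   it maps c (x) y to 1 (x) (c e_1 (x) y). *)
Definition lambda_emb q (u : lambda_ q) : lambda_ q.+1 :=
  malg_lift
    (fun g : osymb (triF F) (lambdaO q) =>
       let: (i, j, k1, k2, (c, y)) := val g in
       otens (G := triF F) (D := lambdaO q.+1) (0, 0, 0, k1 + k2) 1
         (otens (G := Lambda) (i, j, k1, k2) ((c : F) *: Lambda_e1) y))
    (repr u).

Definition lambda : nalg F := colim lambda_emb.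

End Algebra_lambda.

(* The combinatorial sets B_Pi, B_Lambda, B; a product equal to 0 is None. *)
Section Combinatorics.
Variable p : nat.

Definition piB : choiceType := (int * nat * nat)%type.

Definition piB_mul (b b' : piB) : option piB :=
  let: (s, al, be) := b in
  let: (s', al', be') := b' in
  if s' == s + al%:Z - be%:Z then Some (s, (al + al')%N, (be + be')%N)
  else None.

Definition piB_sigma (b : piB) : piB :=
  let: (s, al, be) := b in (p%:Z - s, be, al).

Definition piB_len (b : piB) : nat := let: (_, al, be) := b in (al + be)%N.

Definition in_BOmega (b : piB) : bool :=
  let: (s, al, be) := b in
  [&& 1 <= s, s <= p%:Z, al%:Z <= be%:Z + p%:Z - s & be%:Z <= s - 1].

Definition in_BTheta (b : piB) : bool :=
  let: (s, al, be) := b in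
  [&& 1 <= s, s <= p%:Z - 1, al%:Z <= p%:Z - s - 1 & be%:Z <= s - 1].

Definition lamB : choiceType := (piB * nat * nat)%type.

Definition in_BLambda (x : lamB) : bool :=
  let: (b, n, h) := x in if n == 0%N then in_BOmega b else in_BTheta b.

Definition lamB_mul (x x' : lamB) : option lamB :=
  let: (b, n, h) := x in
  let: (b', n', h') := x' in
  if piB_mul b (if odd n then piB_sigma b' else b') is Some c then
    let y : lamB := (c, (n + n')%N, (h + h')%N) in
    if in_BLambda y then Some y else None
  else None.

Definition lamB_i (x : lamB) : nat := let: (b, n, h) := x in (n + h)%N.
Definition lamB_j (x : lamB) : nat :=
  let: (b, n, h) := x in (p * h + piB_len b)%N.
Definition lamB_k (x : lamB) : nat :=
  let: (b, n, h) := x in (piB_len b + p.-1 * h)%N.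

Definition lamB_hat1 : lamB := ((1, 0%N, 0%N), 0%N, 0%N).

(* The disjoint union of the B_q: [beta_1, ..., beta_q, l] is
   ([:: beta_1; ...; beta_q], l). *)
Definition Bword : choiceType :=
  {x : seq lamB * nat | all in_BLambda x.1}.

Fixpoint height_from (j : nat) (s : seq lamB) (l : nat) : seq int :=
  if s is x :: s' then ((lamB_i x)%:Z - j%:Z) :: height_from (lamB_j x) s' l
  else [:: l%:Z - j%:Z].

Definition height (x : Bword) : seq int := height_from 0 (val x).1 (val x).2.

(* The image of an element of B_q, where q = size s, in B_N for N >= q. *)
Definition pad (N : nat) (s : seq lamB) : seq lamB :=
  nseq (N - size s) lamB_hat1 ++ s.

Definition Beq (x y : Bword) : bool :=
  let N := maxn (size (val x).1) (size (val y).1) in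
  (pad N (val x).1 == pad N (val y).1) && ((val x).2 == (val y).2).

Lemma pad_pad N M s : (N <= M)%N -> (size s <= N)%N -> pad M (pad N s) = pad M s.
Proof.
move=> leNM les; rewrite /pad size_cat size_nseq subnK // catA -nseqD.
by rewrite addnBA // subnK.
Qed.

Lemma pad_inj N s t : size s = size t -> pad N s = pad N t -> s = t.
Proof.
by move=> st /eqP; rewrite /pad st eqseq_cat ?eqxx //= => /eqP.
Qed.

Lemma size_pad N s : (size s <= N)%N -> size (pad N s) = N.
Proof. by move=> les; rewrite size_cat size_nseq subnK. Qed.

Lemma Beq_pad x y N : (size (val x).1 <= N)%N -> (size (val y).1 <= N)%N ->
  Beq x y =
  (pad N (val x).1 == pad N (val y).1) && ((val x).2 == (val y).2).
Proof.
move=> lex ley; rewrite /Beq; set M := maxn _ _; congr (_ && _).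
have leM : (M <= N)%N by rewrite geq_max lex.
rewrite -(pad_pad leM (leq_maxl _ _)) -(pad_pad leM (leq_maxr _ _)) -/M.
apply/eqP/eqP=> [->//|/pad_inj]; apply.
by rewrite !size_pad // ?leq_maxl ?leq_maxr.
Qed.

Lemma Beq_equiv : equiv_class_of Beq.
Proof.
split=> [x|x y|y x z]; first by rewrite /Beq !eqxx.
  by rewrite /Beq maxnC eq_sym [X in _ && X]eq_sym.
pose N := maxn (size (val y).1) (maxn (size (val x).1) (size (val z).1)).
have ley : (size (val y).1 <= N)%N by rewrite leq_maxl.
have lex : (size (val x).1 <= N)%N by rewrite !leq_max leqnn orbT.
have lez : (size (val z).1 <= N)%N by rewrite !leq_max leqnn !orbT.
rewrite (Beq_pad lex ley) (Beq_pad ley lez) (Beq_pad lex lez).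
by move=> /andP[/eqP-> /eqP->].
Qed.

Canonical Beq_equiv_rel := EquivRelPack Beq_equiv.
Canonical Beq_encModRel := defaultEncModRel Beq.

(* B, the union of the B_q along the embeddings beta |-> [hat1, beta]. *)
Definition B : Type := {eq_quot Beq}.
HB.instance Definition _ := Choice.on B.
HB.instance Definition _ := EqQuotient.on B.

Definition Bclass (x : Bword) : B := \pi_B x.

(* The product of words of equal length, and the parity of the sum over
   s' < s of |beta_s|_k |beta'_s'|_k.  *)
Fixpoint seqB_mul (s t : seq lamB) : option (seq lamB) :=
  match s, t with
  | x :: s', y :: t' =>
      if lamB_mul x y is Some z then omap (cons z) (seqB_mul s' t') else None
  | _, _ => Some [::]
  end.

Definition seqB_sign (s t : seq lamB) : bool :=
  odd (\sum_(i < size s) \sum_(i' < size t | (i' < i)%N)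
         lamB_k (nth lamB_hat1 s i) * lamB_k (nth lamB_hat1 t i')).

(* Some (eps, c) stands for (-1)^eps c. *)
Definition B_mul (b c : B) : option (bool * B) :=
  let: (s, l) := val (repr b) in
  let: (t, m) := val (repr c) in
  let N := maxn (size s) (size t) in
  if seqB_mul (pad N s) (pad N t) is Some r then
    omap (fun x => (seqB_sign (pad N s) (pad N t), Bclass x))
      (insub (r, (l + m)%N))
  else None.

Definition in_Blambda (b : B) : bool := all (eq_op^~ 0) (height (repr b)).

End Combinatorics.

(* The elements of the algebras named by the combinatorial symbols. *)
Section Elements.
Variables (F : fieldType) (p : nat).

Definition piB_elt (b : piB) : Pi F :=
  let: (s, al, be) := b in Pi_path F (s, nseq be false ++ nseq al true).

(* (b, n, h) with n > 0 is b (x) 1 (x) ... (x) 1 (x) zeta^h, with n factors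
   in Theta^sigma. *)
Definition Lambda_elt (x : lamB) : Lambda F p :=
  let: (b, n, h) := x in
  let w : seq (letter (Omega F p) (Theta F p)) :=
    if n is n'.+1 then
      inr (toTheta p (piB_elt b)) :: nseq n' (inr (Theta_one F p))
    else [:: inl (toOmega p (piB_elt b))] in
  tens (talg_word (Omega_one F p) (@Theta_lact F p) (@Theta_ract F p) w
          : T_Omega F p)
    ('X^h : polyalg F).

Definition seqB_k (s : seq lamB) : int := \sum_(x <- s) (lamB_k p x)%:Z.

Fixpoint lambdaO_elt (s : seq lamB) (l : nat) : lambdaO F p (size s) :=
  match s return lambdaO F p (size s) with
  | [::] => ('X^l : polyalg F)
  | x :: s' =>
      otens (G := Lambda F p) (D := lambdaO F p (size s'))
        ((lamB_i x)%:Z, (lamB_j p x)%:Z, (lamB_k p x)%:Z, seqB_k s')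
        (Lambda_elt x) (lambdaO_elt s' l)
  end.

(* 1 (x) beta_1 (x) ... (x) beta_q (x) z^l in lambda_q, and its image in
   lambda; meaningful for words of height 0 only. *)
Definition lambda_q_elt (s : seq lamB) (l : nat) : lambda_ F p (size s) :=
  otens (G := triF F) (D := lambdaO F p (size s))
    (0, 0, 0, seqB_k s) (1 : F^o) (lambdaO_elt s l).

Definition Bword_elt (x : Bword p) : lambda F p :=
  colim_in (@lambda_emb F p) (lambda_q_elt (val x).1 (val x).2).

Definition B_elt (b : B p) : lambda F p := Bword_elt (repr b).

End Elements.

(* Main.v *)
Require Import Defs.
From HB Require Import structures.
From mathcomp Require Import all_boot all_order all_algebra.
From mathcomp Require Import boolp.
From mathcomp Require Import finmap monalg.
From mathcomp Require Import zify.

Set Implicit Arguments.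
Unset Strict Implicit.
Unset Printing Implicit Defensive.

Import Order.TTheory GRing.Theory Num.Theory.
Local Open Scope ring_scope.

(* Each algebra A of the construction is equipped with a linear coordinate map
   phi from A to the space of finitely supported functions on a set K of
   combinatorial symbols.  The map sends the element named by k to the basis
   vector k, and it carries the product of A to the bilinear product with
   structure constants m on K.  Since the named elements also span A, the map
   phi is injective, so every identity in A may be checked on symbols.

   A coordinate map on a quotient is a linear map killing the relations; it
   kills the ideal they generate because it is multiplicative.  For the tensor
   algebra, the coordinates of a word are obtained by letting its letters act
   successively on the unit, which is consistent by associativity of the
   product of symbols.  For the operator O, the grading is read off the
   symbols.  In the direct limit, the symbols are the words without leading
   hat1.

   The idempotents of B_lambda are its elements of k-degree 0.  The coefficient
   at such an element is multiplicative, and an idempotent all of whose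
   coefficients in degree 0 vanish is zero, as otherwise its lowest degree
   would double.  Hence these idempotents are primitive. *)


(** * Linear extension from a basis *)

(** The record [nalg] carries no axioms and products on quotients are evaluated on chosen
    representatives, so at first not even bilinearity of a product is available. The record [ncoord]
    is an invariant that each construction reproduces from that of its ingredients; bilinearity,
    independence of representatives and linear independence come out of it. Names and structure
    constants are total functions, defined also on symbols that name nothing; this is why so many
    statements are relative to supports. To iterate O, coordinates alone do not suffice: the
    homogeneous components must again be spans of symbols, so the grading travels with the
    coordinates as [bicoord]. The sign in the product of B then arises letter by letter, one
    application of O for each letter. *)

Section LinearExtension.
Variables (F : fieldType) (K : choiceType).
Implicit Types (V W : lmodType F) (x : {malg F[K]}).

(** Sums over different supports become comparable over a common larger set; linearity below uses
    the union of three supports. *)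
Lemma malg_liftEw V (f : K -> V) x (d : {fset K}) : (msupp x `<=` d)%fset ->
  malg_lift f x = \sum_(k <- d) x@_k *: f k.
Proof.
move=> sxd; rewrite /malg_lift (big_fset_incl _ sxd) //= => k _.
by move/mcoeff_outdom->; rewrite scale0r.
Qed.

Lemma malg_lift_is_linear V (f : K -> V) : linear (malg_lift f).
Proof.
move=> c x y; pose d := (msupp x `|` msupp y `|` msupp (c *: x + y))%fset.
rewrite !(@malg_liftEw _ _ _ d) ?fsubsetUr // /d.
- rewrite scaler_sumr -big_split /=; apply: eq_bigr => k _.
  by rewrite mcoeffD mcoeffZ scalerDl scalerA.
- by rewrite -fsetUA fsetUCA fsubsetUl.
- by rewrite -fsetUA fsubsetUl.
Qed.

HB.instance Definition _ V (f : K -> V) :=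
  GRing.isLinear.Build F {malg F[K]} V _ (malg_lift f) (malg_lift_is_linear f).

Lemma malg_liftU V (f : K -> V) k : malg_lift f << k >> = f k.
Proof. by rewrite /malg_lift msuppU oner_eq0 big_seq_fset1 mcoeffUU scale1r. Qed.

Lemma eq_malg_lift_in V (f g : K -> V) x :
  (forall k, k \in msupp x -> f k = g k) -> malg_lift f x = malg_lift g x.
Proof. by move=> fg; apply: eq_big_seq => k /fg->. Qed.

Lemma eq_malg_lift V (f g : K -> V) x :
  (forall k, f k = g k) -> malg_lift f x = malg_lift g x.
Proof. by move=> fg; apply: eq_malg_lift_in => k _. Qed.

Lemma linear_malg_lift V W (h : {linear V -> W}) (f : K -> V) x :
  h (malg_lift f x) = malg_lift (fun k => h (f k)) x.
Proof. by rewrite linear_sum; apply: eq_bigr => k _; rewrite linearZ. Qed.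

Lemma malg_lift_id x : malg_lift (fun k => << k >>) x = x.
Proof.
rewrite [RHS]monalgE; apply: eq_bigr => k _.
by apply/malgP => k'; rewrite mcoeffZ !mcoeffU mulr_natr.
Qed.

Lemma linear_malgE V (h : {linear {malg F[K]} -> V}) x :
  h x = malg_lift (fun k => h << k >>) x.
Proof. by rewrite -linear_malg_lift malg_lift_id. Qed.

Lemma malg_liftDr V (f g : K -> V) x c :
  malg_lift (fun k => c *: f k + g k) x = c *: malg_lift f x + malg_lift g x.
Proof.
rewrite scaler_sumr -big_split; apply: eq_bigr => k _.
by rewrite scalerDr !scalerA mulrC.
Qed.

(** Expresses homogeneity as well as membership in the span of a set of symbols; degrees are
    conditions in [Prop], hence no boolean predicate. *)
Definition supported (P : K -> Prop) x := forall k, k \in msupp x -> P k.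

Lemma supported0 P : supported P 0.
Proof. by move=> k; rewrite msupp0 inE. Qed.

Lemma supportedU (P : K -> Prop) k : P k -> supported P << k >>.
Proof. by move=> Pk k'; rewrite msuppU oner_eq0 inE => /eqP->. Qed.

Lemma supportedP P c x y : supported P x -> supported P y ->
  supported P (c *: x + y).
Proof.
move=> Px Py k /(fsubsetP (msuppD_le _ _)); rewrite inE => /orP[|/Py//].
by move=> /(fsubsetP (msuppZ_le _ _))/Px.
Qed.

Lemma supported_sum P (I : Type) (r : seq I) (Q : pred I) (G : I -> {malg F[K]}) :
  (forall i, Q i -> supported P (G i)) -> supported P (\sum_(i <- r | Q i) G i).
Proof.
move=> PG; apply: (big_ind (supported P)); first exact: supported0.
  by move=> x y Px Py; rewrite -[x]scale1r; apply: supportedP.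
exact: PG.
Qed.

Lemma supportedZ P c x : supported P x -> supported P (c *: x).
Proof. by move=> Px; rewrite -[_ *: _]addr0; apply: supportedP => //; apply: supported0. Qed.

Lemma supported_sub (P Q : K -> Prop) x :
  (forall k, P k -> Q k) -> supported P x -> supported Q x.
Proof. by move=> PQ Px k /Px/PQ. Qed.

Lemma supported_eq0 (P : K -> Prop) x : (forall k, ~ P k) -> supported P x -> x = 0.
Proof.
move=> nP Px; apply/malgP => k; rewrite mcoeff0 mcoeff_outdom //.
by apply/negP => /Px/nP.
Qed.

End LinearExtension.

Lemma supported_lift (F : fieldType) (K K' : choiceType) (P : K' -> Prop)
    (f : K -> {malg F[K']}) x :
  (forall k, k \in msupp x -> supported P (f k)) -> supported P (malg_lift f x).
Proof.
move=> Pf; rewrite /malg_lift big_seq; apply: supported_sum => k kx.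
by apply: supportedZ; apply: Pf.
Qed.

Section BilinearExtension.
Variables (F : fieldType).
Implicit Types (K L M N : choiceType) (V W : lmodType F).

(** Convertible to [malg_lift2] when [K] and [L] agree, so that the products of the algebras unfold
    to it; two symbol types are needed to pair coordinates of different algebras. *)
Definition bilift K L V (f : K -> L -> V) (x : {malg F[K]}) (y : {malg F[L]}) : V :=
  malg_lift (fun k => malg_lift (f k) y) x.

Lemma bilift_is_linearl K L V (f : K -> L -> V) y :
  linear (fun x => bilift f x y).
Proof. by move=> c x x'; rewrite /bilift linearP. Qed.

Lemma bilift_is_linearr K L V (f : K -> L -> V) x : linear (bilift f x).
Proof.
move=> c y y'; rewrite /bilift -malg_liftDr.
by apply: eq_malg_lift => k; rewrite linearP.
Qed.

HB.instance Definition _ K L V (f : K -> L -> V) x :=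
  GRing.isLinear.Build F {malg F[L]} V _ (bilift f x) (bilift_is_linearr f x).

(** With the arguments exchanged, linearity in the first variable can be registered as a structure
    too. *)
Definition biliftr K L V (f : K -> L -> V) y x := bilift f x y.
HB.instance Definition _ K L V (f : K -> L -> V) y :=
  GRing.isLinear.Build F {malg F[K]} V _ (biliftr f y) (bilift_is_linearl f y).

Lemma biliftUU K L V (f : K -> L -> V) k l : bilift f << k >> << l >> = f k l.
Proof. by rewrite /bilift !malg_liftU. Qed.

Lemma biliftUr K L V (f : K -> L -> V) k y :
  bilift f << k >> y = malg_lift (f k) y.
Proof. by rewrite /bilift !malg_liftU. Qed.

Lemma biliftlU K L V (f : K -> L -> V) x l :
  bilift f x << l >> = malg_lift (f^~ l) x.
Proof. by apply: eq_malg_lift => k; rewrite !malg_liftU. Qed.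

Lemma bilift0l K L V (f : K -> L -> V) y : bilift f 0 y = 0.
Proof. exact: (linear0 (biliftr f y)). Qed.

Lemma bilift0r K L V (f : K -> L -> V) x : bilift f x 0 = 0.
Proof. exact: linear0. Qed.

Lemma biliftPl K L V (f : K -> L -> V) c x x' y :
  bilift f (c *: x + x') y = c *: bilift f x y + bilift f x' y.
Proof. exact: bilift_is_linearl. Qed.

Lemma biliftPr K L V (f : K -> L -> V) c x y y' :
  bilift f x (c *: y + y') = c *: bilift f x y + bilift f x y'.
Proof. exact: bilift_is_linearr. Qed.

Lemma biliftZl K L V (f : K -> L -> V) c x y :
  bilift f (c *: x) y = c *: bilift f x y.
Proof. by rewrite -[c *: x]addr0 biliftPl bilift0l addr0. Qed.

Lemma biliftZr K L V (f : K -> L -> V) c x y :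
  bilift f x (c *: y) = c *: bilift f x y.
Proof. by rewrite -[c *: y]addr0 biliftPr bilift0r addr0. Qed.

Lemma eq_bilift_in K L V (f g : K -> L -> V) x y :
  (forall k l, k \in msupp x -> l \in msupp y -> f k l = g k l) ->
  bilift f x y = bilift g x y.
Proof.
move=> fg; apply: eq_malg_lift_in => k kx; apply: eq_malg_lift_in => l ly.
exact: fg.
Qed.

Lemma eq_bilift K L V (f g : K -> L -> V) x y :
  (forall k l, f k l = g k l) -> bilift f x y = bilift g x y.
Proof. by move=> fg; apply: eq_bilift_in. Qed.

Lemma linear_bilift K L V W (h : {linear V -> W}) (f : K -> L -> V) x y :
  h (bilift f x y) = bilift (fun k l => h (f k l)) x y.
Proof.
rewrite /bilift linear_malg_lift; apply: eq_malg_lift => k.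
exact: linear_malg_lift.
Qed.

(** Reduces a product of two images to pairs of symbols; most proofs that a coordinate map is
    multiplicative go through it. *)
Lemma bilift_lift K L M N V (m : M -> N -> V) (f : K -> {malg F[M]})
    (g : L -> {malg F[N]}) x y :
  bilift m (malg_lift f x) (malg_lift g y) =
  bilift (fun k l => bilift m (f k) (g l)) x y.
Proof.
rewrite -[LHS]/(biliftr m (malg_lift g y) (malg_lift f x)) linear_malg_lift.
apply: eq_malg_lift => k.
exact: (linear_malg_lift (bilift m (f k))).
Qed.

Lemma supported_bilift K L M (P : M -> Prop) (f : K -> L -> {malg F[M]}) x y :
  (forall k l, k \in msupp x -> l \in msupp y -> supported P (f k l)) ->
  supported P (bilift f x y).
Proof.
move=> Pf; apply: supported_lift => k kx; apply: supported_lift => l ly.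
exact: Pf.
Qed.

Lemma biliftZ K L V (f : K -> L -> V) c x y :
  c *: bilift f x y = bilift (fun k l => c *: f k l) x y.
Proof.
exact: (linear_bilift ( *:%R c : {linear V -> V})).
Qed.

Lemma bilift_swap K L V (f : K -> L -> V) x y :
  bilift f x y = bilift (fun l k => f k l) y x.
Proof.
rewrite [RHS]/bilift /bilift /malg_lift.
under eq_bigr do rewrite scaler_sumr; rewrite exchange_big /=.
apply: eq_bigr => l _; rewrite scaler_sumr; apply: eq_bigr => k _.
by rewrite !scalerA mulrC.
Qed.

End BilinearExtension.

(** * Quotients and coordinates *)

Section Span.
Variables (F : fieldType) (V : lmodType F).
Implicit Types S T : V -> Prop.

Lemma lspanP S v : v \in lspan_pred S <-> lspan S v.
Proof. by rewrite unfold_in; split=> /asboolP. Qed.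

Lemma lspan_gen S v : S v -> lspan S v.
Proof. by move=> Sv; rewrite -[v]scale1r -[_ *: _]addr0; apply/lspanS/lspan0. Qed.

Lemma lspan_lin S (c : F) u v : lspan S u -> lspan S v -> lspan S (c *: u + v).
Proof. by rewrite -!lspanP => Su Sv; rewrite rpredD ?rpredZ. Qed.

Lemma lspan_sum S (I : eqType) (r : seq I) (c : I -> F) (f : I -> V) :
  (forall i, i \in r -> lspan S (f i)) -> lspan S (\sum_(i <- r) c i *: f i).
Proof.
move=> Sf; apply/lspanP; rewrite big_seq; apply: rpred_sum => i ri.
by apply/rpredZ/lspanP/Sf.
Qed.

Lemma lspan_sub S T v :
  (forall u, S u -> lspan T u) -> lspan S v -> lspan T v.
Proof.
move=> ST; elim=> [|c u w /ST Tu _ Tw]; first exact: lspan0.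
by apply/lspanP; rewrite rpredD ?rpredZ //; apply/lspanP.
Qed.

Lemma lspan_ind_lin S T v :
  (forall u, S u -> T u) -> T 0 ->
  (forall c u w, T u -> T w -> T (c *: u + w)) -> lspan S v -> T v.
Proof. by move=> ST T0 TP; elim=> // c u w /ST Tu _; apply: TP. Qed.

End Span.

Section Quotient.
Variables (F : fieldType) (V W : lmodType F) (S : V -> Prop).

Lemma lproj_is_linear : linear (lproj S).
Proof. by move=> c x y; rewrite lprojD -lqscaleE. Qed.

HB.instance Definition _ :=
  GRing.isLinear.Build F V (lquot S) _ (lproj S) lproj_is_linear.

Lemma lproj_eqP u v : lproj S u = lproj S v <-> lspan S (u - v).
Proof. by rewrite -lspanP -lproj_eq; split=> [->|/eqP]. Qed.

Lemma lproj0P v : S v -> lproj S v = 0.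
Proof.
by move=> Sv; rewrite -(linear0 (lproj S)); apply/lproj_eqP; rewrite subr0; apply: lspan_gen.
Qed.

Variable f : {linear V -> W}.

Definition qlift (_ : forall v, S v -> f v = 0) (x : lquot S) : W := f (repr x).

Variable f0 : forall v, S v -> f v = 0.

Lemma qliftE v : qlift f0 (lproj S v) = f v.
Proof.
apply/eqP; rewrite /qlift -subr_eq0 -linearB; apply/eqP.
have : lspan S (repr (lproj S v) - v) by apply/lproj_eqP; rewrite lreprK.
apply: (lspan_ind_lin (T := fun u => f u = 0)) => //; first exact: linear0.
by move=> c u w fu fw; rewrite linearP fu fw scaler0 addr0.
Qed.

Lemma qlift_is_linear : linear (qlift f0).
Proof.
move=> c x y; rewrite -[x]lreprK -[y]lreprK -linearP !qliftE.
exact: linearP.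
Qed.

HB.instance Definition _ :=
  GRing.isLinear.Build F (lquot S) W _ (qlift f0) qlift_is_linear.

End Quotient.

Lemma lproj_rel_linear (F : fieldType) (V : lmodType F) (S : V -> Prop) (c : F) u v w :
  S (u - c *: v - w) -> lproj S u = c *: lproj S v + lproj S w.
Proof.
move=> Suvw; rewrite -lproj_is_linear; apply/lproj_eqP/lspan_gen.
by rewrite opprD addrA.
Qed.

(** The linearity relations in the presentations of tensor products, of the tensor algebra, of O and
    of the direct limit all have the shape [u - c *: v - w]. *)
Lemma linear_rel0 (F : fieldType) (V W : lmodType F) (f : {linear V -> W}) c u v w
    u' v' w' : f u = u' -> f v = v' -> f w = w' -> u' = c *: v' + w' ->
  f (u - c *: v - w) = 0.
Proof. by move=> <- <- <- e; rewrite !linearB linearZ e /= addrAC addrK subrr. Qed.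

Lemma linear_sub0 (F : fieldType) (V W : lmodType F) (f : {linear V -> W}) u v u' :
  f u = u' -> f v = u' -> f (u - v) = 0.
Proof. by move=> eu ev; rewrite linearB eu ev subrr. Qed.

Section NAlg.
Variables (F : fieldType).
Implicit Types A : nalg F.

Definition nbilinear A :=
  (forall (c : F) (x y z : A), ((c *: x + y) * z)%A = c *: (x * z)%A + (y * z)%A) /\
  (forall (c : F) (x y z : A), (z * (c *: x + y))%A = c *: (z * x)%A + (z * y)%A).

Section Bilinear.
Variables (A : nalg F) (A_bilin : nbilinear A).
Implicit Types R : A -> Prop.

Lemma nmul0l (x : A) : (0 * x)%A = 0.
Proof.
have := A_bilin.1 1 0 0 x; rewrite !scale1r addr0.
by rewrite -[X in X = _]addr0 => /addrI.
Qed.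

Lemma nmul0r (x : A) : (x * 0)%A = 0.
Proof.
have := A_bilin.2 1 0 0 x; rewrite !scale1r addr0.
by rewrite -[X in X = _]addr0 => /addrI.
Qed.

Lemma nmulDl (x y z : A) : ((x + y) * z)%A = (x * z)%A + (y * z)%A.
Proof. by have := A_bilin.1 1 x y z; rewrite !scale1r. Qed.

Lemma nmulBl (x y z : A) : ((x - y) * z)%A = (x * z)%A - (y * z)%A.
Proof. by rewrite -scaleN1r addrC A_bilin.1 scaleN1r addrC. Qed.

Lemma nmulBr (x y z : A) : (z * (x - y))%A = (z * x)%A - (z * y)%A.
Proof. by rewrite -scaleN1r addrC A_bilin.2 scaleN1r addrC. Qed.

(** [nquot] divides by the span of the ideal; the ideal is already a subspace, so equality in the
    quotient is membership in the ideal itself. *)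
Lemma nideal_lspan R u : lspan (nideal R) u -> nideal R u.
Proof.
by apply: (lspan_ind_lin (T := nideal R)) => //; [apply: nideal0 | move=> *; apply: nidealP].
Qed.

Lemma nproj_eq R u v : nproj R u = nproj R v <-> nideal R (u - v).
Proof.
split=> [/lproj_eqP/nideal_lspan //|Ruv]; apply/lproj_eqP.
exact: lspan_gen.
Qed.

Lemma nproj_eq0 R u : nideal R u -> nproj R u = 0.
Proof. exact: lproj0P. Qed.

(** The product of the quotient is that of the representatives [u'] and [v']; the error telescopes
    into two terms, each with a factor in the ideal. *)
Lemma nprojM R (u v : A) :
  nproj R (u * v)%A = (nproj R u * nproj R v)%A.
Proof.
apply/nproj_eq.
set u' := repr (lproj (nideal R) u); set v' := repr (lproj (nideal R) v).
have Ru : nideal R (u - u') by apply/nproj_eq; rewrite /nproj lreprK.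
have Rv : nideal R (v - v') by apply/nproj_eq; rewrite /nproj lreprK.
have -> : (u * v)%A - (u' * v')%A = 1 *: ((u - u') * v)%A + (u' * (v - v'))%A.
  by rewrite scale1r nmulBl nmulBr addrA subrK.
by apply: nidealP; [apply: nidealMr | apply: nidealMl].
Qed.

Lemma nquot_bilinear (R : A -> Prop) : nbilinear (nquot R).
Proof.
split=> c x y z; rewrite -[x]lreprK -[y]lreprK -[z]lreprK.
  rewrite -linearP -!/(nproj R _) -!nprojM A_bilin.1.
  exact: (linearP (lproj (nideal R))).
rewrite -linearP -!/(nproj R _) -!nprojM A_bilin.2.
exact: (linearP (lproj (nideal R))).
Qed.

End Bilinear.

Arguments nprojM {A} A_bilin {R} u v.


Section QuotientLift.
Variables (A : nalg F) (K : choiceType) (m : K -> K -> {malg F[K]}).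
Variables (f : {linear A -> {malg F[K]}}).
Hypothesis fM : forall x y : A, f (x * y)%A = bilift m (f x) (f y).
Variables (R : A -> Prop) (f0 : forall u, R u -> f u = 0).

Lemma nideal_kill u : nideal R u -> f u = 0.
Proof.
elim=> {u}; first exact: linear0.
- by move=> c u v _ fu _ fv; rewrite linearP fu fv scaler0 addr0.
- exact: f0.
- by move=> u v _ fv; rewrite fM fv bilift0r.
- by move=> u v _ fu; rewrite fM fu bilift0l.
Qed.

Definition nqlift : nquot R -> {malg F[K]} := qlift nideal_kill.
HB.instance Definition _ := GRing.Linear.on nqlift.

Lemma nqliftE u : nqlift (nproj R u) = f u.
Proof. exact: qliftE. Qed.

Lemma nqliftM (x y : nquot R) : nqlift (x * y)%A = bilift m (nqlift x) (nqlift y).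
Proof. by rewrite -fM; apply: qliftE. Qed.

End QuotientLift.

(** Linear independence is implicit in [ncoord_elt], since distinct symbols are independent. Symbols
    outside [P] name nothing: supports of coordinates lie in [P] by [ncoord_supported], so the
    values of [e] and [m] elsewhere never enter. *)
Record ncoord A (K : choiceType) (P : pred K) (e : K -> A)
    (m : K -> K -> {malg F[K]}) := NCoord {
  ncf :> {linear A -> {malg F[K]}};
  ncoord_elt : forall k, P k -> ncf (e k) = << k >>;
  ncoord_span : forall a, lspan (fun v => exists2 k, P k & v = e k) a;
  ncoordM : forall x y, ncf (x * y)%A = bilift m (ncf x) (ncf y)
}.

Section Coordinates.
Variables (A : nalg F) (K : choiceType) (P : pred K) (e : K -> A).
Variables (m : K -> K -> {malg F[K]}) (phi : ncoord P e m).

Lemma ncoordK a : malg_lift e (phi a) = a.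
Proof.
have := ncoord_span phi a; apply: (lspan_ind_lin (T := fun u => malg_lift e (phi u) = u)).
- by move=> u [k Pk ->]; rewrite ncoord_elt // malg_liftU.
- by rewrite !linear0.
- by move=> c u w eu ew; rewrite linearP malg_lift_is_linear eu ew.
Qed.

Lemma ncoord_inj : injective phi.
Proof. exact: can_inj ncoordK. Qed.

Lemma ncoord_supported a : supported P (phi a).
Proof.
have := ncoord_span phi a; apply: (lspan_ind_lin (T := fun u => supported P (phi u))).
- by move=> u [k Pk ->]; rewrite ncoord_elt //; apply: supportedU.
- by rewrite linear0; apply: supported0.
- by move=> c u w eu ew; rewrite linearP; apply: supportedP.
Qed.

Lemma ncoord_bilinear : nbilinear A.
Proof.
by split=> c x y z; apply: ncoord_inj; rewrite linearP !ncoordM linearP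
  ?biliftPl ?biliftPr.
Qed.

Lemma ncoord_mul k l : P k -> P l -> (e k * e l)%A = malg_lift e (m k l).
Proof.
by move=> Pk Pl; rewrite -[LHS]ncoordK ncoordM !ncoord_elt // biliftUU.
Qed.

End Coordinates.

End NAlg.

(** * The preprojective algebra *)

Definition malg_opt (F : fieldType) (K : choiceType) (o : option K) : {malg F[K]} :=
  if o is Some k then << k >> else 0.
Arguments malg_opt : simpl never.

Section PreprojectiveAlgebra.
Variables (F : fieldType).
Implicit Types (s : int) (w : qpath) (b : piB).

Lemma pathalg_bilinear : nbilinear (pathalg F).
Proof. by split=> c x y z; [apply: biliftPl | apply: biliftPr]. Qed.

Lemma Pi_bilinear : nbilinear (Pi F).
Proof. exact/nquot_bilinear/pathalg_bilinear. Qed.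

Lemma qpath_eltM v w : (qpath_elt F v * qpath_elt F w)%A = qpath_mul F v w.
Proof. exact: biliftUU. Qed.

Lemma Pi_pathM v w : qpath_end v = w.1 ->
  (Pi_path F v * Pi_path F w)%A = Pi_path F (v.1, v.2 ++ w.2).
Proof.
move=> vw; rewrite /Pi_path -(nprojM pathalg_bilinear) qpath_eltM.
by rewrite /qpath_mul vw eqxx.
Qed.

Lemma qpath_endE w :
  qpath_end w = w.1 + (count_mem true w.2)%:Z - (count_mem false w.2)%:Z.
Proof.
rewrite /qpath_end -addrA; congr (_ + _).
elim: w.2 => [|b u IH]; first by rewrite big_nil.
by rewrite big_cons IH; case: b => /=; lia.
Qed.

Lemma Pi_path_swap s u :
  Pi_path F (s, true :: false :: u) = Pi_path F (s, false :: true :: u).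
Proof.
have e (b : bool) : qpath_end (s, [:: b; ~~ b]) = s.
  by rewrite qpath_endE; case: b => /=; lia.
rewrite -[LHS](Pi_pathM (v := (s, [:: true; false])) (w := (s, u)) (e true)).
rewrite -[RHS](Pi_pathM (v := (s, [:: false; true])) (w := (s, u)) (e false)).
congr (nmul _ _); apply/nproj_eq.
exact/nideal_gen/Pi_rel_xy.
Qed.

Lemma Pi_path_cons s (b : bool) u :
  Pi_path F (s, b :: u) =
  (Pi_path F (s, [:: b]) * Pi_path F (qpath_end (s, [:: b]), u))%A.
Proof. by rewrite Pi_pathM. Qed.

Definition path_piB w : piB :=
  (w.1, count_mem true w.2, count_mem false w.2).

(** The relation lets every [y] move in front of every [x], so a path depends only on its first
    vertex and the numbers of its arrows of each kind. *)
Lemma Pi_path_sorted w : Pi_path F w = piB_elt F (path_piB w).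
Proof.
case: w => s u; elim: u s => [|b u IH] s //.
set al := count_mem true u; set be := count_mem false u.
transitivity (Pi_path F (s, b :: (nseq be false ++ nseq al true))).
  by rewrite Pi_path_cons IH [RHS]Pi_path_cons.
case: b; rewrite /piB_elt /path_piB /= !(add0n, add1n) -/al -/be //.
(* A leading [y] is in place already; a leading [x] has to pass the [be] letters [y] one at a
   time. *)
elim: be s => //= n IHn s.
by rewrite Pi_path_swap Pi_path_cons IHn [RHS]Pi_path_cons.
Qed.

Definition piB_struct b b' : {malg F[piB]} := malg_opt F (piB_mul b b').

Definition path_coord : {malg F[qpath]} -> {malg F[piB]} :=
  malg_lift (fun w => << path_piB w >>).
HB.instance Definition _ := GRing.Linear.on path_coord.

Lemma path_coordU w : path_coord (qpath_elt F w) = << path_piB w >>.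
Proof. exact: malg_liftU. Qed.

Lemma path_coordM (x y : pathalg F) :
  path_coord (x * y)%A = bilift piB_struct (path_coord x) (path_coord y).
Proof.
rewrite [RHS]bilift_lift (linear_bilift path_coord); apply: eq_bilift => v w.
rewrite biliftUU /qpath_mul /piB_struct /= qpath_endE eq_sym.
case: ifP => _; last exact: linear0.
by apply: etrans (path_coordU _) _; rewrite /path_piB /= !count_cat.
Qed.

Lemma path_coord_rel (x : pathalg F) : Pi_rel x -> path_coord x = 0.
Proof.
case=> s; apply/eqP; rewrite linearB subr_eq0; apply/eqP.
by apply: etrans (path_coordU _) (etrans _ (esym (path_coordU _))).
Qed.

Definition Pi_coord_fun : Pi F -> {malg F[piB]} := nqlift path_coordM path_coord_rel.
HB.instance Definition _ := GRing.Linear.on Pi_coord_fun.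

Lemma Pi_coord_path w : Pi_coord_fun (Pi_path F w) = << path_piB w >>.
Proof. by rewrite -path_coordU; apply: nqliftE. Qed.

Lemma count_piB s al be : path_piB (s, nseq be false ++ nseq al true) = (s, al, be).
Proof. by rewrite /path_piB /= !count_cat !count_nseq /= !mul0n !mul1n addn0. Qed.

Lemma Pi_coord_elt b : Pi_coord_fun (piB_elt F b) = << b >>.
Proof. by case: b => [[s al] be]; rewrite Pi_coord_path count_piB. Qed.

Lemma Pi_coord_span (u : Pi F) :
  lspan (fun v => exists2 b, predT b & v = piB_elt F b) u.
Proof.
rewrite -[u]lreprK -[repr u]malg_lift_id linear_malg_lift.
apply: lspan_sum => w _; apply: lspan_gen; exists (path_piB w) => //.
exact: Pi_path_sorted.
Qed.

Definition Pi_coord : ncoord predT (piB_elt F) piB_struct :=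
  NCoord (ncf := Pi_coord_fun) (fun b _ => Pi_coord_elt b) Pi_coord_span
    (nqliftM path_coordM path_coord_rel).

End PreprojectiveAlgebra.

(** * The algebra Omega *)

Section Restriction.
Variables (F : fieldType) (K : choiceType).
Implicit Types (P Q : pred K) (x : {malg F[K]}).

(** The projection that models a quotient by the span of the symbols outside [P]. *)
Definition malg_restrict P : {malg F[K]} -> {malg F[K]} :=
  malg_lift (fun k => if P k then << k >> else 0).
HB.instance Definition _ P := GRing.Linear.on (malg_restrict P).

Lemma malg_restrictU P k : malg_restrict P << k >> = if P k then << k >> else 0.
Proof. exact: malg_liftU. Qed.

Lemma malg_restrict_id P x : supported P x -> malg_restrict P x = x.
Proof.
by move=> Px; rewrite -[RHS]malg_lift_id; apply: eq_malg_lift_in => k /Px->.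
Qed.

Lemma malg_restrict_sub P Q x : (forall k, Q k -> P k) ->
  malg_restrict Q (malg_restrict P x) = malg_restrict Q x.
Proof.
move=> QP; rewrite linear_malg_lift; apply: eq_malg_lift => k.
case: ifP => [_|/negP nPk]; first exact: malg_liftU.
by case: ifP => [/QP//|_]; apply: linear0.
Qed.

(** The hypothesis says that the discarded symbols behave like an ideal; the projection is then
    multiplicative. It is required on the supports only, since for [Omega] it fails on arbitrary
    symbols of B_Pi. *)
Lemma malg_restrict_bilift (m : K -> K -> {malg F[K]}) P x y :
  (forall k l, k \in msupp x -> l \in msupp y ->
     ~~ (P k && P l) -> malg_restrict P (m k l) = 0) ->
  malg_restrict P (bilift m x y) =
  bilift (fun k l => malg_restrict P (m k l)) (malg_restrict P x) (malg_restrict P y).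
Proof.
move=> m0; rewrite linear_bilift bilift_lift.
apply: eq_bilift_in => k l kx ly; have := m0 k l kx ly.
case: (P k) => /= [|->//]; last by rewrite bilift0l.
by case: (P l) => /= [_|->//]; [rewrite biliftUU | rewrite bilift0r].
Qed.

End Restriction.

Section Subalgebra.
Variables (F : fieldType) (A : nalg F) (G : A -> Prop).

Lemma nsubalg_lspanP u : u \in lspan_pred (nsubalg G) <-> nsubalg G u.
Proof.
rewrite lspanP; split=> [|Gu]; last exact: lspan_gen.
apply: (lspan_ind_lin (T := nsubalg G)) => //; first exact: nsubalg0.
by move=> *; apply: nsubalgP.
Qed.

Lemma nsub_valP (x : nsub G) : nsubalg G (val x).
Proof. exact/nsubalg_lspanP/valP. Qed.

Lemma nsub_insubdK u : nsubalg G u -> val (insubd (0 : nsub G) u) = u.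
Proof. by move=> Gu; apply: insubdK; apply/nsubalg_lspanP. Qed.

Lemma nsub_valM (x y : nsub G) : val (x * y)%A = (val x * val y)%A.
Proof. by apply: nsub_insubdK; apply: nsubalgM; apply: nsub_valP. Qed.

Lemma nsub_val_linear : linear (val : nsub G -> A).
Proof. by []. Qed.

Hypothesis A_bilin : nbilinear A.

Lemma nsub_bilinear : nbilinear (nsub G).
Proof.
split=> c x y z; apply: val_inj.
  by rewrite nsub_val_linear !nsub_valM nsub_val_linear A_bilin.1.
by rewrite nsub_val_linear !nsub_valM nsub_val_linear A_bilin.2.
Qed.

End Subalgebra.

(** * Subalgebras of the preprojective algebra given by full subquivers *)

Section PiSubalgebras.
Variable F : fieldType.
Implicit Types (b c : piB) (I : pred int).

Lemma piB_eltM b b' c : piB_mul b b' = Some c ->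
  (piB_elt F b * piB_elt F b')%A = piB_elt F c.
Proof.
by move=> bb'; rewrite (ncoord_mul (Pi_coord F)) // /piB_struct bb' malg_liftU.
Qed.

(** Gives the upper bound on the subalgebra of a full subquiver, as [piB_elt_subalg] gives the lower
    one. *)
Lemma Pi_gen_supported I (Q : pred piB) (u : Pi F) :
  (forall s, I s -> Q (s, 0, 0)%N) ->
  (forall s, I s -> I (s + 1) -> Q (s, 1, 0)%N) ->
  (forall s, I s -> I (s + 1) -> Q (s + 1, 0%N, 1%N)) ->
  (forall b b' c, piB_mul b b' = Some c -> Q b -> Q b' -> Q c) ->
  nsubalg (Pi_gen (F := F) I) u -> supported Q (Pi_coord F u).
Proof.
move=> Qe Qx Qy QM; elim=> {u}.
- by rewrite linear0; apply: supported0.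
- by move=> c u v _ Qu _ Qv; rewrite linearP; apply: supportedP.
- by move=> u [] *; rewrite [X in supported _ X]Pi_coord_path; apply: supportedU;
    [apply: Qe | apply: Qx | apply: Qy].
- move=> u v _ Qu _ Qv; rewrite ncoordM; apply: supported_bilift => b b' bu b'v.
  rewrite /piB_struct; case bb': (piB_mul b b') => [c|]; last exact: supported0.
  by apply: supportedU; apply: QM bb' _ _; [apply: Qu | apply: Qv].
Qed.

(** The sorted path descends from [s] to [s - be] and then climbs to [s - be + al]; the hypothesis
    lists the vertices visited on the way. *)
Lemma piB_elt_subalg I (s : int) (al be : nat) :
  (forall t, s - be%:Z <= t -> t <= s \/ t <= s - be%:Z + al%:Z -> I t) ->
  nsubalg (Pi_gen (F := F) I) (piB_elt F (s, al, be)).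
Proof.
elim: be s => [|be IH] s Is.
  elim: al s Is => [|al IH] s Is.
    by apply/nsubalg_gen/Pi_gen_e/Is; [|left]; lia.
  have -> : piB_elt F (s, al.+1, 0%N) =
      (Pi_path F (s, [:: true]) * piB_elt F (s + 1, al, 0%N))%A.
    by rewrite Pi_pathM //= qpath_endE /=; lia.
  apply: nsubalgM; last by apply: IH => t t1 t2; apply: Is; lia.
  by apply/nsubalg_gen/Pi_gen_x; apply: Is; lia.
have -> : piB_elt F (s, al, be.+1) =
    (Pi_path F (s, [:: false]) * piB_elt F (s - 1, al, be))%A.
  by rewrite Pi_pathM //= qpath_endE /=; lia.
apply: nsubalgM; last by apply: IH => t t1 t2; apply: Is; lia.
rewrite -[X in Pi_path _ (X, _)](subrK 1 s).
by apply/nsubalg_gen/Pi_gen_y; apply: Is; lia.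
Qed.

End PiSubalgebras.

Section OmegaBasis.
Variables (F : fieldType) (p : nat).
Implicit Types (b c : piB).

(** Bounding the two ends suffices: a sorted path descends first, so its highest vertex is one of
    its ends. *)
Definition in_Le b : bool :=
  let: (s, al, be) := b in (s <= p%:Z) && (s + al%:Z - be%:Z <= p%:Z).

Lemma BOmega_Le b : in_BOmega p b -> in_Le b.
Proof. by case: b => [[s al] be] /=; lia. Qed.

(** Within [in_Le], the set [in_BOmega] is cut out by the lowest vertex [s - be] being at least 1.
    Neither factor descends below the lowest vertex of the product, so the other symbols of [in_Le]
    span an ideal. *)
Lemma BOmega_factor b b' c : piB_mul b b' = Some c -> in_Le b -> in_Le b' ->
  in_BOmega p c -> in_BOmega p b && in_BOmega p b'.
Proof.
case: b b' => [[s al] be] [[s' al'] be'] /=; case: eqP => // -> [<-] /=; lia.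
Qed.

Definition Omega_struct b b' : {malg F[piB]} :=
  malg_restrict (in_BOmega p) (piB_struct F b b').

Lemma Omega_structE b b' : in_Le b -> in_Le b' ->
  ~~ (in_BOmega p b && in_BOmega p b') -> Omega_struct b b' = 0.
Proof.
move=> Lb Lb'; rewrite /Omega_struct /piB_struct.
case bb': (piB_mul b b') => [c|] nb; last exact: linear0.
rewrite [LHS]malg_restrictU; case: ifP => // Oc.
by rewrite (BOmega_factor bb') in nb.
Qed.

Lemma Pi_le_supported (u : Pi_le F p) : supported in_Le (Pi_coord F (val u)).
Proof.
apply: Pi_gen_supported (nsub_valP u); try by move=> s /=; lia.
by case=> [[s al] be] [[s' al'] be'] c /=; case: eqP => // -> [<-] /=; lia.
Qed.

Definition Pi_le_coord (u : Pi_le F p) : {malg F[piB]} :=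
  malg_restrict (in_BOmega p) (Pi_coord F (val u)).

Lemma Pi_le_coord_is_linear : linear Pi_le_coord.
Proof. by move=> c u v; rewrite /Pi_le_coord nsub_val_linear !linearP. Qed.

HB.instance Definition _ :=
  GRing.isLinear.Build F (Pi_le F p) {malg F[piB]} _ _ Pi_le_coord_is_linear.

Lemma Pi_le_coordM (u v : Pi_le F p) :
  Pi_le_coord (u * v)%A = bilift Omega_struct (Pi_le_coord u) (Pi_le_coord v).
Proof.
rewrite /Pi_le_coord nsub_valM ncoordM; apply: malg_restrict_bilift => b b' ub vb'.
by apply: Omega_structE; [apply: Pi_le_supported ub | apply: Pi_le_supported vb'].
Qed.

Lemma Pi_le_coord_rel (u : Pi_le F p) : Omega_rel u -> Pi_le_coord u = 0.
Proof.
case=> s {}u s_le0 us; rewrite /Pi_le_coord us [Pi_coord F _]Pi_coord_path.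
by rewrite malg_restrictU ifN //= ; lia.
Qed.

Definition Omega_coord_fun : Omega F p -> {malg F[piB]} :=
  nqlift Pi_le_coordM Pi_le_coord_rel.
HB.instance Definition _ := GRing.Linear.on Omega_coord_fun.

Lemma toOmega_val (u : Pi_le F p) : toOmega p (val u) = nproj (Omega_rel (p := p)) u.
Proof. by rewrite /toOmega valKd. Qed.

Definition Pi_le_mem : Pi F -> Prop := nsubalg (Pi_gen (F := F) (fun s => s <= p%:Z)).

Lemma Omega_bilinear : nbilinear (Omega F p).
Proof. exact/nquot_bilinear/nsub_bilinear/Pi_bilinear. Qed.

Lemma toOmegaM (u v : Pi F) : Pi_le_mem u -> Pi_le_mem v ->
  toOmega p (u * v)%A = (toOmega p u * toOmega p v)%A.
Proof.
move=> /nsub_insubdK<- /nsub_insubdK<-.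
rewrite -nsub_valM !toOmega_val; apply: nprojM.
exact/nsub_bilinear/Pi_bilinear.
Qed.

Lemma Le_mem b : in_Le b -> Pi_le_mem (piB_elt F b).
Proof.
by case: b => [[s al] be] /= Lb; apply: piB_elt_subalg => t; lia.
Qed.

Lemma Omega_coord_toOmega (u : Pi F) : Pi_le_mem u ->
  Omega_coord_fun (toOmega p u) = malg_restrict (in_BOmega p) (Pi_coord F u).
Proof. by move=> /nsub_insubdK<-; rewrite toOmega_val; apply: nqliftE. Qed.

Lemma toOmega_out (u : Pi F) : ~ Pi_le_mem u -> toOmega p u = 0.
Proof.
move=> nu; rewrite /toOmega /insubd insubN; first exact: (linear0 (lproj _)).
by apply/negP => /nsubalg_lspanP.
Qed.

Lemma toOmega_e0 (s : int) : s <= 0 -> toOmega p (Pi_e F s) = 0.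
Proof.
move=> s0; apply/nproj_eq0/nideal_gen/(Omega_rel_e s0).
by apply: nsub_insubdK; apply: (@Le_mem (s, 0, 0)%N) => /=; lia.
Qed.

(** Such a path reaches a vertex that is at most 0, and therefore factors through an idempotent that
    vanishes in [Omega]. *)
Lemma toOmega_kill b : in_Le b -> ~~ in_BOmega p b -> toOmega p (piB_elt F b) = 0.
Proof.
case: b => [[s al] be] Lb nOb.
have kill t b b' c : t <= 0 -> in_Le b -> in_Le b' ->
    piB_mul (t, 0, 0)%N b' = Some b' -> piB_mul b b' = Some c ->
    toOmega p (piB_elt F c) = 0.
  move=> t0 Lb1 Lb' tb' bb'; rewrite -(piB_eltM F bb') toOmegaM; try exact: Le_mem.
  rewrite -(piB_eltM F tb') [toOmega p (_ * _)%A]toOmegaM; try exact: Le_mem.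
    rewrite [toOmega p (piB_elt F (t, 0, 0)%N)]toOmega_e0 //.
    by rewrite (nmul0l Omega_bilinear) (nmul0r Omega_bilinear).
  by apply: Le_mem => /=; lia.
have [s0|s_gt0] := boolP (s <= 0).
  by apply: (kill s (s, 0, 0)%N (s, al, be)) => //=; rewrite ?ifT //; lia.
(* Here [s] is positive, so the failure of [in_BOmega] means that [be] is at least [s]: the path
   descends to the vertex 0 and is cut there. The truncated subtraction is exact. *)
pose be0 := (be - absz s)%N.
apply: (kill 0 (s, 0%N, absz s) (0, al, be0)); rewrite //=.
- by move: Lb => /=; lia.
- by move: Lb nOb; rewrite /be0 /=; lia.
- rewrite ifT; last by lia.
  by congr (Some (_, _, _)); move: Lb nOb; rewrite /be0 /=; lia.
Qed.

Lemma Omega_coord_elt b : in_BOmega p b ->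
  Omega_coord_fun (toOmega p (piB_elt F b)) = << b >>.
Proof.
move=> Ob; rewrite Omega_coord_toOmega; last exact/Le_mem/BOmega_Le.
by rewrite [Pi_coord F _]Pi_coord_elt malg_restrictU Ob.
Qed.

Lemma Omega_coord_span (u : Omega F p) :
  lspan (fun v => exists2 b, in_BOmega p b & v = toOmega p (piB_elt F b)) u.
Proof.
rewrite -[u]lreprK -/(nproj _ _); set v := repr u.
have -> : v = malg_lift (fun b => insubd (0 : Pi_le F p) (piB_elt F b))
    (Pi_coord F (val v)).
  apply: val_inj; rewrite -[LHS](ncoordK (Pi_coord F)).
  rewrite (raddf_sum (val : Pi_le F p -> Pi F)) /malg_lift big_seq [RHS]big_seq.
  apply: eq_bigr => b bv.
  rewrite -[RHS]/(_ *: val (insubd (0 : Pi_le F p) _)) nsub_insubdK //.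
  exact/Le_mem/(Pi_le_supported bv).
rewrite /nproj (linear_malg_lift (lproj _)).
apply: lspan_sum => b bv; have [Ob|nOb] := boolP (in_BOmega p b).
  by apply: lspan_gen; exists b.
have /= := toOmega_kill (Pi_le_supported bv) nOb; rewrite /toOmega /nproj => ->.
exact: lspan0.
Qed.

Definition Omega_coord :
    ncoord (in_BOmega p) (fun b => toOmega p (piB_elt F b)) Omega_struct :=
  NCoord (ncf := Omega_coord_fun) Omega_coord_elt Omega_coord_span
    (nqliftM Pi_le_coordM Pi_le_coord_rel).

End OmegaBasis.

(** * The algebra Theta and its involution *)

Section ThetaBasis.
Variables (F : fieldType) (p : nat).
Implicit Types (b c : piB).

Lemma BTheta_Omega b : in_BTheta p b -> in_BOmega p b.
Proof. by case: b => [[s al] be] /=; lia. Qed.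

(** [in_BTheta] says that [s - be] is at least 1 and [s + al] at most [p - 1], so that every
    ordering of the path stays between 1 and [p - 1]. Both bounds pass to the factors. *)
Lemma BTheta_factor b b' c : piB_mul b b' = Some c ->
  in_BTheta p c -> in_BTheta p b && in_BTheta p b'.
Proof.
case: b b' => [[s al] be] [[s' al'] be'] /=; case: eqP => // -> [<-] /=; lia.
Qed.

Definition Theta_struct b b' : {malg F[piB]} :=
  malg_restrict (in_BTheta p) (piB_struct F b b').

Lemma Theta_structE b b' : ~~ (in_BTheta p b && in_BTheta p b') ->
  Theta_struct b b' = 0.
Proof.
rewrite /Theta_struct /piB_struct.
case bb': (piB_mul b b') => [c|] nb; last exact: linear0.
rewrite [LHS]malg_restrictU; case: ifP => // Oc.
by rewrite (BTheta_factor bb') in nb.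
Qed.

Lemma Theta_struct_Omega b b' :
  malg_restrict (in_BTheta p) (Omega_struct F p b b') = Theta_struct b b'.
Proof. exact/malg_restrict_sub/BTheta_Omega. Qed.

Definition Omega_Theta_coord (u : Omega F p) : {malg F[piB]} :=
  malg_restrict (in_BTheta p) (Omega_coord F p u).

Lemma Omega_Theta_coord_is_linear : linear Omega_Theta_coord.
Proof. by move=> c u v; rewrite /Omega_Theta_coord !linearP. Qed.

HB.instance Definition _ := GRing.isLinear.Build F (Omega F p) {malg F[piB]} _ _
  Omega_Theta_coord_is_linear.

Lemma Omega_Theta_coordM (u v : Omega F p) :
  Omega_Theta_coord (u * v)%A =
  bilift Theta_struct (Omega_Theta_coord u) (Omega_Theta_coord v).
Proof.
rewrite /Omega_Theta_coord ncoordM malg_restrict_bilift => [|b b' _ _ nb].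
  by apply: eq_bilift => b b'; apply: Theta_struct_Omega.
by rewrite Theta_struct_Omega Theta_structE.
Qed.

Lemma Omega_Theta_coord_rel (u : Omega F p) : Theta_rel u -> Omega_Theta_coord u = 0.
Proof.
case; rewrite /Omega_Theta_coord -[Pi_e F p%:Z]/(piB_elt F (p%:Z, 0, 0)%N).
have [Op|nOp] := boolP (in_BOmega p (p%:Z, 0, 0)%N).
  by rewrite ncoord_elt // malg_restrictU ifN //=; lia.
by rewrite toOmega_kill ?linear0 //=; lia.
Qed.

Definition Theta_coord_fun : Theta F p -> {malg F[piB]} :=
  nqlift Omega_Theta_coordM Omega_Theta_coord_rel.
HB.instance Definition _ := GRing.Linear.on Theta_coord_fun.

Lemma Theta_bilinear : nbilinear (Theta F p).
Proof. exact/nquot_bilinear/Omega_bilinear. Qed.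

Lemma Omega_Theta_linear : linear (@Omega_Theta F p).
Proof. exact: (linearP (lproj _)). Qed.

HB.instance Definition _ := GRing.isLinear.Build F (Omega F p) (Theta F p) _ _
  Omega_Theta_linear.

Lemma Omega_ThetaM (u v : Omega F p) :
  Omega_Theta (u * v)%A = (Omega_Theta u * Omega_Theta v)%A.
Proof. exact/nprojM/Omega_bilinear. Qed.

Lemma Theta_coord_Omega (u : Omega F p) :
  Theta_coord_fun (Omega_Theta u) = malg_restrict (in_BTheta p) (Omega_coord F p u).
Proof. exact: nqliftE. Qed.

Lemma Theta_coord_toTheta (u : Pi F) : Pi_le_mem p u ->
  Theta_coord_fun (toTheta p u) = malg_restrict (in_BTheta p) (Pi_coord F u).
Proof.
move=> u_le; rewrite Theta_coord_Omega [Omega_coord _ _ _]Omega_coord_toOmega //.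
exact/malg_restrict_sub/BTheta_Omega.
Qed.

Lemma toTheta_kill b : in_BOmega p b -> ~~ in_BTheta p b -> toTheta p (piB_elt F b) = 0.
Proof.
case: b => [[s al] be] Ob nTb.
(* Failure of [in_BTheta] means that [al] is at least [p - s]. Since [x] and [y] commute, the path
   may climb these [k] steps first, which brings it to the vertex [p]. *)
pose k := absz (p%:Z - s); pose b1 : piB := (p%:Z, (al - k)%N, be).
have Tp : toTheta p (piB_elt F (p%:Z, 0, 0)%N) = 0.
  exact/nproj_eq0/nideal_gen/Theta_rel_e.
have O1 : in_BOmega p b1 by move: Ob nTb; rewrite /b1 /k /=; lia.
have O2 : in_BOmega p (s, k, 0%N) by move: Ob nTb; rewrite /b1 /k /=; lia.
have O3 : in_BOmega p (p%:Z, 0, 0)%N by move: Ob nTb; rewrite /b1 /k /=; lia.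
have e1 : piB_mul (p%:Z, 0, 0)%N b1 = Some b1 by rewrite /= ifT //; lia.
have e2 : piB_mul (s, k, 0)%N b1 = Some (s, al, be).
  rewrite /= ifT; last by move: Ob; rewrite /k /=; lia.
  by congr (Some (_, _, _)); move: Ob nTb; rewrite /k /=; lia.
have memO b : in_BOmega p b -> Pi_le_mem p (piB_elt F b).
  by move=> Obb; apply/Le_mem/BOmega_Le.
rewrite -(piB_eltM F e2) -(piB_eltM F e1) /toTheta.
rewrite toOmegaM; [|exact: memO|by rewrite (piB_eltM F e1); apply: memO].
rewrite [toOmega p (_ * piB_elt F b1)%A]toOmegaM; [|exact: memO|exact: memO].
rewrite !Omega_ThetaM -!/(toTheta p _) Tp.
by rewrite (nmul0l Theta_bilinear) (nmul0r Theta_bilinear).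
Qed.

Lemma Theta_coord_elt b : in_BTheta p b ->
  Theta_coord_fun (toTheta p (piB_elt F b)) = << b >>.
Proof.
move=> Tb; rewrite Theta_coord_toTheta; last exact/Le_mem/BOmega_Le/BTheta_Omega.
by rewrite [Pi_coord F _]Pi_coord_elt malg_restrictU Tb.
Qed.

Lemma Theta_coord_span (u : Theta F p) :
  lspan (fun v => exists2 b, in_BTheta p b & v = toTheta p (piB_elt F b)) u.
Proof.
rewrite -[u]lreprK -[lproj _ _]/(Omega_Theta _).
rewrite -[repr u](ncoordK (Omega_coord F p)) linear_malg_lift.
apply: lspan_sum => b /ncoord_supported Ob.
rewrite -/(toTheta p (piB_elt F b)).
have [Tb|nTb] := boolP (in_BTheta p b); first by apply: lspan_gen; exists b.
by rewrite [X in lspan _ X](toTheta_kill Ob nTb); apply: lspan0.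
Qed.

Definition Theta_coord :
    ncoord (in_BTheta p) (fun b => toTheta p (piB_elt F b)) Theta_struct :=
  NCoord (ncf := Theta_coord_fun) Theta_coord_elt Theta_coord_span
    (nqliftM Omega_Theta_coordM Omega_Theta_coord_rel).

Definition malg_sigma : {malg F[piB]} -> {malg F[piB]} :=
  malg_lift (fun b => << piB_sigma p b >>).
HB.instance Definition _ := GRing.Linear.on malg_sigma.

Lemma malg_sigmaU b : malg_sigma << b >> = << piB_sigma p b >>.
Proof. exact: malg_liftU. Qed.

Lemma BTheta_sigma b : in_BTheta p (piB_sigma p b) = in_BTheta p b.
Proof. by case: b => [[s al] be] /=; lia. Qed.

Lemma malg_sigma_restrict x :
  malg_restrict (in_BTheta p) (malg_sigma x) =
  malg_sigma (malg_restrict (in_BTheta p) x).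
Proof.
rewrite [LHS]linear_malg_lift [RHS]linear_malg_lift; apply: eq_malg_lift => b.
rewrite [LHS]malg_restrictU BTheta_sigma.
by case: ifP => _; [rewrite [RHS]malg_sigmaU | rewrite [RHS]linear0].
Qed.

Lemma path_piB_sigma (s : int) (w : seq bool) :
  path_piB (p%:Z - s, map negb w) = piB_sigma p (path_piB (s, w)).
Proof.
rewrite /path_piB /= !count_map; congr (_, _, _).
  by apply: eq_count; case.
by apply: eq_count; case.
Qed.

Lemma Pi_coord_sigma (u : Pi F) : Pi_coord F (Pi_sigma p u) = malg_sigma (Pi_coord F u).
Proof.
(* By definition both [Pi_sigma] and the coordinates of [Pi] are evaluated on the same
   representative [repr u] in the path algebra. *)
rewrite linear_malg_lift -[Pi_coord F u]/(path_coord (repr u)) linear_malg_lift.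
apply: eq_malg_lift => -[s w]; rewrite [RHS]malg_sigmaU [LHS]Pi_coord_path.
by rewrite path_piB_sigma.
Qed.

Lemma Pi_le_mem_supported (u : Pi F) : supported (in_Le p) (Pi_coord F u) -> Pi_le_mem p u.
Proof.
move=> Lu; rewrite -[u](ncoordK (Pi_coord F)); apply/nsubalg_lspanP.
rewrite /malg_lift big_seq; apply: rpred_sum => b /Lu Lb.
by apply/rpredZ/nsubalg_lspanP/Le_mem.
Qed.

(** The reflection turns lower bounds on vertices into upper bounds; confinement to the inner
    vertices therefore keeps both an element and its image under sigma in the domain of
    [toTheta]. *)
Lemma Pi_inner_supported (u : Pi F) : Pi_inner p u ->
  supported (fun b => in_Le p b && in_Le p (piB_sigma p b)) (Pi_coord F u).
Proof.
pose Q (b : piB) := let: (s, al, be) := b in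
  [&& 1 <= s, s <= p%:Z - 1, 1 <= s + al%:Z - be%:Z & s + al%:Z - be%:Z <= p%:Z - 1].
move=> u_in; apply: (@supported_sub _ _ Q).
  by case=> [[s al] be] /=; lia.
apply: Pi_gen_supported u_in; try by move=> s /=; lia.
by case=> [[s al] be] [[s' al'] be'] c /=; case: eqP => // -> [<-] /=; lia.
Qed.

(** Ensures that the default branch of [Theta_sigma] is never taken. The lift is the combination of
    sorted paths with the same coordinates. *)
Lemma Theta_lift_inner (t : Theta F p) : exists u, Pi_inner p u /\ toTheta p u = t.
Proof.
pose u := malg_lift (piB_elt F) (Theta_coord t); exists u.
have u_in : Pi_inner p u.
  apply/nsubalg_lspanP; rewrite /u /malg_lift big_seq; apply: rpred_sum => b.
  move=> /ncoord_supported Tb; apply/rpredZ/nsubalg_lspanP.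
  by case: b Tb => [[s al] be] /= Tb; apply: piB_elt_subalg => v; lia.
split=> //; apply: (@ncoord_inj _ _ _ _ _ _ Theta_coord).
rewrite [LHS]Theta_coord_toTheta; last first.
  apply: Pi_le_mem_supported; apply: supported_sub (Pi_inner_supported u_in).
  by move=> b /andP[].
have -> : Pi_coord F u = Theta_coord t.
  rewrite linear_malg_lift -[RHS]malg_lift_id; apply: eq_malg_lift => b.
  exact: Pi_coord_elt.
exact/malg_restrict_id/ncoord_supported.
Qed.

Lemma Theta_coordE (u : Pi F) : Pi_le_mem p u ->
  Theta_coord (toTheta p u) = malg_restrict (in_BTheta p) (Pi_coord F u).
Proof. exact: Theta_coord_toTheta. Qed.

Lemma Theta_sigma_lift (t : Theta F p) : exists u,
  [/\ Pi_inner p u, t = toTheta p u & Theta_sigma t = toTheta p (Pi_sigma p u)].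
Proof.
rewrite /Theta_sigma; case: pselect => [ex_u|[]]; last exact: Theta_lift_inner.
by case: (cid ex_u) => u [u_in ut]; exists u; split.
Qed.

(** The right-hand side does not mention the lift chosen in [Theta_sigma], so the involution is well
    defined and linear. *)
Lemma Theta_coord_sigma (t : Theta F p) :
  Theta_coord (Theta_sigma t) = malg_sigma (Theta_coord t).
Proof.
have [u [/Pi_inner_supported u_in -> ->]] := Theta_sigma_lift t.
rewrite !Theta_coordE; first by rewrite Pi_coord_sigma malg_sigma_restrict.
  by apply: Pi_le_mem_supported; apply: supported_sub u_in => b /andP[].
apply: Pi_le_mem_supported; rewrite Pi_coord_sigma.
by apply: supported_lift => b /u_in/andP[_ Lb]; apply: (supportedU (P := in_Le p)).
Qed.

End ThetaBasis.

(** * The tensor algebra *)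

Section TensorAlgebraCombinatorics.
Variables (p : nat).
Implicit Types (b c : piB) (n : nat).

(** What becomes of a right factor when it crosses [n] copies of [Theta^sigma]. *)
Definition twist n b : piB := if odd n then piB_sigma p b else b.

Lemma piB_sigmaK : involutive (piB_sigma p).
Proof. by case=> [[s al] be] /=; congr (_, _, _); lia. Qed.

Lemma twistD n n' b : twist (n + n') b = twist n (twist n' b).
Proof.
rewrite /twist oddD; case: (odd n) (odd n') => [] [] //=.
by rewrite piB_sigmaK.
Qed.

Lemma piB_mul_sigma b b' :
  piB_mul (piB_sigma p b) (piB_sigma p b') = omap (piB_sigma p) (piB_mul b b').
Proof.
case: b b' => [[s al] be] [[s' al'] be'] /=.
have -> : (p%:Z - s' == p%:Z - s + be%:Z - al%:Z) = (s' == s + al%:Z - be%:Z) by lia.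
by case: ifP.
Qed.

Lemma piB_mul_twist n b b' :
  piB_mul (twist n b) (twist n b') = omap (twist n) (piB_mul b b').
Proof.
rewrite /twist; case: (odd n); first exact: piB_mul_sigma.
by case: (piB_mul b b').
Qed.

Lemma piB_mulA b b' b'' :
  obind (piB_mul^~ b'') (piB_mul b b') = obind (piB_mul b) (piB_mul b' b'').
Proof.
case: b b' b'' => [[s al] be] [[s' al'] be'] [[s'' al''] be''] /=.
case: ifP => /= e1; case: ifP => /= e2; try case: ifP => //= e3;
  by rewrite ?e1 ?addnA //; exfalso; lia.
Qed.

Lemma BTheta_twist n b : in_BTheta p (twist n b) = in_BTheta p b.
Proof. by rewrite /twist; case: ifP; rewrite ?BTheta_sigma. Qed.

Definition in_BT (x : piB * nat) : bool :=
  if x.2 == 0%N then in_BOmega p x.1 else in_BTheta p x.1.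

Definition tB_mul (x x' : piB * nat) : option (piB * nat) :=
  obind (fun c => if in_BT (c, x.2 + x'.2)%N then Some (c, x.2 + x'.2)%N else None)
    (piB_mul x.1 (twist x.2 x'.1)).

Lemma lamB_mulE (x x' : piB * nat) (h h' : nat) :
  lamB_mul p (x, h) (x', h') =
  omap (fun c : piB * nat => (c, (h + h')%N)) (tB_mul x x').
Proof.
case: x x' => [b n] [b' n']; rewrite /tB_mul /= -/(twist n b').
case: (piB_mul _ _) => //= c; rewrite /in_BT /=.
by case: ifP.
Qed.

Lemma BT_Omega x : in_BT x -> in_BOmega p x.1.
Proof. by rewrite /in_BT; case: ifP => // _; apply: BTheta_Omega. Qed.

Lemma Le_mul b b' c : piB_mul b b' = Some c -> in_Le p b -> in_Le p b' -> in_Le p c.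
Proof.
by case: b b' => [[s al] be] [[s' al'] be'] /=; case: eqP => // -> [<-] /=; lia.
Qed.

(** The membership test is applied after each product, and the two bracketings test different
    partial products. A partial product that fails forces the total one to fail, by the factor
    lemmas; in tensor degree 0 these need the bound [in_Le] on the factors. *)
Lemma tB_mulA x y z : in_BT x -> in_BT y -> in_BT z ->
  obind (tB_mul^~ z) (tB_mul x y) = obind (tB_mul x) (tB_mul y z).
Proof.
case: x y z => [b n] [b' n'] [b'' n''] Tx Ty Tz.
have [Lb Lb' Lb''] : [/\ in_Le p b, in_Le p b' & in_Le p b''].
  by split; apply: (@BOmega_Le p); [move: Tx | move: Ty | move: Tz] => /BT_Omega.
have := piB_mulA b (twist n b') (twist (n + n') b'').
rewrite twistD piB_mul_twist /tB_mul /=.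
case bb': (piB_mul b (twist n b')) => [c|] /=; last first.
  case: (piB_mul b' (twist n' b'')) => //= c' bc'; case: ifP => //= _.
  by rewrite -bc'.
case b'b'': (piB_mul b' (twist n' b'')) => [c'|] /=; last first.
  by move=> cb''; case: ifP => //= _; rewrite twistD cb''.
move=> assoc.
(* The test of the first partial product is dropped: wherever it fails, the final test fails too. *)
transitivity (obind (fun d => if in_BT (d, n + n' + n'')%N
    then Some (d, n + n' + n'')%N else None) (piB_mul c (twist n (twist n' b'')))).
  case Tc: (in_BT _) => /=; rewrite ?twistD //.
  case cb'': (piB_mul _ _) => [d|] //=; case: ifP => // Td.
  move: Tc; rewrite /in_BT /=; move: Td; rewrite /in_BT /=.
  case: (n + n' + n'' =P 0)%N => [n0|_].
    have [? ? ?] : [/\ n = 0, n' = 0 & n'' = 0]%N by split; lia.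
    subst => Od.
    by have /andP[-> _] := BOmega_factor cb'' (Le_mul bb' Lb Lb') Lb'' Od.
  by case/(BTheta_factor cb'')/andP => Tc _; case: ifP; rewrite ?BTheta_Omega ?Tc.
rewrite assoc.
case Tc': (in_BT (c', _)) => /=; first by rewrite addnA.
case bc': (piB_mul _ _) => [d|] //=; case: ifP => // Td.
move: Tc'; rewrite /in_BT /=; move: Td; rewrite /in_BT /=.
case: (n + n' + n'' =P 0)%N => [n0|_].
  have [? ? ?] : [/\ n = 0, n' = 0 & n'' = 0]%N by split; lia.
  subst => Od.
  by have /andP[_ ->] := BOmega_factor bc' Lb (Le_mul b'b'' Lb' Lb'') Od.
case/(BTheta_factor bc')/andP => _; rewrite BTheta_twist => Tc'.
by case: ifP; rewrite ?BTheta_Omega ?Tc'.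
Qed.

Arguments tB_mul : simpl never.

Definition piB_end b : int := let: (s, al, be) := b in s + al%:Z - be%:Z.
Definition piB_e (s : int) : piB := (s, 0%N, 0%N).

Lemma twist_e n s : twist n (piB_e s) = piB_e (if odd n then p%:Z - s else s).
Proof. by rewrite /twist; case: (odd n). Qed.

Lemma piB_mul_e b s : piB_mul b (piB_e s) = if s == piB_end b then Some b else None.
Proof. by case: b => [[t al] be] /=; rewrite !addn0. Qed.

Lemma piB_e_mul s b : piB_mul (piB_e s) b = if s == b.1.1 then Some b else None.
Proof.
by case: b => [[t al] be] /=; rewrite !add0n addr0 subr0 eq_sym; case: eqP => [->|].
Qed.

(* The vertex whose idempotent is a right unit for (b, n). *)
Definition tB_end (x : piB * nat) : int :=
  if odd x.2 then p%:Z - piB_end x.1 else piB_end x.1.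

(** The case [j = 0] serves for units, the case [j = 1] for appending the unit of [Theta] as one
    more tensor factor. *)
Lemma tB_mul_e x s j : in_BT x ->
  tB_mul x (piB_e s, j) =
  if (s == tB_end x) && in_BT (x.1, (x.2 + j)%N) then Some (x.1, (x.2 + j)%N) else None.
Proof.
case: x => b n Tx; rewrite /tB_mul /= twist_e piB_mul_e /tB_end /=.
have -> : ((if odd n then p%:Z - s else s) == piB_end b) =
    (s == (if odd n then p%:Z - piB_end b else piB_end b)) by case: (odd n); lia.
by case: ifP.
Qed.

Lemma tB_e_mul s x : in_BT x ->
  tB_mul (piB_e s, 0%N) x = if s == x.1.1.1 then Some x else None.
Proof.
case: x => b n Tx; rewrite -[tB_mul _ _]/(obind _ (piB_mul (piB_e s) b)) piB_e_mul.
by case: ifP => //= _; rewrite add0n Tx.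
Qed.

Lemma tB_end_bound x : in_BT x -> 1 <= tB_end x <= p%:Z.
Proof.
case: x => [[[s al] be] n]; rewrite /in_BT /tB_end /=.
by case: (n =P 0)%N => [->|_] /=; [|case: ifP => _]; lia.
Qed.

Lemma tB_start_bound x : in_BT x -> 1 <= x.1.1.1 <= p%:Z.
Proof. by case: x => [[[s al] be] n]; rewrite /in_BT /=; case: ifP => _; lia. Qed.

End TensorAlgebraCombinatorics.

Lemma sum_vertex (V : zmodType) (p : nat) (s : int) (G : int -> V) :
  1 <= s <= p%:Z ->
  (forall t : nat, (1 <= t < p.+1)%N -> t%:Z != s -> G t%:Z = 0) ->
  \sum_(1 <= t < p.+1) G t%:Z = G s.
Proof.
move=> s_in G0; have s_mem : absz s \in index_iota 1 p.+1.
  by rewrite mem_index_iota; lia.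
rewrite (bigD1_seq _ s_mem) ?iota_uniq //=.
rewrite big_seq_cond big1 => [|t /andP[]].
  by rewrite addr0; congr G; lia.
by rewrite mem_index_iota => t_in ts; apply: G0 => //; lia.
Qed.

Lemma bilift_assoc_in (F : fieldType) (K : choiceType) (m : K -> K -> {malg F[K]})
    (x y z : {malg F[K]}) :
  (forall j k l, j \in msupp x -> k \in msupp y -> l \in msupp z ->
     bilift m (m j k) << l >> = bilift m << j >> (m k l)) ->
  bilift m (bilift m x y) z = bilift m x (bilift m y z).
Proof.
move=> mA; rewrite -[LHS]/(biliftr m z (bilift m x y)) linear_bilift.
apply: eq_malg_lift_in => j jx; rewrite linear_bilift.
apply: eq_malg_lift_in => k ky; rewrite [LHS](linear_malgE (bilift m (m j k))).
apply: eq_malg_lift_in => l lz; rewrite [LHS]mA //.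
exact: biliftUr.
Qed.

Lemma malg_mulE (F : fieldType) (M : monomType) (x y : {malg F[M]}) :
  x * y = bilift (fun k l : M => << mmul k l >>) x y.
Proof.
rewrite malgME; apply: eq_bigr => k _; rewrite /malg_lift scaler_sumr.
apply: eq_bigr => l _; apply/malgP => i.
by rewrite !mcoeffZ !mcoeffU mulrA mulr_natr.
Qed.

Section TensorAlgebra.
Variables (F : fieldType) (p : nat).
Local Notation Om := (Omega F p).
Local Notation Th := (Theta F p).
Local Notation T := (T_Omega F p).
Local Notation letter := (letter Om Th).
Local Notation KT := (piB * nat)%type.

Definition T_struct (x y : KT) : {malg F[KT]} := malg_opt F (tB_mul p x y).

Local Notation "x ** y" := (bilift T_struct x y) (at level 40, left associativity).

Definition malg_degree (n : nat) : {malg F[piB]} -> {malg F[KT]} :=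
  malg_lift (fun b => << ((b, n) : KT) >>).
HB.instance Definition _ n := GRing.Linear.on (malg_degree n).

Lemma malg_degreeU n b : malg_degree n << b >> = << ((b, n) : KT) >>.
Proof. exact: malg_liftU. Qed.

Definition letter_coord (l : letter) : {malg F[KT]} :=
  match l with
  | inl x => malg_degree 0 (Omega_coord F p x)
  | inr m => malg_degree 1 (Theta_coord F p m)
  end.

Definition T_unit : {malg F[KT]} := \sum_(1 <= s < p.+1) << ((piB_e s%:Z, 0%N) : KT) >>.

Definition word_coord (w : seq letter) : {malg F[KT]} :=
  foldr (fun l x => letter_coord l ** x) T_unit w.

Lemma supported_degree n (P : piB -> Prop) x : supported P x ->
  supported (fun k : KT => P k.1 /\ k.2 = n) (malg_degree n x).
Proof. move=> Px; apply: supported_lift => b /Px Pb.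
exact: (supportedU (P := fun k : KT => P k.1 /\ k.2 = n)). Qed.

Lemma letter_coord_supported l : supported (in_BT p) (letter_coord l).
Proof.
case: l => [x|m].
  have := supported_degree (n := 0%N) (@ncoord_supported _ _ _ _ _ _ (Omega_coord F p) x).
  by apply: supported_sub => -[b n] [Ob] /= ->.
have := supported_degree (n := 1%N) (@ncoord_supported _ _ _ _ _ _ (Theta_coord F p) m).
by apply: supported_sub => -[b n] [Ob] /= ->.
Qed.

Lemma malg_opt_supported (P : KT -> Prop) o :
  (forall k, o = Some k -> P k) -> supported P (malg_opt F o).
Proof.
case: o => [k|] Po; last exact: supported0.
by apply: supportedU; apply: Po.
Qed.

Lemma tB_mul_BT x y z : tB_mul p x y = Some z -> in_BT p z.
Proof.
by rewrite /tB_mul; case: piB_mul => //= c; case: ifP => // Tc [<-].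
Qed.

Lemma T_mul_supported x y : supported (in_BT p) (x ** y).
Proof.
by apply: supported_bilift => k l _ _; apply: malg_opt_supported => z /tB_mul_BT.
Qed.

Lemma T_unit_supported : supported (in_BT p) T_unit.
Proof.
rewrite /T_unit big_nat; apply: supported_sum => s s_in; apply: supportedU.
by rewrite /in_BT /=; lia.
Qed.

Lemma word_coord_supported w : supported (in_BT p) (word_coord w).
Proof. by case: w => [|l w]; [apply: T_unit_supported | apply: T_mul_supported]. Qed.

Lemma T_unitl x : supported (in_BT p) x -> T_unit ** x = x.
Proof.
move=> Tx; rewrite -[RHS]malg_lift_id bilift_swap.
apply: eq_malg_lift_in => k /Tx Tk.
transitivity (\sum_(1 <= s < p.+1) T_struct (piB_e s%:Z, 0%N) k).
  by rewrite linear_sum; apply: eq_bigr => s _; apply: malg_liftU.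
rewrite (@sum_vertex _ _ k.1.1.1 (fun s => T_struct (piB_e s, 0%N) k)) ?tB_start_bound //.
  by rewrite /T_struct tB_e_mul // eqxx.
by move=> s _ /negPf sk; rewrite /T_struct tB_e_mul // sk.
Qed.

Lemma sum_T_struct_e x j : in_BT p x ->
  \sum_(1 <= s < p.+1) T_struct x (piB_e s%:Z, j) =
  if in_BT p (x.1, (x.2 + j)%N) then << ((x.1, (x.2 + j)%N) : KT) >> else 0.
Proof.
move=> Tx.
rewrite (@sum_vertex _ _ (tB_end p x) (fun s => T_struct x (piB_e s, j))).
- by rewrite /T_struct tB_mul_e // eqxx /=; case: ifP.
- exact: tB_end_bound.
- by move=> s _ /negPf sx; rewrite /T_struct tB_mul_e // sx.
Qed.

Lemma T_unitr x : supported (in_BT p) x -> x ** T_unit = x.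
Proof.
move=> Tx; rewrite -[RHS]malg_lift_id; apply: eq_malg_lift_in => k /Tx Tk.
transitivity (\sum_(1 <= s < p.+1) T_struct k (piB_e s%:Z, 0%N)).
  by rewrite linear_sum; apply: eq_bigr => s _; apply: malg_liftU.
by rewrite sum_T_struct_e // addn0 -surjective_pairing Tk.
Qed.

Lemma T_mulUU j k : << j >> ** << k >> = T_struct j k.
Proof. exact: biliftUU. Qed.

Lemma T_mul_optl o k :
  malg_opt F o ** << k >> = malg_opt F (obind (fun j => tB_mul p j k) o).
Proof. by case: o => [j|]; [apply: T_mulUU | apply: bilift0l]. Qed.

Lemma T_mul_optr o j :
  << j >> ** malg_opt F o = malg_opt F (obind (tB_mul p j) o).
Proof. by case: o => [k|]; [apply: T_mulUU | apply: bilift0r]. Qed.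

Lemma T_mulA x y z : supported (in_BT p) x -> supported (in_BT p) y ->
  supported (in_BT p) z -> x ** y ** z = x ** (y ** z).
Proof.
move=> Tx Ty Tz; apply: bilift_assoc_in => j k l /Tx Tj /Ty Tk /Tz Tl.
rewrite [LHS]T_mul_optl [RHS]T_mul_optr.
exact: (f_equal (fun o => malg_opt F o) (tB_mulA Tj Tk Tl)).
Qed.

Lemma word_coord_cat w w' : word_coord (w ++ w') = word_coord w ** word_coord w'.
Proof.
elim: w => [|l w IH]; first by apply/esym/T_unitl; apply: word_coord_supported.
rewrite [LHS](congr1 (bilift T_struct (letter_coord l)) IH).
by apply/esym/T_mulA; [apply: letter_coord_supported | apply: word_coord_supported ..].
Qed.

Lemma word_coord1 l : word_coord [:: l] = letter_coord l.
Proof. exact/T_unitr/letter_coord_supported. Qed.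

Definition free_coord : {malg F[{fmonom letter}]} -> {malg F[KT]} :=
  malg_lift (fun w : {fmonom letter} => word_coord w).
HB.instance Definition _ := GRing.Linear.on free_coord.

Lemma free_coordU w : free_coord << FMonom w >> = word_coord w.
Proof. exact: malg_liftU. Qed.

Lemma free_coordM (x y : freealg Om Th) :
  free_coord (x * y)%A = free_coord x ** free_coord y.
Proof.
rewrite [(x * y)%A]malg_mulE linear_bilift [RHS]bilift_lift; apply: eq_bilift => v w.
rewrite -word_coord_cat -[LHS]/(free_coord << fmmul v w >>) fmmulE.
exact: free_coordU.
Qed.
End TensorAlgebra.

(** * The relations of the tensor algebra in coordinates *)

Section TensorAlgebraCoordinates.
Variables (F : fieldType) (p : nat).
Local Notation Om := (Omega F p).
Local Notation Th := (Theta F p).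
Local Notation T := (T_Omega F p).
Local Notation letter := (letter Om Th).
Local Notation KT := (piB * nat)%type.
Local Notation "x ** y" := (bilift (T_struct F p) x y) (at level 40, left associativity).
Implicit Types (b c : piB).

(** The common form in which the structure constants of [T_Omega] are compared with those of [Omega]
    and [Theta]: a product in B_Pi followed by a single membership test. *)
Definition degree_opt (P : pred piB) (n : nat) (o : option piB) : {malg F[KT]} :=
  if o is Some c then if P c then << ((c, n) : KT) >> else 0 else 0.

Lemma T_structE b n b' n' : T_struct F p (b, n) (b', n') =
  degree_opt (if (n + n' == 0)%N then in_BOmega p else in_BTheta p) (n + n')
    (piB_mul b (twist p n b')).
Proof.
rewrite /T_struct /tB_mul /in_BT /=; case: piB_mul => //= c.
by case: (n + n' == 0)%N; case: ifP.
Qed.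

Lemma malg_degree_restrict (P : pred piB) n b b' :
  malg_degree n (malg_restrict P (piB_struct F b b')) = degree_opt P n (piB_mul b b').
Proof.
rewrite /piB_struct; case: piB_mul => [c|] /=; last first.
  by rewrite /malg_opt !linear0.
rewrite [malg_restrict _ _]malg_restrictU; case: ifP => _; last exact: linear0.
exact: malg_degreeU.
Qed.

Lemma letter_coord_mulA (x y : Om) :
  letter_coord (inl x : letter) ** letter_coord (inl y) = letter_coord (inl (x * y)%A : letter).
Proof.
rewrite [LHS]bilift_lift -[RHS]/(malg_degree 0 _) ncoordM linear_bilift.
apply: eq_bilift => b b'; rewrite [RHS]malg_degree_restrict [LHS]biliftUU.
exact: T_structE.
Qed.

(** Reconciles [T_struct], which tests the product only, with the passage from [Omega] to [Theta],
    which discards factors. *)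
Lemma degree_opt_Theta0 n b b' : ~~ (in_BTheta p b && in_BTheta p b') ->
  degree_opt (in_BTheta p) n (piB_mul b b') = 0.
Proof.
by rewrite -malg_degree_restrict => nb; rewrite [malg_restrict _ _]Theta_structE ?linear0.
Qed.

Lemma letter_coord_lact (x : Om) (m : Th) :
  letter_coord (inl x : letter) ** letter_coord (inr m) =
  letter_coord (inr (Theta_lact x m) : letter).
Proof.
rewrite [LHS]bilift_lift -[RHS]/(malg_degree 1 (Theta_coord F p (Theta_lact x m))).
(* The projection to [Theta] is written as a filter on the symbols of [Omega], so that both sides
   run over the same pairs of symbols. *)
have -> : Theta_coord F p (Theta_lact x m) =
    bilift (fun b b' => bilift (Theta_struct F p)
      (if in_BTheta p b then << b >> else 0) << b' >>)
      (Omega_coord F p x) (Theta_coord F p m).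
  rewrite ncoordM [Theta_coord F p (Omega_Theta x)]Theta_coord_Omega.
  by rewrite -[X in bilift _ _ X]malg_lift_id bilift_lift.
rewrite [RHS]linear_bilift.
apply: eq_bilift => b b'; rewrite [LHS]biliftUU [LHS]T_structE.
case: ifP => Tb; first by rewrite biliftUU [RHS]malg_degree_restrict.
by rewrite bilift0l linear0 [LHS]degree_opt_Theta0 // /twist /= Tb.
Qed.

Lemma letter_coord_ract (x : Om) (m : Th) :
  letter_coord (inr m : letter) ** letter_coord (inl x) =
  letter_coord (inr (Theta_ract m x) : letter).
Proof.
rewrite [LHS]bilift_lift -[RHS]/(malg_degree 1 (Theta_coord F p (Theta_ract m x))).
have -> : Theta_coord F p (Theta_ract m x) =
    bilift (fun b b' => bilift (Theta_struct F p) << b >>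
      (malg_sigma p (if in_BTheta p b' then << b' >> else 0)))
      (Theta_coord F p m) (Omega_coord F p x).
  rewrite ncoordM Theta_coord_sigma [Theta_coord F p (Omega_Theta x)]Theta_coord_Omega.
  by rewrite -[X in bilift _ X]malg_lift_id [malg_sigma _ _]linear_malg_lift bilift_lift.
rewrite [RHS]linear_bilift.
apply: eq_bilift => b b'; rewrite [LHS]biliftUU [LHS]T_structE.
case: ifP => Tb'.
  by rewrite [malg_sigma _ _]malg_sigmaU biliftUU [RHS]malg_degree_restrict.
by rewrite !linear0 [LHS]degree_opt_Theta0 // BTheta_twist Tb' andbF.
Qed.

Lemma Omega_coord_one :
  Omega_coord F p (Omega_one F p) = \sum_(1 <= s < p.+1) << piB_e s%:Z >>.
Proof.
rewrite linear_sum big_nat [RHS]big_nat; apply: eq_bigr => s s_in.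
have Os : in_BOmega p (piB_e s%:Z) by move=> /=; lia.
exact: (ncoord_elt (Omega_coord F p) Os).
Qed.

Lemma letter_coord_one : letter_coord (inl (Omega_one F p) : letter) = T_unit F p.
Proof.
rewrite /letter_coord Omega_coord_one linear_sum; apply: eq_bigr => s _.
exact: malg_degreeU.
Qed.

Lemma letter_coord_linl (a : F) (x y : Om) :
  letter_coord (inl (a *: x + y) : letter) =
  a *: letter_coord (inl x : letter) + letter_coord (inl y : letter).
Proof.
exact: etrans (congr1 (malg_degree 0) (linearP (Omega_coord F p) a x y))
  (linearP (malg_degree 0) a _ _).
Qed.

Lemma letter_coord_linr (a : F) (x y : Th) :
  letter_coord (inr (a *: x + y) : letter) =
  a *: letter_coord (inr x : letter) + letter_coord (inr y : letter).
Proof.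
exact: etrans (congr1 (malg_degree 1) (linearP (Theta_coord F p) a x y))
  (linearP (malg_degree 1) a _ _).
Qed.

Lemma free_coord_ltr (l : letter) : free_coord (ltr l) = letter_coord l.
Proof. by rewrite /ltr fmuE [LHS]free_coordU word_coord1. Qed.

Lemma free_coord_rel (u : freealg Om Th) :
  talg_rel (Omega_one F p) (@Theta_lact F p) (@Theta_ract F p) u -> free_coord u = 0.
Proof.
pose f : {linear freealg Om Th -> {malg F[KT]}} := @free_coord F p.
have fl (l : letter) : f (ltr l) = letter_coord l := free_coord_ltr l.
have fM (l l' : letter) : f (ltr l * ltr l')%A = letter_coord l ** letter_coord l'.
  by rewrite -2!free_coord_ltr; apply: free_coordM.
case=> [c x y|c m n||x y|x m|m x].
- exact: linear_rel0 (fl _) (fl _) (fl _) (letter_coord_linl c x y).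
- exact: linear_rel0 (fl _) (fl _) (fl _) (letter_coord_linr c m n).
- apply: linear_sub0 (etrans (fl _) letter_coord_one) _.
  by rewrite -[1]/(<< fmone _ >>) fmoneE; apply: free_coordU.
- exact: linear_sub0 (etrans (fM _ _) (letter_coord_mulA x y)) (fl _).
- exact: linear_sub0 (etrans (fM _ _) (letter_coord_lact x m)) (fl _).
- exact: linear_sub0 (etrans (fM _ _) (letter_coord_ract x m)) (fl _).
Qed.

Definition T_coord_fun : T -> {malg F[KT]} :=
  nqlift (@free_coordM F p) free_coord_rel.
HB.instance Definition _ := GRing.Linear.on T_coord_fun.

Lemma T_coord_word (w : seq letter) :
  T_coord_fun (talg_word (Omega_one F p) (@Theta_lact F p) (@Theta_ract F p) w)
  = word_coord w.
Proof. by rewrite -free_coordU; apply: nqliftE. Qed.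

End TensorAlgebraCoordinates.

Lemma nseqS_cat (A : Type) n (x : A) : nseq n.+1 x = nseq n x ++ [:: x].
Proof. by elim: n => //= n ->. Qed.

(** * A basis of the tensor algebra *)

Section TensorAlgebraBasis.
Variables (F : fieldType) (p : nat).
Local Notation Om := (Omega F p).
Local Notation Th := (Theta F p).
Local Notation T := (T_Omega F p).
Local Notation letter := (letter Om Th).
Local Notation KT := (piB * nat)%type.
Local Notation "x ** y" := (bilift (T_struct F p) x y) (at level 40, left associativity).
Local Notation word :=
  (talg_word (Omega_one F p) (@Theta_lact F p) (@Theta_ract F p)).
Local Notation R := (talg_rel (Omega_one F p) (@Theta_lact F p) (@Theta_ract F p)).
Implicit Types (b c : piB).

Definition T_elt_word (x : KT) : seq letter :=
  if x.2 is n.+1 then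
    inr (toTheta p (piB_elt F x.1)) :: nseq n (inr (Theta_one F p))
  else [:: inl (toOmega p (piB_elt F x.1))].

Definition T_elt (x : KT) : T := word (T_elt_word x).

Lemma Theta_coord_one : Theta_coord F p (Theta_one F p) =
  \sum_(1 <= s < p.+1) (if in_BTheta p (piB_e s%:Z) then << piB_e s%:Z >> else 0).
Proof.
rewrite [LHS]Theta_coord_Omega [X in malg_restrict _ X]Omega_coord_one linear_sum.
by apply: eq_bigr => s _; apply: malg_restrictU.
Qed.

(** The unit of [Theta] is a sum of vertex idempotents, of which exactly one meets the end of [x]; a
    further factor 1 raises the tensor degree and leaves the path unchanged. *)
Lemma mul_letter_one (x : KT) : in_BTheta p x.1 ->
  << x >> ** letter_coord (inr (Theta_one F p) : letter) = << ((x.1, x.2.+1) : KT) >>.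
Proof.
move=> Tx; rewrite biliftUr -[letter_coord _]/(malg_degree 1 (Theta_coord F p (Theta_one F p))).
rewrite Theta_coord_one [malg_degree _ _]linear_sum linear_sum.
(* The vertex [p] is missing from the unit of [Theta], but its term vanishes in [T_struct] as well;
   hence the sum may be taken over all vertices of [Omega]. *)
have term e : malg_lift (T_struct F p x)
    (malg_degree 1 (if in_BTheta p e then << e >> else 0)) = T_struct F p x (e, 1%N).
  case: ifP => Te; first by rewrite malg_degreeU; apply: malg_liftU.
  rewrite !linear0; case: x Tx => b n Tx.
  rewrite T_structE addn1; apply/esym/degree_opt_Theta0.
  by rewrite BTheta_twist Te andbF.
have BTx n : in_BT p (x.1, n).
  by rewrite /in_BT /=; case: ifP => // _; apply: BTheta_Omega.
transitivity (\sum_(1 <= s < p.+1) T_struct F p x (piB_e s%:Z, 1%N)).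
  by apply: eq_bigr => s _; apply: term.
have Tx' : in_BT p x by rewrite [x]surjective_pairing; apply: BTx.
rewrite sum_T_struct_e // addn1.
by rewrite [in_BT _ _]BTx.
Qed.

Lemma word_coord_elt (x : KT) : in_BT p x -> word_coord (T_elt_word x) = << x >>.
Proof.
case: x => b [|n] Tb.
  rewrite [LHS]word_coord1 -[LHS]/(malg_degree 0 (Omega_coord F p _)).
  have Ob : in_BOmega p b := Tb.
  by rewrite [X in malg_degree _ X](ncoord_elt (Omega_coord F p) Ob); apply: malg_degreeU.
elim: n Tb => [|n IH] Tb.
  rewrite [LHS]word_coord1 -[LHS]/(malg_degree 1 (Theta_coord F p _)).
  have Thb : in_BTheta p b := Tb.
  by rewrite [X in malg_degree _ X](ncoord_elt (Theta_coord F p) Thb); apply: malg_degreeU.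
have -> : T_elt_word (b, n.+2) = T_elt_word (b, n.+1) ++ [:: inr (Theta_one F p)].
  apply: (congr1 (cons (inr (toTheta p (piB_elt F b))))).
  exact: nseqS_cat.
rewrite word_coord_cat IH // word_coord1.
exact: (@mul_letter_one (b, n.+1) Tb).
Qed.

Lemma T_coord_elt (x : KT) : in_BT p x -> T_coord_fun (T_elt x) = << x >>.
Proof. by move=> Tx; rewrite T_coord_word; apply: word_coord_elt. Qed.

Lemma freealg_bilinear : nbilinear (freealg Om Th).
Proof.
split=> c x y z; first by rewrite [LHS]mulrDl -scalerAl.
by rewrite [LHS]malg_mulE biliftPr -!malg_mulE.
Qed.

Lemma T_bilinear : nbilinear T.
Proof. exact/nquot_bilinear/freealg_bilinear. Qed.

Lemma T_wordM (v w : seq letter) : (word v * word w)%A = word (v ++ w).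
Proof.
rewrite /talg_word -(nprojM freealg_bilinear); congr nproj.
rewrite [LHS]malg_mulE biliftUU; congr mkmalgU; exact: fmmulE.
Qed.

Lemma T_Omega_mulA (x y z : T) : (x * (y * z)%A)%A = ((x * y)%A * z)%A.
Proof.
have assoc (a b c : freealg Om Th) : (nproj R a * (nproj R b * nproj R c)%A)%A =
    ((nproj R a * nproj R b)%A * nproj R c)%A.
  rewrite -!(nprojM freealg_bilinear); apply: congr1.
  exact: (@mulrA {malg F[{fmonom letter}]}).
by have := assoc (repr x) (repr y) (repr z); rewrite /nproj !lreprK.
Qed.

Lemma T_rel (u v : freealg Om Th) : R (u - v) -> nproj R u = nproj R v.
Proof. by move=> Ruv; apply/nproj_eq/nideal_gen. Qed.

Definition T_lam (x : Om) : T := word [:: inl x].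
Definition T_mu (m : Th) : T := word [:: inr m].

Lemma T_rel_linear (c : F) (u v w : freealg Om Th) : R (u - c *: v - w) ->
  nproj R u = c *: nproj R v + nproj R w.
Proof.
by move=> Ruvw; apply: lproj_rel_linear; apply: nideal_gen.
Qed.

Lemma T_lam_is_linear : linear T_lam.
Proof.
move=> c x y; have := T_rel_linear (talg_linA _ _ _ c x y).
by rewrite /ltr !fmuE.
Qed.

Lemma T_mu_is_linear : linear T_mu.
Proof.
move=> c x y; have := T_rel_linear (talg_linM _ _ _ c x y).
by rewrite /ltr !fmuE.
Qed.

HB.instance Definition _ := GRing.isLinear.Build F Om T _ T_lam T_lam_is_linear.
HB.instance Definition _ := GRing.isLinear.Build F Th T _ T_mu T_mu_is_linear.

Local Notation ups n := (word (nseq n (inr (Theta_one F p)))).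

Lemma word1E (l : letter) : word [:: l] = nproj R (ltr l).
Proof. by rewrite /ltr fmuE. Qed.

Lemma word1M (l l' : letter) : (word [:: l] * word [:: l'])%A = nproj R (ltr l * ltr l')%A.
Proof. by rewrite !word1E (nprojM freealg_bilinear). Qed.

Lemma T_lamM (x y : Om) : (T_lam x * T_lam y)%A = T_lam (x * y)%A.
Proof.
rewrite [LHS]word1M [RHS]word1E; apply: T_rel; exact: talg_mulA.
Qed.

Lemma T_lam_mu (x : Om) (m : Th) : (T_lam x * T_mu m)%A = T_mu (Theta_lact x m).
Proof.
rewrite [LHS]word1M [RHS]word1E; apply: T_rel; exact: talg_lact.
Qed.

Lemma T_mu_lam (m : Th) (x : Om) : (T_mu m * T_lam x)%A = T_mu (Theta_ract m x).
Proof.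
rewrite [LHS]word1M [RHS]word1E; apply: T_rel; exact: talg_ract.
Qed.

Lemma T_lam_one : T_lam (Omega_one F p) = word [::].
Proof.
rewrite [LHS]word1E /talg_word -fmoneE; apply: T_rel; exact: talg_one.
Qed.

Lemma Omega_mulr1 (x : Om) : (x * Omega_one F p)%A = x.
Proof.
apply: (@ncoord_inj _ _ _ _ _ _ (Omega_coord F p)).
rewrite ncoordM Omega_coord_one -[RHS]malg_lift_id; apply: eq_malg_lift_in => b Ob.
have {}Ob : in_BOmega p b := ncoord_supported Ob.
rewrite linear_sum (@sum_vertex _ p (piB_end b)
  (fun s => malg_lift (Omega_struct F p b) << piB_e s >>)).
- rewrite malg_liftU /Omega_struct /piB_struct piB_mul_e eqxx.
  by rewrite [LHS]malg_restrictU Ob.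
- by case: b Ob => [[s al] be] /=; lia.
- move=> s _ /negPf sb; rewrite malg_liftU /Omega_struct /piB_struct piB_mul_e sb.
  exact: linear0.
Qed.

Lemma Theta_lact1 (x : Om) : Theta_lact x (Theta_one F p) = Omega_Theta x.
Proof. by rewrite /Theta_lact /Theta_one -Omega_ThetaM Omega_mulr1. Qed.

(** The tensor of [m] with [n] further factors, all equal to the unit of [Theta]. *)
Definition T_mu_ups n (m : Th) : T := (T_mu m * ups n)%A.

Lemma T_mu_ups_is_linear n : linear (T_mu_ups n).
Proof. by move=> c x y; rewrite /T_mu_ups linearP T_bilinear.1. Qed.

HB.instance Definition _ n :=
  GRing.isLinear.Build F Th T _ (T_mu_ups n) (T_mu_ups_is_linear n).

Definition T_basic (v : T) : Prop := exists2 k, in_BT p k & v = T_elt k.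

Lemma T_elt0 b : T_elt (b, 0%N) = T_lam (toOmega p (piB_elt F b)).
Proof. by []. Qed.

Lemma T_eltS b n : T_elt (b, n.+1) = T_mu_ups n (toTheta p (piB_elt F b)).
Proof. by rewrite /T_mu_ups T_wordM. Qed.

Lemma T_lam_span (x : Om) : lspan T_basic (T_lam x).
Proof.
rewrite -[x](ncoordK (Omega_coord F p)) linear_malg_lift; apply: lspan_sum => b Ob.
by apply: lspan_gen; exists (b, 0%N) => //; apply: (ncoord_supported Ob).
Qed.

Lemma T_mu_ups_span n (m : Th) : lspan T_basic (T_mu_ups n m).
Proof.
rewrite -[m](ncoordK (Theta_coord F p)) linear_malg_lift; apply: lspan_sum => b Tb.
apply: lspan_gen; exists (b, n.+1); first exact: (ncoord_supported Tb).
by rewrite T_eltS.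
Qed.

Lemma T_mu_ups0 (m : Th) : T_mu_ups 0 m = T_mu m.
Proof. by rewrite /T_mu_ups T_wordM. Qed.

Lemma T_mu_upsS n (m : Th) :
  (T_mu m * T_mu_ups n (Theta_one F p))%A = T_mu_ups n.+1 m.
Proof.
exact: (congr1 (nmul (T_mu m)) (T_wordM [:: inr (Theta_one F p)] (nseq n (inr (Theta_one F p))))).
Qed.

Lemma T_lam_mu_ups (x : Om) n (m : Th) :
  (T_lam x * T_mu_ups n m)%A = T_mu_ups n (Theta_lact x m).
Proof.
exact: etrans (T_Omega_mulA _ _ _) (congr1 (fun t => (t * ups n)%A) (T_lam_mu x m)).
Qed.

(** The class of [x] in [Theta] is [x] acting on the unit. As tensors are taken over [Omega], this
    [x] can be moved to the right end of [m]: all content collects in the first factor, and this is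
    why the elements [T_elt] span. *)
Lemma T_mu_mu_ups (m : Th) n (x : Om) :
  (T_mu m * T_mu_ups n (Omega_Theta x))%A = T_mu_ups n.+1 (Theta_ract m x).
Proof.
rewrite -Theta_lact1 -T_lam_mu_ups [LHS]T_Omega_mulA.
exact: etrans (congr1 (fun t => (t * _)%A) (T_mu_lam m x)) (T_mu_upsS n _).
Qed.

Lemma T_letter_elt_span (l : letter) (k : KT) : lspan T_basic (word [:: l] * T_elt k)%A.
Proof.
case: k => b [|n]; case: l => [x|m].
- rewrite T_elt0 [X in lspan _ X](T_lamM x); exact: T_lam_span.
- rewrite T_elt0 [X in lspan _ X](T_mu_lam m) -T_mu_ups0; exact: T_mu_ups_span.
- rewrite T_eltS [X in lspan _ X](T_lam_mu_ups x); exact: T_mu_ups_span.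
- rewrite T_eltS [X in lspan _ X]T_mu_mu_ups; exact: T_mu_ups_span.
Qed.

Lemma T_word_span (w : seq letter) : lspan T_basic (word w).
Proof.
elim: w => [|l w IH]; first by rewrite -T_lam_one; apply: T_lam_span.
rewrite -[word _](T_wordM [:: l] w).
apply: (lspan_ind_lin (T := fun v => lspan T_basic (word [:: l] * v)%A)) IH.
- by move=> _ [k _ ->]; apply: T_letter_elt_span.
- by rewrite (nmul0r T_bilinear); apply: lspan0.
- by move=> c u v; rewrite T_bilinear.2; apply: lspan_lin.
Qed.

Lemma T_coord_span (t : T) : lspan (fun v => exists2 k, in_BT p k & v = T_elt k) t.
Proof.
rewrite -[t]lreprK -[repr t]malg_lift_id linear_malg_lift.
apply: lspan_sum => -[w] _; exact: T_word_span.
Qed.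

Definition T_coord : ncoord (in_BT p) T_elt (T_struct F p) :=
  NCoord (ncf := @T_coord_fun F p) T_coord_elt T_coord_span
    (nqliftM (@free_coordM F p) (@free_coord_rel F p)).

End TensorAlgebraBasis.

(** * The grading of the tensor algebra *)

Section TensorAlgebraDegree.
Variables (F : fieldType) (p : nat).
Local Notation Om := (Omega F p).
Local Notation Th := (Theta F p).
Local Notation T := (T_Omega F p).
Local Notation letter := (letter Om Th).
Local Notation KT := (piB * nat)%type.
Local Notation wdeg := (word_deg (@Omega_deg F p) (@Theta_deg F p)).
Local Notation word :=
  (talg_word (Omega_one F p) (@Theta_lact F p) (@Theta_ract F p)).
Implicit Types (b c : piB).

Lemma piB_len_mul b b' c : piB_mul b b' = Some c ->
  piB_len c = (piB_len b + piB_len b')%N.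
Proof.
by case: b b' => [[s al] be] [[s' al'] be'] /=; case: eqP => // _ [<-] /=; lia.
Qed.

Lemma piB_len_twist n b : piB_len (twist p n b) = piB_len b.
Proof. by rewrite /twist; case: ifP => // _; case: b => [[s al] be] /=; lia. Qed.

Definition has_T_degree (n a : nat) (k : KT) := k.2 = n /\ piB_len k.1 = a.

Lemma tB_mul_degree n a n' a' x x' y : tB_mul p x x' = Some y ->
  has_T_degree n a x -> has_T_degree n' a' x' -> has_T_degree (n + n') (a + a') y.
Proof.
rewrite /tB_mul; case xx': (piB_mul _ _) => [c|] //=; case: ifP => // _ [<-] [<- <-] [<- <-].
by split=> //=; rewrite (piB_len_mul xx') piB_len_twist.
Qed.

Lemma T_struct_degree n a n' a' x x' :
  has_T_degree n a x -> has_T_degree n' a' x' ->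
  supported (has_T_degree (n + n') (a + a')) (T_struct F p x x').
Proof.
by move=> dx dx'; apply: malg_opt_supported => y xx'; apply: tB_mul_degree xx' dx dx'.
Qed.

Lemma Omega_deg_supported a (x : Om) : Omega_deg a x ->
  supported (fun b => piB_len b = a) (Omega_coord F p x).
Proof.
apply: (lspan_ind_lin (T := fun x => supported (fun b => piB_len b = a) (Omega_coord F p x))).
(* [toOmega] sends a path that leaves the subalgebra to 0, which is homogeneous of every degree. *)
- move=> _ [w <- ->]; have [w_le|nw_le] := pselect (Pi_le_mem p (Pi_path F w)).
    rewrite [Omega_coord F p _]Omega_coord_toOmega // [Pi_coord F _]Pi_coord_path.
    rewrite malg_restrictU; case: ifP => _; last exact: supported0.
    apply: (supportedU (P := fun b => piB_len b = size w.2)).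
    rewrite /= -(count_predC (pred1 true) w.2); congr (_ + _)%N.
    by apply: eq_count; case.
  by rewrite toOmega_out // linear0; apply: supported0.
- by rewrite linear0; apply: supported0.
- by move=> c u v du dv; rewrite linearP; apply: supportedP.
Qed.

Lemma Theta_deg_supported a (m : Th) : Theta_deg a m ->
  supported (fun b => piB_len b = a) (Theta_coord F p m).
Proof.
case=> x /Omega_deg_supported dx ->; rewrite [Theta_coord F p _]Theta_coord_Omega.
apply: supported_lift => b /dx db; case: ifP => _; last exact: supported0.
exact: (supportedU (P := fun b => piB_len b = a)).
Qed.

Lemma letter_deg_supported n a (l : letter) :
  letter_deg (@Omega_deg F p) (@Theta_deg F p) l n a ->
  supported (has_T_degree n a) (letter_coord l).
Proof.
case: l => [x|m] [-> d].
  apply: supported_sub (supported_degree (n := 0%N) (Omega_deg_supported d)).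
  by move=> k [].
apply: supported_sub (supported_degree (n := 1%N) (Theta_deg_supported d)).
by move=> k [].
Qed.

Lemma word_deg_supported w n a : wdeg w n a -> supported (has_T_degree n a) (word_coord w).
Proof.
elim=> {w n a} [|l w n a n' a' dl _ IH].
  by apply: supported_sum => s _; apply: (supportedU (P := has_T_degree 0 0)).
apply: supported_bilift => k k' /(letter_deg_supported dl) dk /IH dk'.
exact: T_struct_degree.
Qed.

Lemma Omega_deg_piB b : Omega_deg (piB_len b) (toOmega p (piB_elt F b)).
Proof.
case: b => [[s al] be]; apply: lspan_gen.
exists (s, nseq be false ++ nseq al true) => //.
by rewrite /= size_cat !size_nseq addnC.
Qed.

Lemma Omega_deg_one : Omega_deg 0 (Omega_one F p).
Proof.
rewrite /Omega_one; under eq_bigr do rewrite -[toOmega _ _]scale1r.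
apply: lspan_sum => s _; exact: (Omega_deg_piB (piB_e s%:Z)).
Qed.

Lemma T_elt_word_deg (k : KT) : wdeg (T_elt_word F p k) k.2 (piB_len k.1).
Proof.
case: k => b n; have Ob := @Omega_deg_piB b; case: n => [|n].
  have := word_deg_cons (l := inl (toOmega p (piB_elt F b))) (n := 0%N) (conj erefl Ob)
    (word_deg_nil _ _).
  by rewrite !addn0.
have Tb : Theta_deg (piB_len b) (toTheta p (piB_elt F b)) by exists (toOmega p (piB_elt F b)).
have Tn : wdeg (nseq n (inr (Theta_one F p))) n 0.
  elim: n => [|n IH]; first exact: word_deg_nil.
  have T1 : Theta_deg 0 (Theta_one F p) by exists (Omega_one F p) => //; apply: Omega_deg_one.
  exact: (word_deg_cons (l := inr (Theta_one F p)) (n := 1%N) (conj erefl T1) IH).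
have := word_deg_cons (l := inr (toTheta p (piB_elt F b))) (n := 1%N) (conj erefl Tb) Tn.
by rewrite addn0.
Qed.

(** The converse holds because the words that name the basis elements are themselves homogeneous. *)
Lemma T_degP n a (t : T) :
  talg_deg (@Omega_deg F p) (@Theta_deg F p) n a t <->
  supported (has_T_degree n a) (T_coord F p t).
Proof.
split.
  apply: (lspan_ind_lin (T := fun t => supported (has_T_degree n a) (T_coord F p t))).
  - move=> _ [w dw ->]; rewrite [T_coord F p _]T_coord_word.
    exact: word_deg_supported.
  - by rewrite linear0; apply: supported0.
  - by move=> c u v du dv; rewrite linearP; apply: supportedP.
move=> dt; rewrite -[t](ncoordK (T_coord F p)); apply: lspan_sum => k /dt [<- <-].
by apply: lspan_gen; exists (T_elt_word F p k); [apply: T_elt_word_deg|].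
Qed.

End TensorAlgebraDegree.

(** * Tensor products and Lambda *)

Section Pairing.
Variables (F : fieldType) (KA KB K : choiceType) (pr : KA -> KB -> K).

(** The pairing [pr] is left open: it is the pair for [ntens], [word_cons] for an application of O
    with [Lambda], and [skip_unit] for one with F. *)
Definition malg_pair (x : {malg F[KA]}) (y : {malg F[KB]}) : {malg F[K]} :=
  bilift (fun a b => << pr a b >>) x y.

(** The scalar [c] is 1 for the plain tensor product and the sign for O; it may be taken out because
    homogeneity makes it constant on the supports. *)
Lemma malg_pair_mul (mA : KA -> KA -> {malg F[KA]}) (mB : KB -> KB -> {malg F[KB]})
    (m : K -> K -> {malg F[K]}) (c : F) x y x' y' :
  (forall a b a' b', a \in msupp x -> b \in msupp y ->
     a' \in msupp x' -> b' \in msupp y' ->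
     m (pr a b) (pr a' b') = c *: malg_pair (mA a a') (mB b b')) ->
  bilift m (malg_pair x y) (malg_pair x' y') =
  c *: malg_pair (bilift mA x x') (bilift mB y y').
Proof.
move=> mE; rewrite [LHS]bilift_lift.
have -> : malg_pair (bilift mA x x') (bilift mB y y') =
    bilift (fun a a' => malg_pair (mA a a') (bilift mB y y')) x x'.
  exact: (linear_bilift (biliftr (fun a b => << pr a b >>) (bilift mB y y'))).
rewrite biliftZ; apply: eq_bilift_in => a a' ax a'x'.
have -> : malg_pair (mA a a') (bilift mB y y') =
    bilift (fun b b' => malg_pair (mA a a') (mB b b')) y y'.
  exact: (linear_bilift (bilift (fun a b => << pr a b >>) (mA a a'))).
rewrite bilift_lift biliftZ; apply: eq_bilift_in => b b' yb yb'.
by rewrite biliftUU mE.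
Qed.

Lemma malg_pairPl c x x' y :
  malg_pair (c *: x + x') y = c *: malg_pair x y + malg_pair x' y.
Proof. exact: biliftPl. Qed.

Lemma malg_pairPr c x y y' :
  malg_pair x (c *: y + y') = c *: malg_pair x y + malg_pair x y'.
Proof. exact: biliftPr. Qed.

Lemma malg_pairUU a b : malg_pair << a >> << b >> = << pr a b >>.
Proof. exact: biliftUU. Qed.

Lemma supported_pair (P : K -> Prop) x y :
  (forall a b, a \in msupp x -> b \in msupp y -> P (pr a b)) ->
  supported P (malg_pair x y).
Proof. by move=> Pab; apply: supported_bilift => a b /Pab Pa /Pa; apply: supportedU. Qed.

End Pairing.

Section TensorProduct.
Variables (F : fieldType) (A B : nalg F) (KA KB : choiceType).
Variables (PA : pred KA) (PB : pred KB) (eA : KA -> A) (eB : KB -> B).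
Variables (mA : KA -> KA -> {malg F[KA]}) (mB : KB -> KB -> {malg F[KB]}).
Variables (phiA : ncoord PA eA mA) (phiB : ncoord PB eB mB).
Local Notation KAB := (KA * KB)%type.
Local Notation pair_malg := (malg_pair (fun (a : KA) (b : KB) => (a, b) : KAB)).

Definition tens_pred (k : KAB) : bool := PA k.1 && PB k.2.
Definition tens_elt (k : KAB) : ntens A B := tens (eA k.1) (eB k.2).
Definition tens_struct (k l : KAB) : {malg F[KAB]} :=
  pair_malg (mA k.1 l.1) (mB k.2 l.2).

Definition tens_symb_coord : {malg F[(A * B)%type]} -> {malg F[KAB]} :=
  malg_lift (fun g : (A * B)%type => pair_malg (phiA g.1) (phiB g.2)).
HB.instance Definition _ := GRing.Linear.on tens_symb_coord.

Lemma tens_symb_coordU (x : A) (y : B) :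
  tens_symb_coord << ((x, y) : (A * B)%type) >> = pair_malg (phiA x) (phiB y).
Proof. exact: malg_liftU. Qed.

Lemma tens_rel_coord v : tens_rel v -> tens_symb_coord v = 0.
Proof.
case=> [[c [x [y [z ->]]]]|[c [x [y [z ->]]]]].
  apply: (linear_rel0 (f := tens_symb_coord));
    [exact: tens_symb_coordU | exact: tens_symb_coordU | exact: tens_symb_coordU | ].
  by rewrite linearP malg_pairPl.
apply: (linear_rel0 (f := tens_symb_coord));
  [exact: tens_symb_coordU | exact: tens_symb_coordU | exact: tens_symb_coordU | ].
by rewrite linearP malg_pairPr.
Qed.

Definition tens_coord_fun : ntens A B -> {malg F[KAB]} := qlift tens_rel_coord.
HB.instance Definition _ := GRing.Linear.on tens_coord_fun.

Lemma tens_coord_tens (x : A) (y : B) :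
  tens_coord_fun (tens x y) = pair_malg (phiA x) (phiB y).
Proof. by rewrite -tens_symb_coordU; apply: qliftE. Qed.

Lemma tens_coord_elt k : tens_pred k -> tens_coord_fun (tens_elt k) = << k >>.
Proof.
case: k => a b /andP[Pa Pb]; rewrite tens_coord_tens !ncoord_elt //.
exact: malg_pairUU.
Qed.

Lemma tens_coordM (u v : ntens A B) : tens_coord_fun (u * v)%A =
  bilift tens_struct (tens_coord_fun u) (tens_coord_fun v).
Proof.
rewrite [LHS](linear_bilift tens_coord_fun) [RHS]bilift_lift; apply: eq_bilift => g h.
rewrite [LHS]tens_coord_tens !ncoordM.
rewrite (@malg_pair_mul _ _ _ _ _ mA mB tens_struct 1) ?scale1r //.
by move=> a b a' b' *; rewrite scale1r.
Qed.

Lemma tens_linearl (y : B) : linear (fun x : A => tens x y : ntens A B).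
Proof.
by move=> c u v; apply: lproj_rel_linear; left; exists c, u, v, y.
Qed.

Lemma tens_linearr (x : A) : linear (fun y : B => tens x y : ntens A B).
Proof.
by move=> c u v; apply: lproj_rel_linear; right; exists c, x, u, v.
Qed.

Definition tensl (y : B) (x : A) : ntens A B := tens x y.
HB.instance Definition _ y := GRing.isLinear.Build F A (ntens A B) _ (tensl y) (tens_linearl y).
Definition tensr (x : A) (y : B) : ntens A B := tens x y.
HB.instance Definition _ x := GRing.isLinear.Build F B (ntens A B) _ (tensr x) (tens_linearr x).

Lemma tens_expand (x : A) (y : B) :
  tens x y = malg_lift (fun a => malg_lift (fun b => tens_elt (a, b)) (phiB y)) (phiA x).
Proof.
rewrite -[LHS]/(tensl y x) -[in LHS](ncoordK phiA x) linear_malg_lift.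
apply: eq_malg_lift => a; rewrite -[LHS]/(tensr (eA a) y) -[in LHS](ncoordK phiB y).
exact: linear_malg_lift.
Qed.

Lemma tens_coord_span (u : ntens A B) :
  lspan (fun v => exists2 k, tens_pred k & v = tens_elt k) u.
Proof.
rewrite -[u]lreprK -[repr u]malg_lift_id linear_malg_lift.
apply: lspan_sum => -[x y] _; rewrite [X in lspan _ X](tens_expand x y).
apply: lspan_sum => a /ncoord_supported Pa; apply: lspan_sum => b /ncoord_supported Pb.
by apply: lspan_gen; exists (a, b) => //; apply/andP.
Qed.

Definition tens_coord : ncoord tens_pred tens_elt tens_struct :=
  NCoord (ncf := tens_coord_fun) tens_coord_elt tens_coord_span tens_coordM.

End TensorProduct.

Section PolynomialCoordinates.
Variable F : fieldType.

Definition poly_coord_fun (f : polyalg F) : {malg F[nat]} :=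
  \sum_(i < size (f : {poly F})) (f : {poly F})`_i *: << (i : nat) >>.

Lemma poly_coord_coef (f : {poly F}) i : (poly_coord_fun f)@_i = f`_i.
Proof.
rewrite raddf_sum /=; under eq_bigr do rewrite mcoeffZ mcoeffU mulr_natr.
have [i_lt|i_ge] := ltnP i (size f).
  rewrite (bigD1 (Ordinal i_lt)) //= eqxx big1 ?addr0 // => j /negPf ji.
  by rewrite -[(j == i :> nat)]/(j == Ordinal i_lt) ji.
rewrite nth_default // big1 // => j _; case: eqP => // ji.
by have := ltn_ord j; rewrite ji ltnNge i_ge.
Qed.

Lemma poly_coord_is_linear : linear poly_coord_fun.
Proof.
by move=> c f g; apply/malgP => i; rewrite mcoeffD mcoeffZ !poly_coord_coef coefD coefZ.
Qed.

HB.instance Definition _ := GRing.isLinear.Build F (polyalg F) {malg F[nat]} _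
  poly_coord_fun poly_coord_is_linear.

Definition Xpow (n : nat) : polyalg F := 'X^n.
Definition nat_struct (i j : nat) : {malg F[nat]} := << (i + j)%N >>.

Lemma poly_coord_elt n : predT n -> poly_coord_fun (Xpow n) = << n >>.
Proof.
by move=> _; apply/malgP => i; rewrite poly_coord_coef coefXn mcoeffU eq_sym.
Qed.

Lemma poly_coord_span (f : polyalg F) :
  lspan (fun v => exists2 k, predT k & v = Xpow k) f.
Proof.
rewrite -[f](coefK (f : {poly F})) poly_def.
by apply: lspan_sum => i _; apply: lspan_gen; exists (i : nat).
Qed.

Lemma poly_coordM (f g : polyalg F) : poly_coord_fun (f * g)%A =
  bilift nat_struct (poly_coord_fun f) (poly_coord_fun g).
Proof.
(* The argument of [ncoordK], needed here before the record can be formed. *)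
have poly_lift (h : polyalg F) : malg_lift Xpow (poly_coord_fun h) = h.
  apply: (lspan_ind_lin (T := fun h => malg_lift Xpow (poly_coord_fun h) = h))
    (poly_coord_span h).
  - by move=> _ [k _ ->]; rewrite poly_coord_elt // malg_liftU.
  - by rewrite !linear0.
  - by move=> c u v eu ev; rewrite linearP malg_lift_is_linear eu ev.
have mul_lift (x y : {malg F[nat]}) : (malg_lift Xpow x * malg_lift Xpow y)%A =
    bilift (fun i j => (Xpow i * Xpow j)%A) x y.
  rewrite [LHS]mulr_suml; apply: eq_bigr => i _; rewrite -[LHS]scalerAl mulr_sumr.
  by congr (_ *: _); apply: eq_bigr => j _; rewrite -scalerAr.
rewrite -{1}[f]poly_lift -{1}[g]poly_lift mul_lift linear_bilift.
apply: eq_bilift => i j; rewrite -[(Xpow i * Xpow j)%A]/('X^i * 'X^j) -exprD.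
exact: poly_coord_elt.
Qed.

Definition poly_coord : ncoord predT Xpow nat_struct :=
  NCoord (ncf := poly_coord_fun) poly_coord_elt poly_coord_span poly_coordM.

End PolynomialCoordinates.

Section Transport.
Variables (F : fieldType) (A : nalg F) (K : choiceType) (P P' : pred K).
Variables (e e' : K -> A) (m m' : K -> K -> {malg F[K]}) (phi : ncoord P e m).
Hypotheses (P'E : P' =1 P) (e'E : forall k, P k -> e' k = e k).
Hypothesis (m'E : forall k l, m' k l = m k l).

Lemma ncoord_transport_elt k : P' k -> phi (e' k) = << k >>.
Proof. by rewrite P'E => Pk; rewrite e'E // ncoord_elt. Qed.

Lemma ncoord_transport_span a : lspan (fun v => exists2 k, P' k & v = e' k) a.
Proof.
have := ncoord_span phi a; apply: lspan_sub => _ [k Pk ->].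
by apply: lspan_gen; exists k; rewrite ?P'E ?e'E.
Qed.

Lemma ncoord_transportM x y : phi (x * y)%A = bilift m' (phi x) (phi y).
Proof. by rewrite ncoordM; apply: eq_bilift => k l; rewrite m'E. Qed.

(** The tensor product delivers predicate, names and structure constants in product form; here they
    are exchanged for the equal ones stated for B_Lambda. *)
Definition ncoord_transport : ncoord P' e' m' :=
  NCoord (ncf := phi) ncoord_transport_elt ncoord_transport_span ncoord_transportM.
End Transport.

Section LambdaBasis.
Variables (F : fieldType) (p : nat).

Definition Lambda_struct (x y : lamB) : {malg F[lamB]} := malg_opt F (lamB_mul p x y).

Lemma in_BLambdaE (x : lamB) : in_BLambda p x = in_BT p x.1.
Proof. by case: x => [[b n] h]. Qed.

Lemma BLambda_tens_pred :
  in_BLambda p =1 tens_pred (in_BT p) (predT : pred nat).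
Proof. by move=> x; rewrite in_BLambdaE /tens_pred andbT. Qed.

Lemma Lambda_elt_tens (x : lamB) : Lambda_elt F p x = tens_elt (T_elt F p) (Xpow F) x.
Proof. by case: x => [[b [|n]] h]. Qed.

Lemma Lambda_struct_tens (x y : lamB) :
  Lambda_struct x y = tens_struct (T_struct F p) (nat_struct F) x y.
Proof.
case: x y => [x h] [y h']; rewrite /Lambda_struct lamB_mulE /tens_struct /T_struct.
case: (tB_mul p x y) => [z|] /=; last by rewrite [RHS]bilift0l.
by rewrite [RHS]malg_pairUU.
Qed.

Definition Lambda_coord : ncoord (in_BLambda p) (Lambda_elt F p) Lambda_struct :=
  ncoord_transport (tens_coord (T_coord F p) (poly_coord F)) BLambda_tens_pred
    (fun x _ => Lambda_elt_tens x) Lambda_struct_tens.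

Definition has_Lambda_degree (i j k : int) (x : lamB) :=
  [/\ (lamB_i x)%:Z = i, (lamB_j p x)%:Z = j & (lamB_k p x)%:Z = k].

Lemma Lambda_degP i j k (u : Lambda F p) :
  trideg i j k u <-> supported (has_Lambda_degree i j k) (Lambda_coord u).
Proof.
split.
  apply: (lspan_ind_lin (T := fun u => supported (has_Lambda_degree i j k) (Lambda_coord u))).
  - move=> _ [n [a [h [t [/T_degP dt -> -> -> ->]]]]].
    rewrite [Lambda_coord _]tens_coord_tens [poly_coord F _](@poly_coord_elt F h) //.
    rewrite /malg_pair biliftlU; apply: supported_lift => -[b n'] /dt [/= <- <-].
    apply: (supportedU (P := has_Lambda_degree _ _ _)).
    by split=> //=; congr (Posz _); rewrite addnC.
  - by rewrite linear0; apply: supported0.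
  - by move=> c v w dv dw; rewrite linearP; apply: supportedP.
move=> du; rewrite -[u](ncoordK Lambda_coord); apply: lspan_sum => x xu.
have [<- <- <-] := du x xu; apply: lspan_gen.
case: x xu => [[b n] h] xu.
exists n, (piB_len b), h, (T_elt F p (b, n)); split.
- apply/T_degP; rewrite ncoord_elt; last first.
    by have := ncoord_supported xu; rewrite in_BLambdaE.
  exact: (supportedU (P := has_T_degree _ _)).
- by [].
- by [].
- by [].
- exact: Lambda_elt_tens.
Qed.

Lemma lamB_mul_degree (x y z : lamB) : lamB_mul p x y = Some z ->
  [/\ lamB_i z = (lamB_i x + lamB_i y)%N, lamB_j p z = (lamB_j p x + lamB_j p y)%N
    & lamB_k p z = (lamB_k p x + lamB_k p y)%N].
Proof.
case: x y => [[b n] h] [[b' n'] h']; rewrite lamB_mulE.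
case xy: (tB_mul p (b, n) (b', n')) => [[c m]|] //= [<-] /=.
have [/= -> ->] := tB_mul_degree xy (conj erefl erefl) (conj erefl erefl).
by rewrite !mulnDr; split; lia.
Qed.

End LambdaBasis.

(** * The operator O *)

Section OperatorCoordinates.
Variables (F : fieldType) (G : trialg F) (D : bialg F).
Variables (KG KD K : choiceType) (pr : KG -> KD -> K).
Variables (PG : pred KG) (eG : KG -> G) (mG : KG -> KG -> {malg F[KG]}).
Variables (PD : pred KD) (eD : KD -> D) (mD : KD -> KD -> {malg F[KD]}).
Variables (phiG : ncoord PG eG mG) (phiD : ncoord PD eD mD).
Variables (gi gj gk : KG -> int) (dj dk : KD -> int).

Definition tri_degree (i j k : int) (a : KG) := [/\ gi a = i, gj a = j & gk a = k].
Definition bi_degree (j k : int) (b : KD) := dj b = j /\ dk b = k.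

Hypothesis G_degP : forall i j k x,
  trideg (t := G) i j k x <-> supported (tri_degree i j k) (phiG x).
Hypothesis G_mul : forall a a', PG a -> PG a' ->
  supported (tri_degree (gi a + gi a') (gj a + gj a') (gk a + gk a')) (mG a a').
Hypothesis D_degP : forall j k y,
  bideg (b := D) j k y <-> supported (bi_degree j k) (phiD y).
Hypothesis D_mul : forall b b', PD b -> PD b' ->
  supported (bi_degree (dj b + dj b') (dk b + dk b')) (mD b b').

Variables (P : pred K) (e : K -> opO G D) (m : K -> K -> {malg F[K]}).
Variables (ki kk : K -> int).
(** Symbols of the result are the pairs with equal [j]-degrees, the condition that selects the
    summands of O. *)
Hypothesis PE : forall k, P k ->
  exists a b, [/\ PG a, PD b, gj a = dj b & k = pr a b].
Hypothesis prP : forall a b, PG a -> PD b -> gj a = dj b -> P (pr a b).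
Hypothesis eE : forall a b, PG a -> PD b -> gj a = dj b ->
  e (pr a b) = otens (gi a, gj a, gk a, dk b) (eG a) (eD b).
Hypothesis mE : forall a b a' b', PG a -> PD b -> PG a' -> PD b' ->
  m (pr a b) (pr a' b') =
  (-1) ^ (gk a' * dk b) *: malg_pair pr (mG a a') (mD b b').
Hypothesis kiE : forall a b, ki (pr a b) = gi a.
Hypothesis kkE : forall a b, kk (pr a b) = gk a + dk b.

Local Notation homog := (ohom (G := G) (D := D)).

Lemma ohomP i j k1 k2 x y : homog (i, j, k1, k2, (x, y)) <->
  supported (tri_degree i j k1) (phiG x) /\ supported (bi_degree j k2) (phiD y).
Proof. by rewrite -G_degP -D_degP. Qed.

Definition osymb_coord (g : osymb G D) : {malg F[K]} :=
  malg_pair pr (phiG (val g).2.1) (phiD (val g).2.2).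

Definition osymb_malg_coord : {malg F[osymb G D]} -> {malg F[K]} := malg_lift osymb_coord.
HB.instance Definition _ := GRing.Linear.on osymb_malg_coord.

Lemma osymb_malg_coordU g : osymb_malg_coord << g >> = osymb_coord g.
Proof. exact: malg_liftU. Qed.

Lemma otens_rel_coord v : otens_rel v -> osymb_malg_coord v = 0.
Proof.
case=> c [g [g1 [g2 [_ _ -> gE]]]].
apply: (linear_rel0 (f := osymb_malg_coord)) (osymb_malg_coordU _)
  (osymb_malg_coordU _) (osymb_malg_coordU _) _.
rewrite /osymb_coord; case: ((val g).2) ((val g1).2) ((val g2).2) gE => [x y] [x1 y1] [x2 y2].
case=> [[-> <- <-]|[<- <- ->]] /=; first by rewrite linearP malg_pairPl.
by rewrite linearP malg_pairPr.
Qed.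

Definition oalg_coord_fun : opO G D -> {malg F[K]} := qlift otens_rel_coord.
HB.instance Definition _ := GRing.Linear.on oalg_coord_fun.

Lemma otensE d x y (h : homog (d, (x, y))) :
  otens d x y = lproj (otens_rel (D := D)) << (Sub (d, (x, y)) (asboolT h) : osymb G D) >>.
Proof. by rewrite /otens (insubT (fun g => `[< homog g >]) (asboolT h)). Qed.

Lemma oalg_coord_symb (g : osymb G D) :
  oalg_coord_fun (lproj (otens_rel (D := D)) << g >>) = osymb_coord g.
Proof. by rewrite -osymb_malg_coordU; apply: qliftE. Qed.

Lemma oalg_coord_otens d x y : homog (d, (x, y)) ->
  oalg_coord_fun (otens d x y) = malg_pair pr (phiG x) (phiD y).
Proof. by move=> h; rewrite (otensE h) [LHS]oalg_coord_symb. Qed.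

Lemma oalg_coord_elt k : P k -> oalg_coord_fun (e k) = << k >>.
Proof.
case/PE=> a [b [Pa Pb ab ->]]; rewrite eE // oalg_coord_otens.
  by rewrite !ncoord_elt // malg_pairUU.
apply/ohomP; rewrite !ncoord_elt //; split.
  exact: (supportedU (P := tri_degree _ _ _)).
exact: (supportedU (P := bi_degree _ _)).
Qed.

Lemma oalg_coordM (u v : opO G D) : oalg_coord_fun (u * v)%A =
  bilift m (oalg_coord_fun u) (oalg_coord_fun v).
Proof.
rewrite [LHS](linear_bilift oalg_coord_fun) [RHS]bilift_lift; apply: eq_bilift.
move=> [[[[[i j] k1] k2] [x y]] g_hom] [[[[[i' j'] k1'] k2'] [x' y']] h_hom].
rewrite /osymb_coord /osymb_mul /=.
have /ohomP[dx dy] := asboolW g_hom; have /ohomP[dx' dy'] := asboolW h_hom.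
rewrite linearZ /= oalg_coord_otens; last first.
  apply/ohomP; rewrite !ncoordM; split; apply: supported_bilift.
    move=> a a' xa xa'; have [<- <- <-] := dx _ xa; have [<- <- <-] := dx' _ xa'.
    by apply: G_mul; [apply: ncoord_supported xa | apply: ncoord_supported xa'].
  move=> b b' yb yb'; have [<- <-] := dy _ yb; have [<- <-] := dy' _ yb'.
  by apply: D_mul; [apply: ncoord_supported yb | apply: ncoord_supported yb'].
rewrite !ncoordM; symmetry; apply: malg_pair_mul => a b a' b' xa yb xa' yb'.
rewrite mE; try by [apply: ncoord_supported xa | apply: ncoord_supported xa'
  | apply: ncoord_supported yb | apply: ncoord_supported yb'].
(* [osymb_mul] takes its sign from the degrees of the summands; by homogeneity these are the degrees
   of the symbols [a'] and [b]. *)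
by have [_ _ ->] := dx' _ xa'; have [_ ->] := dy _ yb.
Qed.

(** Both terms have to be homogeneous for the same index [d], because [otens] is 0 by default on
    other arguments. *)
Lemma otens_linearl d c x1 x2 y :
  homog (d, (x1, y)) -> homog (d, (x2, y)) ->
  otens d (c *: x1 + x2) y = c *: otens d x1 y + otens d x2 y :> opO G D.
Proof.
case: d => [[[i j] k1] k2] h1 h2.
have h : homog (i, j, k1, k2, (c *: x1 + x2, y)).
  move: h1 h2 => /ohomP[d1 dy] /ohomP[d2 _]; apply/ohomP; split=> //.
  by rewrite linearP; apply: supportedP.
rewrite (otensE h1) (otensE h2) (otensE h); apply: lproj_rel_linear.
pose s z (hz : homog z) : osymb G D := Sub z (asboolT hz).
by exists c, (s _ h), (s _ h1), (s _ h2); split=> //; left.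
Qed.

Lemma otens_linearr d c x y1 y2 :
  homog (d, (x, y1)) -> homog (d, (x, y2)) ->
  otens d x (c *: y1 + y2) = c *: otens d x y1 + otens d x y2 :> opO G D.
Proof.
case: d => [[[i j] k1] k2] h1 h2.
have h : homog (i, j, k1, k2, (x, c *: y1 + y2)).
  move: h1 h2 => /ohomP[dx d1] /ohomP[_ d2]; apply/ohomP; split=> //.
  by rewrite linearP; apply: supportedP.
rewrite (otensE h1) (otensE h2) (otensE h); apply: lproj_rel_linear.
pose s z (hz : homog z) : osymb G D := Sub z (asboolT hz).
by exists c, (s _ h), (s _ h1), (s _ h2); split=> //; right.
Qed.

Lemma otens0l d y : homog (d, (0, y)) -> otens d 0 y = 0 :> opO G D.
Proof.
move=> h; have := otens_linearl 1 h h; rewrite !scale1r addr0.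
by rewrite -[X in X = _]addr0 => /addrI.
Qed.

Lemma otens0r d x : homog (d, (x, 0)) -> otens d x 0 = 0 :> opO G D.
Proof.
move=> h; have := otens_linearr 1 h h; rewrite !scale1r addr0.
by rewrite -[X in X = _]addr0 => /addrI.
Qed.

Lemma otens_suml i j k1 k2 (I : eqType) (r : seq I) (c : I -> F) (f : I -> G) y :
  (forall a, a \in r -> supported (tri_degree i j k1) (phiG (f a))) ->
  supported (bi_degree j k2) (phiD y) ->
  otens (i, j, k1, k2) (\sum_(a <- r) c a *: f a) y =
  \sum_(a <- r) c a *: otens (i, j, k1, k2) (f a) y :> opO G D.
Proof.
move=> df dy; elim: r df => [|a r IH] df.
  rewrite !big_nil otens0l //; apply/ohomP; split=> //.
  by rewrite linear0; apply: supported0.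
have dr b : b \in r -> supported (tri_degree i j k1) (phiG (f b)).
  by move=> rb; apply: df; rewrite inE rb orbT.
rewrite !big_cons otens_linearl ?IH //; apply/ohomP; split=> //.
  by apply: df; rewrite inE eqxx.
rewrite linear_sum big_seq; apply: supported_sum => b /dr db.
by rewrite linearZ; apply: supportedZ.
Qed.

Lemma otens_sumr i j k1 k2 (I : eqType) (r : seq I) (c : I -> F) x (f : I -> D) :
  supported (tri_degree i j k1) (phiG x) ->
  (forall b, b \in r -> supported (bi_degree j k2) (phiD (f b))) ->
  otens (i, j, k1, k2) x (\sum_(b <- r) c b *: f b) =
  \sum_(b <- r) c b *: otens (i, j, k1, k2) x (f b) :> opO G D.
Proof.
move=> dx df; elim: r df => [|a r IH] df.
  rewrite !big_nil otens0r //; apply/ohomP; split=> //.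
  by rewrite linear0; apply: supported0.
have dr b : b \in r -> supported (bi_degree j k2) (phiD (f b)).
  by move=> rb; apply: df; rewrite inE rb orbT.
rewrite !big_cons otens_linearr ?IH //; apply/ohomP; split=> //.
  by apply: df; rewrite inE eqxx.
rewrite linear_sum big_seq; apply: supported_sum => b /dr db.
by rewrite linearZ; apply: supportedZ.
Qed.

Lemma otens_expand i j k1 k2 x y : homog (i, j, k1, k2, (x, y)) ->
  otens (i, j, k1, k2) x y =
  malg_lift (fun a => malg_lift (fun b => e (pr a b)) (phiD y)) (phiG x).
Proof.
move=> /ohomP[dx dy].
have deG a : a \in msupp (phiG x) -> supported (tri_degree i j k1) (phiG (eG a)).
  move=> xa; rewrite ncoord_elt; last exact: ncoord_supported xa.
  by apply: (supportedU (P := tri_degree i j k1)); apply: dx.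
have deD b : b \in msupp (phiD y) -> supported (bi_degree j k2) (phiD (eD b)).
  move=> yb; rewrite ncoord_elt; last exact: ncoord_supported yb.
  by apply: (supportedU (P := bi_degree j k2)); apply: dy.
transitivity (otens (i, j, k1, k2)
    (\sum_(a <- msupp (phiG x)) (phiG x)@_a *: eG a) y : opO G D).
  exact: (congr1 (fun z => otens _ z y) (esym (ncoordK phiG x))).
rewrite (otens_suml _ deG dy); apply: eq_big_seq => a xa; apply: congr1.
transitivity (otens (i, j, k1, k2) (eG a)
    (\sum_(b <- msupp (phiD y)) (phiD y)@_b *: eD b) : opO G D).
  exact: (congr1 (otens _ (eG a)) (esym (ncoordK phiD y))).
rewrite (otens_sumr _ (deG a xa) deD).
apply: eq_big_seq => b yb; congr (_ *: _).
(* [eE] names the summand by the degrees of the symbols; homogeneity identifies them with the given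
   index. *)
have [ia ja ka] := dx a xa; have [jb kb] := dy b yb.
rewrite eE ?ia ?ja ?ka ?kb ?jb //.
  exact: ncoord_supported xa.
exact: ncoord_supported yb.
Qed.

Lemma lproj_symbE (g : osymb G D) :
  lproj (otens_rel (D := D)) << g >> = otens (val g).1 (val g).2.1 (val g).2.2.
Proof.
case: g => [[d [x y]] h] /=; rewrite (otensE (asboolW h)).
by congr (lproj _ << _ >>); apply: val_inj.
Qed.

Lemma oalg_coord_span (u : opO G D) : lspan (fun v => exists2 k, P k & v = e k) u.
Proof.
rewrite -[u]lreprK -[repr u]malg_lift_id linear_malg_lift.
apply: lspan_sum => g _; rewrite [X in lspan _ X]lproj_symbE.
case: g => [[[[[i j] k1] k2] [x y]] h] /=.
have h_hom := asboolW h; have /ohomP[dx dy] := h_hom.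
rewrite (otens_expand h_hom); apply: lspan_sum => a xa; apply: lspan_sum => b yb.
apply: lspan_gen; exists (pr a b) => //; apply: prP.
- exact: ncoord_supported xa.
- exact: ncoord_supported yb.
- by have [_ -> _] := dx a xa; have [-> _] := dy b yb.
Qed.

Definition oalg_coord : ncoord P e m :=
  NCoord (ncf := oalg_coord_fun) oalg_coord_elt oalg_coord_span oalg_coordM.

(** Has the form of the hypothesis [D_degP], so that O can be applied again. *)
Lemma oalg_degP i k (u : opO G D) :
  bideg i k u <-> supported (fun c => ki c = i /\ kk c = k) (oalg_coord u).
Proof.
split.
  apply: (lspan_ind_lin (T := fun u =>
    supported (fun c => ki c = i /\ kk c = k) (oalg_coord u))).
  - move=> _ [j [k1 [k2 [x [y [dx dy <- ->]]]]]].
    rewrite [oalg_coord _]oalg_coord_otens //.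
    apply: supported_pair => a b; rewrite kiE kkE.
    by move=> /(iffLR (G_degP _ _ _ _) dx)[-> _ ->] /(iffLR (D_degP _ _ _) dy)[_ ->].
  - by rewrite linear0; apply: supported0.
  - by move=> c u1 u2 d1 d2; rewrite linearP; apply: supportedP.
move=> du; rewrite -[u](ncoordK oalg_coord); apply: lspan_sum => c uc.
have [<- <-] := du c uc; have [a [b [Pa Pb ab ->]]] := PE (ncoord_supported uc).
apply: lspan_gen; exists (gj a), (gk a), (dk b), (eG a), (eD b).
rewrite kiE kkE eE //; split=> //.
  apply/G_degP; rewrite ncoord_elt //; exact: (supportedU (P := tri_degree _ _ _)).
apply/D_degP; rewrite ncoord_elt //; exact: (supportedU (P := bi_degree _ _)).
Qed.

End OperatorCoordinates.

(** * Iteration of the operator *)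

Section WordCombinatorics.
Variables (p : nat).
Local Notation KS := (seq lamB * nat)%type.
Implicit Types (s t r : seq lamB) (l : nat).

(** The degree that the [j]-degree of a letter placed in front has to match; for the empty word it
    is the degree of the power of [z]. *)
Definition word_i (x : KS) : int := if x.1 is a :: _ then (lamB_i a)%:Z else x.2%:Z.
Definition word_k (x : KS) : int := seqB_k p x.1.

(** All entries of the height except the first are zero; the first remains free, as it is the
    grading that O leaves on its output. *)
Fixpoint matched s l : bool :=
  if s is a :: s' then ((lamB_j p a)%:Z == word_i (s', l)) && matched s' l else true.

Lemma height_from_matched j s l :
  all (eq_op^~ 0) (height_from p j s l) = (word_i (s, l) == j%:Z) && matched s l.
Proof.
elim: s j => [|a s IH] j /=; first by rewrite subr_eq0 !andbT.
by rewrite subr_eq0 IH [_ == word_i _]eq_sym.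
Qed.

Definition in_BO (q : nat) (x : KS) : bool :=
  [&& size x.1 == q, all (in_BLambda p) x.1 & matched x.1 x.2].

Definition sign_exponent s t : nat :=
  \sum_(i < size s) \sum_(i' < size t | (i' < i)%N)
     lamB_k p (nth lamB_hat1 s i) * lamB_k p (nth lamB_hat1 t i').

(** The first letter of the first word has no earlier position to cross. The first letter [a'] of
    the second word is crossed by every letter of [s]. *)
Lemma sign_exponent_cons a s a' t :
  sign_exponent (a :: s) (a' :: t) =
  (lamB_k p a' * (\sum_(x <- s) lamB_k p x) + sign_exponent s t)%N.
Proof.
rewrite /sign_exponent big_ord_recl big1 // add0n.
have -> : (\sum_(x <- s) lamB_k p x = \sum_(i < size s) lamB_k p (nth lamB_hat1 s i))%N.
  by rewrite (big_nth lamB_hat1) big_mkord.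
rewrite big_distrr -big_split /=; apply: eq_bigr => i _.
rewrite (big_mkcond (fun i' : 'I_(size (a' :: t)) => (i' < _)%N)) big_ord_recl /=.
by rewrite mulnC -big_mkcond.
Qed.

Lemma seqB_kE s : seqB_k p s = (\sum_(x <- s) lamB_k p x)%N%:Z.
Proof. by rewrite /seqB_k (big_morph Posz PoszD (erefl _)). Qed.

Lemma seqB_mul_all s t r : size s = size t -> seqB_mul p s t = Some r ->
  size r = size s /\ all (in_BLambda p) r.
Proof.
elim: s t r => [|a s IH] [|b t] r //=; first by move=> _ [<-].
case=> st; rewrite /=; case ab: (lamB_mul p a b) => [c|] //.
case r0: (seqB_mul p s t) => [r'|] //= [<-] /=; have [-> ->] := IH _ _ st r0.
split=> //; rewrite andbT.
case: a b ab => [x h] [y h']; rewrite lamB_mulE.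
case xy: (tB_mul p x y) => [z|] //= [<-]; rewrite in_BLambdaE.
exact: tB_mul_BT xy.
Qed.

Lemma seqB_mul_degree s t r l l' : size s = size t -> seqB_mul p s t = Some r ->
  word_i (r, (l + l')%N) = word_i (s, l) + word_i (t, l') /\
  seqB_k p r = seqB_k p s + seqB_k p t.
Proof.
move=> st; rewrite !seqB_kE -PoszD => rst; split.
  case: s t st rst => [|a s] [|b t] //= _; first by move=> [<-].
  case ab: (lamB_mul p a b) => [c|] //; case: seqB_mul => //= r' [<-].
  by rewrite /word_i /=; have [-> _ _] := lamB_mul_degree ab.
congr Posz; elim: s t r st rst => [|a s IH] [|b t] r //=.
  by move=> _ [<-]; rewrite !big_nil.
case=> st; case ab: (lamB_mul p a b) => [c|] //.
case r0: (seqB_mul p s t) => [r'|] //= [<-]; rewrite !big_cons (IH _ _ st r0).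
by have [_ _ ->] := lamB_mul_degree ab; rewrite addnACA.
Qed.

Variable F : fieldType.

Definition B_struct (x y : KS) : {malg F[KS]} :=
  (-1) ^+ seqB_sign p x.1 y.1 *:
    malg_opt F (omap (fun r => (r, (x.2 + y.2)%N) : KS) (seqB_mul p x.1 y.1)).

Definition word_cons (a : lamB) (x : KS) : KS := (a :: x.1, x.2).

(** The recursion of the sign of B is exactly the sign of one application of O. *)
Lemma B_struct_cons a x a' x' :
  B_struct (word_cons a x) (word_cons a' x') =
  (-1) ^ ((lamB_k p a')%:Z * word_k x) *:
    malg_pair word_cons (Lambda_struct F p a a') (B_struct x x').
Proof.
case: x x' => [s l] [t l']; rewrite /B_struct /=.
rewrite /seqB_sign -!/(sign_exponent _ _) !signr_odd sign_exponent_cons.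
rewrite /word_k seqB_kE -PoszM -exprnP exprD -scalerA; congr (_ *: _).
rewrite /malg_pair linearZ -/(malg_pair _ _ _); congr (_ *: _).
rewrite /Lambda_struct; case: (lamB_mul p a a') => [c|] /=; last by rewrite [RHS]bilift0l.
case: (seqB_mul p s t) => [r|] /=; last by rewrite [RHS]bilift0r.
by rewrite [RHS]malg_pairUU.
Qed.

Lemma B_struct_degree q x y : in_BO q x -> in_BO q y ->
  supported (fun z => word_i z = word_i x + word_i y /\ word_k z = word_k x + word_k y)
    (B_struct x y).
Proof.
case: x y => [s l] [t l'] /and3P[/eqP /= qs _ _] /and3P[/eqP /= qt _ _].
apply: supportedZ; case rst: (seqB_mul p s t) => [r|]; last exact: supported0.
apply: (supportedU (P := fun z => _ z = _ /\ _ z = _)).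
by apply: seqB_mul_degree rst; rewrite qs.
Qed.

End WordCombinatorics.

Section Tower.
Variables (F : fieldType) (p : nat).
Local Notation KS := (seq lamB * nat)%type.

(** The same elements as [lambdaO_elt], but with a type that depends on [q] alone, so that
    coordinates can be built by recursion on [q]; words of another length are excluded by
    [in_BO]. *)
Fixpoint lambdaO_basis (q : nat) : KS -> lambdaO F p q :=
  match q return KS -> lambdaO F p q with
  | 0 => fun x => ('X^(x.2) : polyalg F)
  | q'.+1 => fun x =>
      if x.1 is a :: s then
        otens (G := Lambda F p) (D := lambdaO F p q')
          ((lamB_i a)%:Z, (lamB_j p a)%:Z, (lamB_k p a)%:Z, seqB_k p s)
          (Lambda_elt F p a) (lambdaO_basis q' (s, x.2))
      else 0
  end.

Lemma lambdaO_eltE s l : lambdaO_elt F p s l = lambdaO_basis (size s) (s, l).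
Proof. by elim: s => //= a s ->. Qed.

(** The inductive invariant of the iteration: coordinates together with a description of the
    homogeneous components. *)
Record bicoord (D : bialg F) (P : pred KS) (e : KS -> D) := BiCoord {
  bicoord_ncoord :> ncoord P e (B_struct p F);
  bicoord_degP : forall j k y, bideg (b := D) j k y <->
    supported (bi_degree word_i (word_k p) j k) (bicoord_ncoord y)
}.

Definition Fz_coord_fun (f : biFz F) : {malg F[KS]} :=
  malg_lift (fun l => << (([::], l) : KS) >>) (poly_coord F f).

Lemma Fz_coord_is_linear : linear Fz_coord_fun.
Proof. by move=> c u v; rewrite /Fz_coord_fun !linearP. Qed.

HB.instance Definition _ :=
  GRing.isLinear.Build F (biFz F) {malg F[KS]} _ Fz_coord_fun Fz_coord_is_linear.

Lemma Fz_coordX l : Fz_coord_fun (Xpow F l) = << (([::], l) : KS) >>.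
Proof. by rewrite /Fz_coord_fun ncoord_elt // malg_liftU. Qed.

Lemma Fz_coord_elt x : in_BO p 0 x -> Fz_coord_fun (lambdaO_basis 0 x) = << x >>.
Proof. by case: x => [[|a s] l] //= _; apply: Fz_coordX. Qed.

Lemma Fz_coord_span (f : biFz F) :
  lspan (fun v => exists2 x, in_BO p 0 x & v = lambdaO_basis 0 x) f.
Proof.
have := ncoord_span (poly_coord F) f; apply: lspan_sub => _ [l _ ->].
by apply: lspan_gen; exists ([::], l).
Qed.

Lemma Fz_coordM (f g : biFz F) :
  Fz_coord_fun (f * g)%A = bilift (B_struct p F) (Fz_coord_fun f) (Fz_coord_fun g).
Proof.
rewrite /Fz_coord_fun ncoordM linear_bilift [RHS]bilift_lift; apply: eq_bilift => l l'.
rewrite biliftUU [LHS]malg_liftU /B_struct /seqB_sign big_ord0 /= expr0 scale1r.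
by [].
Qed.

Lemma Fz_degP j k (f : biFz F) : bideg j k f <->
  supported (bi_degree word_i (word_k p) j k) (Fz_coord_fun f).
Proof.
split.
  apply: (lspan_ind_lin (T := fun f =>
    supported (bi_degree word_i (word_k p) j k) (Fz_coord_fun f))).
  - move=> _ [l [-> -> ->]]; rewrite [Fz_coord_fun _]Fz_coordX.
    apply: (supportedU (P := bi_degree word_i (word_k p) _ _)).
    by split; rewrite // /word_k /seqB_k big_nil.
  - by rewrite linear0; apply: supported0.
  - by move=> c u v du dv; rewrite Fz_coord_is_linear; apply: supportedP.
move=> df; rewrite -[f](ncoordK (poly_coord F)); apply: lspan_sum => l fl.
(* Distinct powers have distinct symbols, so nothing cancels when the exponents are turned into
   words. *)
have lf : ([::], l) \in msupp (Fz_coord_fun f).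
  rewrite -mcoeff_neq0 raddf_sum (bigD1_seq l) ?fset_uniq //= big1.
    by rewrite addr0 mcoeffZ mcoeffU eqxx mulr1 mcoeff_neq0.
  move=> l' /negPf ll'; rewrite mcoeffZ mcoeffU.
  by rewrite xpair_eqE /= ll' mulr0.
have [<- <-] := df _ lf; apply: lspan_gen; exists l; split=> //.
by rewrite /word_k /seqB_k big_nil.
Qed.

Definition Fz_ncoord : ncoord (in_BO p 0) (lambdaO_basis 0) (B_struct p F) :=
  NCoord (ncf := Fz_coord_fun) Fz_coord_elt Fz_coord_span Fz_coordM.

Lemma Lambda_struct_degree (a a' : lamB) :
  supported (tri_degree (fun a => (lamB_i a)%:Z) (fun a => (lamB_j p a)%:Z)
      (fun a => (lamB_k p a)%:Z)
    ((lamB_i a)%:Z + (lamB_i a')%:Z) ((lamB_j p a)%:Z + (lamB_j p a')%:Z)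
    ((lamB_k p a)%:Z + (lamB_k p a')%:Z)) (Lambda_struct F p a a').
Proof.
rewrite /Lambda_struct; case aa': (lamB_mul p a a') => [c|]; last exact: supported0.
apply: (supportedU (P := tri_degree _ _ _ _ _ _)).
by have [ic jc kc] := lamB_mul_degree aa'; split; rewrite -PoszD ?ic ?jc ?kc.
Qed.

Section Step.
Variables (q : nat).

Lemma in_BO_cons (x : KS) : in_BO p q.+1 x -> exists a y,
  [/\ in_BLambda p a, in_BO p q y, (lamB_j p a)%:Z = word_i y & x = word_cons a y].
Proof.
case: x => [[|a s] l] // /and3P[/= /eqP[sq] /andP[Ba Bs] /andP[/eqP ij ml]].
by exists a, (s, l); split=> //; apply/and3P; split=> //; apply/eqP.
Qed.

Lemma in_BO_word_cons (a : lamB) (y : KS) : in_BLambda p a -> in_BO p q y ->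
  (lamB_j p a)%:Z = word_i y -> in_BO p q.+1 (word_cons a y).
Proof.
case: y => s l Ba /and3P[/= /eqP sq Bs ml] ij.
by apply/and3P; rewrite /= sq Ba Bs ml ij !eqxx.
Qed.

Variable phi : bicoord (in_BO p q) (lambdaO_basis q).

Lemma word_k_cons (a : lamB) (x : KS) :
  word_k p (word_cons a x) = (lamB_k p a)%:Z + word_k p x.
Proof. by rewrite /word_k /seqB_k big_cons. Qed.

Lemma lambdaO_basis_cons (a : lamB) (y : KS) : lambdaO_basis q.+1 (word_cons a y) =
  otens ((lamB_i a)%:Z, (lamB_j p a)%:Z, (lamB_k p a)%:Z, word_k p y)
    (Lambda_elt F p a) (lambdaO_basis q y).
Proof. by case: y. Qed.

Definition lambdaO_step_ncoord :
    ncoord (in_BO p q.+1) (lambdaO_basis q.+1) (B_struct p F) :=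
  oalg_coord (@Lambda_degP F p) (fun a a' _ _ => @Lambda_struct_degree a a')
    (@bicoord_degP _ _ _ phi) (@B_struct_degree p F q) in_BO_cons in_BO_word_cons
    (fun a b _ _ _ => lambdaO_basis_cons a b)
    (fun a b a' b' _ _ _ _ => B_struct_cons p F a b a' b').

Lemma lambdaO_step_degP j k y : bideg (b := lambdaO F p q.+1) j k y <->
  supported (bi_degree word_i (word_k p) j k) (lambdaO_step_ncoord y).
Proof. by apply: oalg_degP => // a b; apply: word_k_cons. Qed.

Definition lambdaO_step : bicoord (in_BO p q.+1) (lambdaO_basis q.+1) :=
  BiCoord lambdaO_step_degP.

End Step.

Fixpoint lambdaO_coord (q : nat) : bicoord (in_BO p q) (lambdaO_basis q) :=
  match q return bicoord (in_BO p q) (lambdaO_basis q) with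
  | 0 => @BiCoord (biFz F) _ _ Fz_ncoord Fz_degP
  | q'.+1 => lambdaO_step (lambdaO_coord q')
  end.

Lemma lambdaO_coord_otens q d x y : ohom (G := Lambda F p) (D := lambdaO F p q) (d, (x, y)) ->
  lambdaO_coord q.+1 (otens (G := Lambda F p) (D := lambdaO F p q) d x y) =
  malg_pair word_cons (Lambda_coord F p x) (lambdaO_coord q y).
Proof. exact: oalg_coord_otens. Qed.

End Tower.

(** * The operator of the field F and the embeddings of the tower *)

Section ScalarOperator.
Variables (F : fieldType) (p : nat).
Local Notation KS := (seq lamB * nat)%type.

Definition triF_coord_fun (c : triF F) : {malg F[unit]} := (c : F) *: << tt >>.

Lemma triF_coord_is_linear : linear triF_coord_fun.
Proof. by move=> a c d; rewrite /triF_coord_fun scalerDl scalerA. Qed.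

HB.instance Definition _ := GRing.isLinear.Build F (triF F) {malg F[unit]} _
  triF_coord_fun triF_coord_is_linear.

Definition unit_struct (_ _ : unit) : {malg F[unit]} := << tt >>.
Definition triF_basis (_ : unit) : triF F := (1 : F^o).

Lemma triF_coord_elt k : predT k -> triF_coord_fun (triF_basis k) = << k >>.
Proof. by case: k => _; apply: scale1r. Qed.

Lemma triF_coord_span (c : triF F) :
  lspan (fun v => exists2 k, predT k & v = triF_basis k) c.
Proof.
have -> : c = (c : F) *: (triF_basis tt) + 0 :> triF F.
  by rewrite addr0; apply/esym/(@mulr1 F).
by apply: lspanS (lspan0 _); exists tt.
Qed.

Lemma triF_coordM (c d : triF F) : triF_coord_fun (c * d)%A =
  bilift unit_struct (triF_coord_fun c) (triF_coord_fun d).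
Proof.
rewrite /triF_coord_fun biliftZl biliftZr biliftUU scalerA.
by [].
Qed.

Definition triF_coord : ncoord predT triF_basis unit_struct :=
  NCoord (ncf := triF_coord_fun) triF_coord_elt triF_coord_span triF_coordM.

Definition zero_degree (_ : unit) : int := 0.
Local Notation unit_degree := (tri_degree zero_degree zero_degree zero_degree).

Lemma triF_degP i j k c : trideg (t := triF F) i j k c <->
  supported (unit_degree i j k) (triF_coord c).
Proof.
split=> [[->|[-> -> ->]]|dc].
- by rewrite linear0; apply: supported0.
- by move=> [] _.
- have [->|c0] := eqVneq (c : F) 0; [by left | right].
  suff /dc[<- <- <-] : tt \in msupp (triF_coord c) by [].
  by rewrite -[triF_coord c]/((c : F) *: << tt >>) -mcoeff_neq0 mcoeffZ mcoeffUU mulr1.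
Qed.

Lemma unit_struct_degree (a b : unit) : supported
  (unit_degree (zero_degree a + zero_degree b) (zero_degree a + zero_degree b)
     (zero_degree a + zero_degree b)) (unit_struct a b).
Proof. by move=> [] _. Qed.

(** F lives in degree 0, so its operator keeps only words whose first height entry vanishes as well:
    the height is then 0. *)
Definition in_Bq (q : nat) (x : KS) : bool := in_BO p q x && (word_i x == 0).

Definition lambda_q_basis (q : nat) (x : KS) : lambda_ F p q :=
  otens (G := triF F) (D := lambdaO F p q) (0, 0, 0, word_k p x) (1 : F^o)
    (lambdaO_basis F p q x).

Lemma lambda_q_eltE s l : lambda_q_elt F p s l = lambda_q_basis (size s) (s, l).
Proof. by rewrite /lambda_q_elt lambdaO_eltE. Qed.

Definition skip_unit (_ : unit) (x : KS) : KS := x.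

Lemma in_BqP q (x : KS) : in_Bq q x -> exists a b,
  [/\ predT a, in_BO p q b, zero_degree a = word_i b & x = skip_unit a b].
Proof. by case/andP=> qx /eqP x0; exists tt, x. Qed.

Lemma in_Bq_intro q a (x : KS) : predT a -> in_BO p q x -> zero_degree a = word_i x ->
  in_Bq q (skip_unit a x).
Proof. by move=> _ qx x0; apply/andP; split=> //; rewrite -x0. Qed.

Lemma skip_unit_pair (y : {malg F[KS]}) : malg_pair skip_unit << tt >> y = y.
Proof. by rewrite /malg_pair biliftUr malg_lift_id. Qed.

Lemma B_struct_skip (a : unit) b a' b' :
  B_struct p F (skip_unit a b) (skip_unit a' b') =
  (-1) ^ (zero_degree a' * word_k p b) *:
    malg_pair skip_unit (unit_struct a a') (B_struct p F b b').
Proof. by rewrite mul0r expr0z scale1r skip_unit_pair. Qed.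

Definition lambda_q_coord q : ncoord (in_Bq q) (lambda_q_basis q) (B_struct p F) :=
  @oalg_coord _ _ _ _ _ _ skip_unit _ _ _ _ _ _ triF_coord (lambdaO_coord F p q) _ _ _ _ _
    triF_degP (fun a b _ _ => @unit_struct_degree a b)
    (@bicoord_degP _ _ _ _ _ (lambdaO_coord F p q)) (@B_struct_degree p F q)
    _ _ _ (@in_BqP q) (@in_Bq_intro q)
    (fun _ _ _ _ _ => erefl)
    (fun a b a' b' _ _ _ _ => B_struct_skip a b a' b').

Lemma lambda_q_coord_otens q d c y : ohom (G := triF F) (D := lambdaO F p q) (d, (c, y)) ->
  lambda_q_coord q (otens (G := triF F) (D := lambdaO F p q) d c y) =
  malg_pair skip_unit (triF_coord c) (lambdaO_coord F p q y).
Proof. exact: oalg_coord_otens. Qed.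

Definition cons_hat1 : {malg F[KS]} -> {malg F[KS]} :=
  malg_lift (fun x => << word_cons lamB_hat1 x >>).
HB.instance Definition _ := GRing.Linear.on cons_hat1.

Lemma lambda_q_coord_repr q (u : lambda_ F p q) : lambda_q_coord q u =
  malg_lift (fun g : osymb (triF F) (lambdaO F p q) =>
    malg_pair skip_unit (triF_coord (val g).2.1) (lambdaO_coord F p q (val g).2.2)) (repr u).
Proof. by []. Qed.

Hypothesis p_gt0 : (0 < p)%N.

Lemma BLambda_hat1 : in_BLambda p lamB_hat1.
Proof. by rewrite /=; lia. Qed.

Lemma Lambda_coord_e1 : Lambda_coord F p (Lambda_e1 F p) = << lamB_hat1 >>.
Proof. exact: (ncoord_elt (Lambda_coord F p) BLambda_hat1). Qed.

(** The embedding is evaluated on a representative, but its coordinates see only the prefix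
    [lamB_hat1], which [malg_strip] removes in the limit. *)
Lemma lambda_emb_coord q (u : lambda_ F p q) :
  lambda_q_coord q.+1 (lambda_emb u) = cons_hat1 (lambda_q_coord q u).
Proof.
rewrite [lambda_q_coord q u]lambda_q_coord_repr [RHS]linear_malg_lift.
rewrite /lambda_emb [LHS]linear_malg_lift.
apply: eq_malg_lift => -[[[[[i j] k1] k2] [c y]] h].
have hom : ohom (G := triF F) (D := lambdaO F p q) (i, j, k1, k2, (c, y)) := asboolW h.
have [dc dy] := hom.
have inner : ohom (G := Lambda F p) (D := lambdaO F p q)
    (i, j, k1, k2, ((c : F) *: Lambda_e1 F p, y)).
  split=> //; apply/Lambda_degP; rewrite linearZ /= Lambda_coord_e1.
  (* The scalar 0 is homogeneous of every degree; for the other alternative the degrees are all 0,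
     as are those of [lamB_hat1]. *)
  case: dc => [->|[-> -> ->]]; first by rewrite scale0r; apply: supported0.
  apply: supportedZ; apply: (supportedU (P := has_Lambda_degree _ _ _ _)).
  by split=> //=; rewrite muln0.
have inner_coord : lambdaO_coord F p q.+1
    (otens (G := Lambda F p) (D := lambdaO F p q) (i, j, k1, k2) ((c : F) *: Lambda_e1 F p) y)
    = (c : F) *: cons_hat1 (lambdaO_coord F p q y).
  rewrite lambdaO_coord_otens // linearZ /= Lambda_coord_e1 /malg_pair biliftZl.
  by rewrite biliftUr.
have outer : ohom (G := triF F) (D := lambdaO F p q.+1) (0, 0, 0, k1 + k2, (1 : F^o,
    otens (G := Lambda F p) (D := lambdaO F p q) (i, j, k1, k2) ((c : F) *: Lambda_e1 F p) y)).
  split; first by right.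
  apply/(bicoord_degP (lambdaO_coord F p q.+1)); rewrite inner_coord.
  case: dc => [->|[_ _ ->]]; first by rewrite scale0r; apply: supported0.
  apply: supportedZ; apply: supported_lift => x xy.
  apply: (supportedU (P := bi_degree _ _ _ _)).
  have [_ <-] := iffLR (bicoord_degP (lambdaO_coord F p q) _ _ _) dy x xy.
  by split; [| rewrite word_k_cons /= muln0].
rewrite [LHS]lambda_q_coord_otens // inner_coord.
have triFE (a : F) : malg_pair skip_unit (triF_coord (a : triF F)) =1
    (fun z => a *: z) by move=> z; rewrite /malg_pair biliftZl [bilift _ _ _]skip_unit_pair.
by rewrite triFE scale1r [in RHS]triFE linearZ.
Qed.

End ScalarOperator.

(** * The direct limit *)

Section NormalForms.
Variables (F : fieldType) (p : nat).
Hypothesis p_gt0 : (0 < p)%N.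
Local Notation KS := (seq lamB * nat)%type.
Implicit Types (s t : seq lamB) (x y : KS).

Fixpoint strip s : seq lamB :=
  if s is a :: s' then if a == lamB_hat1 then strip s' else s else [::].

Lemma strip_hat1 n s : strip (nseq n lamB_hat1 ++ s) = strip s.
Proof. by elim: n => //= n ->; rewrite eqxx. Qed.

Lemma strip_pad N s : strip (pad N s) = strip s.
Proof. exact: strip_hat1. Qed.

Lemma strip_id s : strip (strip s) = strip s.
Proof. by elim: s => //= a s IH; case: ifP => //= ->. Qed.

Lemma size_strip s : (size (strip s) <= size s)%N.
Proof. by elim: s => //= a s IH; case: ifP => // _; apply: leq_trans IH _. Qed.

Lemma pad_catE n N s : (size s <= N)%N -> pad (n + N) s = nseq n lamB_hat1 ++ pad N s.
Proof. by move=> sN; rewrite /pad catA -nseqD addnBA. Qed.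

Lemma pad_hat1 N s : (size s < N)%N -> pad N (lamB_hat1 :: s) = pad N s.
Proof.
move=> sN; rewrite /pad -cat1s catA -[[:: lamB_hat1]]/(nseq 1 lamB_hat1) -nseqD.
by rewrite addn1 subnSK.
Qed.

Lemma pad_strip N s : (size s <= N)%N -> pad N (strip s) = pad N s.
Proof.
elim: s => //= a s IH sN; case: eqP => [->|//].
by rewrite pad_hat1 // IH // ltnW.
Qed.

(** Height 0 for a word of arbitrary length; invariant under removal of leading [lamB_hat1]. *)
Definition admissible x : bool :=
  [&& all (in_BLambda p) x.1, matched p x.1 x.2 & word_i x == 0].

Lemma admissible_hat1 s l : admissible (lamB_hat1 :: s, l) = admissible (s, l).
Proof.
have allE : all (in_BLambda p) (lamB_hat1 :: s) = all (in_BLambda p) s.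
  by rewrite -[LHS]/(in_BLambda p lamB_hat1 && _) BLambda_hat1.
rewrite /admissible [X in X && _]allE; congr (_ && _).
by rewrite /= muln0 [word_i (_ :: _, _) == 0]eqxx andbT andbC eq_sym.
Qed.

Lemma admissible_strip s l : admissible (strip s, l) = admissible (s, l).
Proof. by elim: s => //= a s IH; case: eqP => // ->; rewrite IH admissible_hat1. Qed.

Lemma in_BqE q x : in_Bq p q x = (size x.1 == q) && admissible x.
Proof. by rewrite /in_Bq /in_BO /admissible -!andbA. Qed.

Definition strip_word x : KS := (strip x.1, x.2).
Definition pad_word N x : KS := (pad N x.1, x.2).

Definition malg_strip : {malg F[KS]} -> {malg F[KS]} :=
  malg_lift (fun x => << strip_word x >>).
HB.instance Definition _ := GRing.Linear.on malg_strip.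

Lemma malg_stripU x : malg_strip << x >> = << strip_word x >>.
Proof. exact: malg_liftU. Qed.

Lemma strip_cons_hat1 z : malg_strip (cons_hat1 z) = malg_strip z.
Proof.
rewrite [LHS]linear_malg_lift; apply: eq_malg_lift => x.
exact: malg_stripU.
Qed.

Lemma lamB_hat1M : lamB_mul p lamB_hat1 lamB_hat1 = Some lamB_hat1.
Proof. by have := BLambda_hat1 p_gt0; rewrite /lamB_mul /= => ->. Qed.

Lemma B_struct_hat1 x y :
  B_struct p F (word_cons lamB_hat1 x) (word_cons lamB_hat1 y) =
  cons_hat1 (B_struct p F x y).
Proof.
rewrite B_struct_cons /= muln0 mul0r expr0z scale1r /Lambda_struct lamB_hat1M.
exact: biliftUr.
Qed.

Lemma strip_B_struct_nseq n s l t l' :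
  malg_strip (B_struct p F (nseq n lamB_hat1 ++ s, l) (nseq n lamB_hat1 ++ t, l')) =
  malg_strip (B_struct p F (s, l) (t, l')).
Proof.
elim: n => [|n IH]; first by [].
have E : B_struct p F (nseq n.+1 lamB_hat1 ++ s, l) (nseq n.+1 lamB_hat1 ++ t, l') =
    cons_hat1 (B_struct p F (nseq n lamB_hat1 ++ s, l) (nseq n lamB_hat1 ++ t, l')).
  exact: (B_struct_hat1 (nseq n lamB_hat1 ++ s, l) (nseq n lamB_hat1 ++ t, l')).
transitivity (malg_strip (cons_hat1 (B_struct p F (nseq n lamB_hat1 ++ s, l)
    (nseq n lamB_hat1 ++ t, l')))); first exact: congr1 E.
by rewrite strip_cons_hat1; exact: IH.
Qed.

Definition lambda_struct x y : {malg F[KS]} :=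
  let N := maxn (size x.1) (size y.1) in
  malg_strip (B_struct p F (pad_word N x) (pad_word N y)).

(** Longer padding changes nothing: [lamB_hat1] is idempotent and of k-degree 0, so extra prefixes
    affect neither the product nor the sign, and stripping removes them. *)
Lemma lambda_structE N x y : (size x.1 <= N)%N -> (size y.1 <= N)%N ->
  lambda_struct x y = malg_strip (B_struct p F (pad_word N x) (pad_word N y)).
Proof.
move=> xN yN; rewrite /lambda_struct; set M := maxn _ _.
have MN : (M <= N)%N by rewrite geq_max xN.
have padE u : (size u <= M)%N -> pad N u = nseq (N - M) lamB_hat1 ++ pad M u.
  by move=> uM; rewrite -pad_catE // subnK.
rewrite /pad_word (padE x.1 (leq_maxl _ _)) (padE y.1 (leq_maxr _ _)).
exact/esym/strip_B_struct_nseq.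
Qed.

Lemma lambda_struct_strip N x y : (size x.1 <= N)%N -> (size y.1 <= N)%N ->
  lambda_struct (strip_word x) (strip_word y) =
  malg_strip (B_struct p F (pad_word N x) (pad_word N y)).
Proof.
move=> xN yN.
have xE : pad_word N (strip_word x) = pad_word N x by rewrite /pad_word pad_strip.
have yE : pad_word N (strip_word y) = pad_word N y by rewrite /pad_word pad_strip.
have sxN := leq_trans (size_strip x.1) xN; have syN := leq_trans (size_strip y.1) yN.
rewrite (@lambda_structE N (strip_word x) (strip_word y) sxN syN).
exact: (congr2 (fun a b => malg_strip (B_struct p F a b)) xE yE).
Qed.

End NormalForms.

Section Colimit.
Variables (F : fieldType) (p : nat).
Hypothesis p_gt0 : (0 < p)%N.
Local Notation KS := (seq lamB * nat)%type.
Local Notation emb := (@lambda_emb F p).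
Local Notation symb := (colim_symb (lambda_ F p)).
Local Notation rel := (colim_rel emb).
Local Notation phi := (lambda_q_coord F p).

Definition colim_symb_coord : {malg F[symb]} -> {malg F[KS]} :=
  malg_lift (fun g : symb => malg_strip (phi (tag g) (tagged g))).
HB.instance Definition _ := GRing.Linear.on colim_symb_coord.

Lemma colim_symb_coordU q (x : lambda_ F p q) :
  colim_symb_coord (csymb x) = malg_strip (phi q x).
Proof. exact: malg_liftU. Qed.

Lemma colim_rel_coord v : rel v -> colim_symb_coord v = 0.
Proof.
case=> [q c x y|q x].
  apply: (linear_rel0 (f := colim_symb_coord)) (colim_symb_coordU _)
    (colim_symb_coordU _) (colim_symb_coordU _) _.
  rewrite (linearP (phi q) c x y); exact: malg_lift_is_linear.
apply: (linear_sub0 (f := colim_symb_coord)) (colim_symb_coordU _) _.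
rewrite [LHS]colim_symb_coordU (lambda_emb_coord p_gt0).
exact/esym/strip_cons_hat1.
Qed.

Definition lambda_coord_fun : lambda F p -> {malg F[KS]} := qlift colim_rel_coord.
HB.instance Definition _ := GRing.Linear.on lambda_coord_fun.

Lemma lambda_coord_in q (x : lambda_ F p q) :
  lambda_coord_fun (colim_in emb x) = malg_strip (phi q x).
Proof. by rewrite -colim_symb_coordU; apply: qliftE. Qed.

Lemma colim_in_is_linear q : linear (fun x : lambda_ F p q => colim_in emb x : lambda F p).
Proof. by move=> c x y; apply: lproj_rel_linear; apply: colim_lin. Qed.

Definition colim_inl q (x : lambda_ F p q) : lambda F p := colim_in emb x.
HB.instance Definition _ q := GRing.isLinear.Build F (lambda_ F p q) (lambda F p) _
  (@colim_inl q) (@colim_in_is_linear q).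

Definition in_Bl (x : KS) : bool := (strip x.1 == x.1) && admissible p x.
Definition lambda_basis (x : KS) : lambda F p := colim_in emb (lambda_q_elt F p x.1 x.2).

Lemma lambda_q_coord_elt x : admissible p x ->
  phi (size x.1) (lambda_q_elt F p x.1 x.2) = << x >>.
Proof.
case: x => s l adm; rewrite lambda_q_eltE ncoord_elt //.
by rewrite in_BqE /= eqxx.
Qed.

Lemma lambda_basis_coord x : admissible p x ->
  lambda_coord_fun (lambda_basis x) = << strip_word x >>.
Proof.
by move=> adm; rewrite lambda_coord_in lambda_q_coord_elt // malg_stripU.
Qed.

Lemma lambda_basis_strip s l : admissible p (s, l) ->
  lambda_basis (s, l) = lambda_basis (strip s, l).
Proof.
elim: s => [|a s IH] adm; first by [].
have [a1|na] := eqVneq a lamB_hat1; last first.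
  by have -> : strip (a :: s) = a :: s by rewrite /= (negPf na).
rewrite {}a1 in adm *.
have -> : strip (lamB_hat1 :: s) = strip s by [].
have adm' : admissible p (s, l) by rewrite -(admissible_hat1 p_gt0).
have emb_s : lambda_q_elt F p (lamB_hat1 :: s) l = lambda_emb (lambda_q_elt F p s l).
  apply: (@ncoord_inj _ _ _ _ _ _ (phi (size s).+1)).
  rewrite (lambda_emb_coord p_gt0) (lambda_q_coord_elt adm').
  rewrite [LHS](lambda_q_coord_elt adm); exact/esym/malg_liftU.
rewrite -(IH adm') /lambda_basis -[LHS]/(colim_in emb (lambda_q_elt F p (lamB_hat1 :: s) l)).
rewrite emb_s; apply/lproj_eqP/lspan_gen; exact: colim_step.
Qed.

Lemma lambda_coord_elt x : in_Bl x -> lambda_coord_fun (lambda_basis x) = << x >>.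
Proof.
by case: x => s l /andP[/eqP /= sE adm]; rewrite lambda_basis_coord // /strip_word /= sE.
Qed.

Lemma lambda_coord_span (u : lambda F p) :
  lspan (fun v => exists2 x, in_Bl x & v = lambda_basis x) u.
Proof.
rewrite -[u]lreprK -[repr u]malg_lift_id linear_malg_lift.
apply: lspan_sum => -[q x] _; rewrite -[X in lspan _ X]/(colim_inl x).
rewrite -[x](ncoordK (phi q)) linear_malg_lift.
apply: lspan_sum => -[s l] /ncoord_supported; rewrite in_BqE => /andP[/eqP /= sq adm].
apply: lspan_gen; exists (strip s, l).
  by apply/andP; split; [apply/eqP/strip_id | rewrite (admissible_strip p_gt0)].
rewrite -(lambda_basis_strip adm) -[RHS]/(colim_in emb (lambda_q_elt F p s l)).
(* The element lives in level [q], which equals the length of [s] only propositionally; eliminating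
   the equation aligns the types. *)
by rewrite lambda_q_eltE; case: _ / sq.
Qed.

Definition malg_prepend n : {malg F[KS]} -> {malg F[KS]} :=
  malg_lift (fun x => << ((nseq n lamB_hat1 ++ x.1, x.2) : KS) >>).

Lemma colim_up_coord n q (x : lambda_ F p q) :
  phi (n + q) (colim_up emb n x) = malg_prepend n (phi q x).
Proof.
elim: n => [|n IH].
  by rewrite -[LHS](malg_lift_id (phi q x)); apply: eq_malg_lift => -[].
rewrite [LHS](lambda_emb_coord p_gt0) IH [LHS]linear_malg_lift.
by apply: eq_malg_lift => y; apply: malg_liftU.
Qed.

Lemma ecast_coord n n' (e : n = n') (x : lambda_ F p n) :
  phi n' (ecast n (lambda_ F p n) e x) = phi n x.
Proof. by case: n' / e. Qed.

Lemma colim_symb_mul_coord (g h : symb) :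
  lambda_coord_fun (colim_symb_mul emb g h) =
  bilift (lambda_struct F p) (malg_strip (phi (tag g) (tagged g)))
    (malg_strip (phi (tag h) (tagged h))).
Proof.
case: g h => [q x] [r y]; rewrite [LHS]lambda_coord_in ncoordM ecast_coord.
rewrite !colim_up_coord [in LHS]bilift_lift [RHS]bilift_lift [LHS]linear_bilift.
apply: eq_bilift_in => k l /ncoord_supported qk /ncoord_supported rl.
move: qk rl; rewrite !in_BqE => /andP[/eqP qk _] /andP[/eqP rl _].
(* The direct limit raises [x] by [r] levels and [y] by [q] levels; both prefixes are paddings to
   the common length [q + r]. *)
have kE : (nseq r lamB_hat1 ++ k.1, k.2) = pad_word (q + r) k.
  by rewrite /pad_word /pad qk addnC addnK.
have lE : (nseq q lamB_hat1 ++ l.1, l.2) = pad_word (q + r) l.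
  by rewrite /pad_word /pad rl addnK.
have kN : (size k.1 <= q + r)%N by rewrite qk leq_addr.
have lN : (size l.1 <= q + r)%N by rewrite rl leq_addl.
rewrite kE lE [RHS]biliftUU (lambda_struct_strip F p_gt0 kN lN).
exact: congr1 (biliftUU _ _ _).
Qed.

Lemma lambda_coordM (u v : lambda F p) : lambda_coord_fun (u * v)%A =
  bilift (lambda_struct F p) (lambda_coord_fun u) (lambda_coord_fun v).
Proof.
rewrite [LHS](linear_bilift lambda_coord_fun) [RHS]bilift_lift; apply: eq_bilift => g h.
exact: colim_symb_mul_coord.
Qed.

Definition lambda_coord : ncoord in_Bl lambda_basis (lambda_struct F p) :=
  NCoord (ncf := lambda_coord_fun) lambda_coord_elt lambda_coord_span lambda_coordM.

End Colimit.

(** * Monomial bases *)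

Section MonomialBasisCriterion.
Variables (F : fieldType) (A : nalg F) (K : choiceType) (P : pred K) (e : K -> A).
Variables (m : K -> K -> {malg F[K]}) (phi : ncoord P e m).
(** [E0] marks the symbols of idempotents, [lf k] and [rt k] are those fixing [k] from the left and
    from the right, and [deg] is a length that is additive on products. *)
Variables (E0 : pred K) (lf rt : K -> K) (deg : K -> nat).
Hypothesis m_mono : forall k l, exists (eps : bool) o, m k l = (-1) ^+ eps *: malg_opt F o.
Hypothesis E0P : forall t, E0 t = P t && (deg t == 0%N).
Hypothesis lfP : forall k, P k -> E0 (lf k).
Hypothesis rtP : forall k, P k -> E0 (rt k).
Hypothesis lf_id : forall t, E0 t -> lf t = t.
Hypothesis m_lf : forall t k, E0 t -> P k -> m t k = if t == lf k then << k >> else 0.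
Hypothesis m_rt : forall t k, E0 t -> P k -> m k t = if t == rt k then << k >> else 0.
Hypothesis m_deg : forall k l, P k -> P l ->
  supported (fun j => deg j = (deg k + deg l)%N) (m k l).

Definition chi (t : K) (x : {malg F[K]}) : F^o := x@_t.

Lemma chi_is_linear t : linear (chi t).
Proof. by move=> c x y; rewrite /chi mcoeffD mcoeffZ. Qed.

HB.instance Definition _ t :=
  GRing.isLinear.Build F {malg F[K]} F^o _ (chi t) (chi_is_linear t).

Lemma chiU t k : chi t << k >> = (k == t)%:R.
Proof. exact: mcoeffU. Qed.

Lemma bilift_mul (a b : K -> F) x y :
  bilift (fun k l => a k * b l : F^o) x y =
  (malg_lift (a : K -> F^o) x : F) * (malg_lift (b : K -> F^o) y : F).
Proof.
rewrite [RHS]mulr_suml; apply: eq_bigr => k _.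
rewrite [LHS]scaler_sumr mulr_sumr; apply: eq_bigr => l _.
by rewrite -[LHS]/(_ * (_ * (_ * _))) -[RHS]/(_ * _ * (_ * _)) mulrACA mulrA mulrA.
Qed.

Lemma E0_P t : E0 t -> P t.
Proof. by rewrite E0P => /andP[]. Qed.

(** A product has a component of degree 0 only if both factors have degree 0, and the symbols of
    degree 0 multiply as orthogonal idempotents. *)
Lemma chi_struct t k l : E0 t -> P k -> P l ->
  chi t (m k l) = (k == t)%:R * (l == t)%:R.
Proof.
move=> Et Pk Pl; have [Ek|nEk] := boolP (E0 k).
  rewrite m_lf //; have [->|lt] := eqVneq l t; last first.
    by rewrite mulr0; case: ifP => _; rewrite ?linear0 // chiU (negPf lt).
  by rewrite lf_id // mulr1; case: ifP => _; rewrite ?linear0 // chiU eqxx.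
(* Now [k] has positive degree, hence so has every symbol of the product, whereas [t] has degree
   0. *)
rewrite /chi mcoeff_outdom; last first.
  apply/negP => /(m_deg Pk Pl) dt; move: nEk Et.
  rewrite !E0P Pk dt addn_eq0 => nk /andP[_ /andP[dk _]].
  by rewrite dk in nk.
by have [kt|] := eqVneq k t; [rewrite kt Et in nEk | rewrite mul0r].
Qed.

Lemma chiM t (x y : A) : E0 t ->
  chi t (phi (x * y)%A) = chi t (phi x) * chi t (phi y) :> F.
Proof.
move=> Et; rewrite ncoordM linear_bilift.
have chiE z : chi t z = malg_lift (fun k => (k == t)%:R : F^o) z.
  by rewrite linear_malgE; apply: eq_malg_lift => k; apply: chiU.
rewrite [in RHS]chiE [X in _ * X]chiE -bilift_mul.
apply: (@eq_bilift_in _ _ _ (F^o)) => k l kx ly; apply: chi_struct => //.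
  exact: ncoord_supported kx.
exact: ncoord_supported ly.
Qed.

Lemma idempotent_eq0 (h : A) : Defs.idempotent h ->
  (forall t, E0 t -> chi t (phi h) = 0) -> h = 0.
Proof.
move=> hh chi0; have deg_gt0 k : k \in msupp (phi h) -> (0 < deg k)%N.
  move=> hk; rewrite lt0n; apply/negP => dk0.
  have Ek : E0 k by rewrite E0P dk0 (ncoord_supported hk).
  by move: hk; rewrite -mcoeff_neq0 -[_@__]/(chi k _) chi0 // eqxx.
(* Each use of [h = h * h] raises the lower bound by one, as all symbols of [h] have positive
   degree; a finite support must then be empty. *)
have deg_ge n : supported (fun k => (n <= deg k)%N) (phi h).
  elim: n => [|n IH]; first by [].
  rewrite -hh ncoordM; apply: supported_bilift => k l hk hl.
  apply: supported_sub (m_deg (ncoord_supported hk) (ncoord_supported hl)) => j ->.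
  by rewrite -addn1 leq_add ?deg_gt0 // IH.
apply: (@ncoord_inj _ _ _ _ _ _ phi); rewrite linear0.
apply: (@supported_eq0 _ _ (fun _ => False)) => [k []|k hk].
by have := deg_ge (deg k).+1 k hk; rewrite ltnn.
Qed.

Lemma E0_mul t s : E0 t -> E0 s -> (e t * e s)%A = if t == s then e t else 0.
Proof.
move=> Et Es; rewrite (ncoord_mul phi) ?E0_P // m_lf ?E0_P // lf_id //.
by case: eqP => [->|_]; rewrite ?malg_liftU ?linear0.
Qed.

Lemma E0_primitive t : E0 t -> primitive_idempotent (e t).
Proof.
move=> Et; have phit : phi (e t) = << t >> by rewrite ncoord_elt ?E0_P.
split; last 1 first.
- move=> f g ff gg [fg gf] tfg.
  (* An element fixed by [e t] from the left has coefficient 0 at every other idempotent; this will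
     be applied to both summands. *)
  have chi_t (h : A) : (e t * h)%A = h -> forall s, E0 s -> s != t -> chi s (phi h) = 0.
    move=> th s Es st; rewrite -th chiM // phit chiU eq_sym (negPf st).
    exact: mul0r.
  have A_bilin := ncoord_bilinear phi.
  have tf : (e t * f)%A = f by rewrite tfg nmulDl // gf addr0.
  have tg : (e t * g)%A = g by rewrite tfg nmulDl // fg add0r.
  (* The coefficient at [t] is multiplicative and [f * g = 0], so it vanishes on one summand; that
     summand then has no coefficient in degree 0 at all. *)
  have : chi t (phi f) * chi t (phi g) = 0 :> F.
    by rewrite -chiM // fg linear0; apply: linear0.
  move=> /eqP; rewrite mulf_eq0 => /orP[]/eqP chi0; [left|right].
    apply: idempotent_eq0 => // s Es; have [->//|st] := eqVneq s t.
    exact: chi_t tf s Es st.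
  apply: idempotent_eq0 => // s Es; have [->//|st] := eqVneq s t.
  exact: chi_t tg s Es st.
- move=> et0; have : chi t (phi (e t)) = 0 by rewrite et0 linear0; apply: linear0.
  by rewrite phit chiU eqxx => /eqP; rewrite oner_eq0.
- by rewrite /Defs.idempotent E0_mul // eqxx.
Qed.

Lemma ncoord_elt_inj : {in P &, injective e}.
Proof.
move=> k l Pk Pl ekl; have := congr1 (fun x => chi l (phi x)) ekl.
rewrite !ncoord_elt // !chiU eqxx; case: eqP => // _ /esym/eqP.
by rewrite oner_eq0.
Qed.

Lemma idempotent_sum_unitl (ks : seq K) k : uniq ks -> (forall t, t \in ks -> E0 t) ->
  P k -> lf k \in ks -> \sum_(t <- ks) m t k = << k >>.
Proof.
move=> ks_uniq ksE Pk kks; rewrite (bigD1_seq (lf k)) //= m_lf ?ksE // eqxx.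
rewrite big_seq_cond big1 ?addr0 // => t /andP[/ksE Et /negPf tk].
by rewrite m_lf // tk.
Qed.

Lemma idempotent_sum_unitr (ks : seq K) k : uniq ks -> (forall t, t \in ks -> E0 t) ->
  P k -> rt k \in ks -> \sum_(t <- ks) m k t = << k >>.
Proof.
move=> ks_uniq ksE Pk kks; rewrite (bigD1_seq (rt k)) //= m_rt ?ksE // eqxx.
rewrite big_seq_cond big1 ?addr0 // => t /andP[/ksE Et /negPf tk].
by rewrite m_rt // tk.
Qed.

Lemma E0_complete :
  complete_primitive_idempotents (fun u : A => exists2 t, E0 t & u = e t).
Proof.
split.
- by move=> _ [t Et ->]; apply: E0_primitive.
- move=> _ _ [t Et ->] [s Es ->] ts; split; rewrite E0_mul // ifN //.
    by apply: contra_notN ts => /eqP->.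
  by apply: contra_notN ts => /eqP->.
(* A local unit for [a]: the left and right idempotents of the finitely many symbols in its support,
   each taken once. *)
move=> a; pose ks := undup (map lf (msupp (phi a)) ++ map rt (msupp (phi a))).
have ks_uniq : uniq ks by apply: undup_uniq.
have ksE t : t \in ks -> E0 t.
  rewrite mem_undup mem_cat => /orP[]/mapP[k /ncoord_supported Pk ->].
    exact: lfP.
  exact: rtP.
have phi_sum : phi (\sum_(u <- map e ks) u) = \sum_(t <- ks) << t >>.
  rewrite big_map linear_sum; apply: eq_big_seq => t /ksE/E0_P Pt.
  exact: ncoord_elt.
exists (map e ks); split.
- rewrite map_inj_in_uniq // => t s /ksE/E0_P Pt /ksE/E0_P Ps.
  exact: ncoord_elt_inj.
- by move=> _ /mapP[t /ksE Et ->]; exists t.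
- apply: (@ncoord_inj _ _ _ _ _ _ phi); rewrite ncoordM phi_sum bilift_swap -[RHS]malg_lift_id.
  apply: eq_malg_lift_in => k ak; rewrite linear_sum.
  rewrite -[RHS](@idempotent_sum_unitl ks) ?(ncoord_supported ak) //.
    by apply: eq_bigr => t _; apply: malg_liftU.
  by rewrite mem_undup mem_cat map_f.
- apply: (@ncoord_inj _ _ _ _ _ _ phi); rewrite ncoordM phi_sum -[RHS]malg_lift_id.
  apply: eq_malg_lift_in => k ak; rewrite linear_sum.
  rewrite -[RHS](@idempotent_sum_unitr ks) ?(ncoord_supported ak) //.
    by apply: eq_bigr => t _; apply: malg_liftU.
  by rewrite mem_undup mem_cat orbC map_f.
Qed.

Lemma ncoord_is_basis : is_basis (fun u : A => exists2 k, P k & u = e k).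
Proof.
split=> [s c s_uniq sP sum0 x xs|a]; last exact: (ncoord_span phi).
have [k Pk xk] := sP x xs.
have := congr1 (fun z => chi k (phi z)) sum0; rewrite linear_sum linear_sum.
rewrite (bigD1_seq x) //= big_seq_cond big1 ?addr0; last first.
  move=> y /andP[/sP[l Pl yl] yx]; rewrite !linearZ /= yl ncoord_elt // chiU.
  case: eqP => [lk|_]; first by rewrite yl lk -xk eqxx in yx.
  exact: mulr0.
rewrite !linearZ /= xk ncoord_elt // chiU eqxx.
by rewrite -[_ *: _]/(_ * _) mulr1 !linear0.
Qed.

Lemma monomial_basis_ncoord (S : A -> Prop) :
  (forall u, S u <-> exists2 k, P k & u = e k) -> monomial_basis S.
Proof.
move=> SE; split.
- have [ind gen] := ncoord_is_basis; split=> [s c s_uniq sS|a].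
    by apply: ind => // x /sS/SE.
  by have := gen a; apply: lspan_sub => u /SE; apply: lspan_gen.
- exists (fun u : A => exists2 t, E0 t & u = e t); first exact: E0_complete.
  by move=> _ [t Et ->]; apply/SE; exists t => //; apply: E0_P.
move=> x y /SE[k Pk ->] /SE[l Pl ->].
have kl := ncoord_mul phi Pk Pl; have [eps [o mkl]] := m_mono k l.
case: o mkl => [j|] mkl; last by left; rewrite kl mkl [malg_opt _ _]/malg_opt scaler0 linear0.
have {}mkl : m k l = (-1) ^+ eps *: << j >> := mkl.
right; have jkl : (e k * e l)%A = (-1) ^+ eps *: e j.
  by rewrite kl mkl linearZ; apply: congr1; apply: malg_liftU.
(* [m] is a total function; that [j] names a basis element is read off the support of the actual
   product, where its coefficient is a sign. *)
have Pj : P j.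
  apply: (@ncoord_supported _ _ _ _ _ _ phi (e k * e l)%A).
  rewrite ncoordM !ncoord_elt // biliftUU mkl -mcoeff_neq0 mcoeffZ mcoeffUU mulr1.
  by rewrite signr_eq0.
exists (e j); first by apply/SE; exists j.
by rewrite jkl; case: eps {mkl jkl}; [right; rewrite expr1 scaleN1r | left; rewrite expr0 scale1r].
Qed.

End MonomialBasisCriterion.

(** * Idempotents and length on the symbols of lambda *)

Section LambdaIdempotents.
Variables (F : fieldType) (p : nat).
Hypothesis p_gt1 : (1 < p)%N.
Let p_gt0 : (0 < p)%N := ltnW p_gt1.
Local Notation KS := (seq lamB * nat)%type.
Implicit Types (s t u : seq lamB) (a : lamB) (x y : KS).

Definition lam_e (i : int) : lamB := (piB_e i, 0%N, 0%N).
Definition lam_start a : int := a.1.1.1.1.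
Definition lam_end a : int := tB_end p a.1.
Definition seq_deg s : nat := \sum_(a <- s) lamB_k p a.
(** The left unit is formed letter by letter. A letter starting at the vertex 1 contributes
    [lamB_hat1], so the result has to be stripped to be in normal form. *)
Definition word_start x : KS := (strip [seq lam_e (lam_start a) | a <- x.1], 0%N).
Definition word_end x : KS := (strip [seq lam_e (lam_end a) | a <- x.1], 0%N).
Definition is_lam_e a : bool := a == lam_e (lam_start a).

Lemma lam_e_BLambda (i : int) : 1 <= i <= p%:Z -> in_BLambda p (lam_e i).
Proof. by rewrite in_BLambdaE /in_BT /=; lia. Qed.

Lemma lamB_e_mul (i : int) a : in_BLambda p a ->
  lamB_mul p (lam_e i) a = if i == lam_start a then Some a else None.
Proof.
case: a => x h; rewrite in_BLambdaE => Tx; rewrite /lam_e lamB_mulE tB_e_mul //.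
by rewrite /lam_start /=; case: ifP.
Qed.

Lemma lamB_mul_e a (i : int) : in_BLambda p a ->
  lamB_mul p a (lam_e i) = if i == lam_end a then Some a else None.
Proof.
case: a => [[b n] h]; rewrite in_BLambdaE => Tx; rewrite /lam_e lamB_mulE tB_mul_e //.
by rewrite /lam_end /= !addn0 Tx andbT; case: ifP => //= _; rewrite addn0.
Qed.

Lemma seqB_e_mul u s : size u = size s -> all is_lam_e u -> all (in_BLambda p) s ->
  seqB_mul p u s = if u == [seq lam_e (lam_start a) | a <- s] then Some s else None.
Proof.
elim: u s => [|c u IH] [|a s] //= [us] /andP[/eqP ec eu] /andP[Ba Bs].
rewrite ec lamB_e_mul // eqseq_cons IH //.
have -> : (lam_e (lam_start c) == lam_e (lam_start a)) = (lam_start c == lam_start a).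
  by apply/eqP/eqP => [[]|->].
by case: ifP => //= _; case: ifP.
Qed.

Lemma seqB_mul_e s u : size u = size s -> all is_lam_e u -> all (in_BLambda p) s ->
  seqB_mul p s u = if u == [seq lam_e (lam_end a) | a <- s] then Some s else None.
Proof.
elim: u s => [|c u IH] [|a s] //= [us] /andP[/eqP ec eu] /andP[Ba Bs].
rewrite ec lamB_mul_e // eqseq_cons IH //.
have -> : (lam_e (lam_start c) == lam_e (lam_end a)) = (lam_start c == lam_end a).
  by apply/eqP/eqP => [[]|->].
by case: ifP => //= _; case: ifP.
Qed.

Lemma lam_e_k a : is_lam_e a -> lamB_k p a = 0%N.
Proof. by move/eqP->; rewrite /= muln0. Qed.

Lemma lam_e_j a : is_lam_e a -> lamB_j p a = 0%N.
Proof. by move/eqP->; rewrite /= muln0. Qed.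

Lemma nth_lam_e_k s i : all is_lam_e s -> lamB_k p (nth lamB_hat1 s i) = 0%N.
Proof.
move=> es; apply: lam_e_k; have [i_lt|i_ge] := ltnP i (size s).
  exact: (all_nthP _ es).
by rewrite nth_default.
Qed.

Lemma seqB_sign_el u s : all is_lam_e u -> seqB_sign p u s = false.
Proof.
move=> eu; rewrite /seqB_sign big1 // => i _; rewrite big1 // => j _.
by rewrite nth_lam_e_k.
Qed.

Lemma seqB_sign_er s u : all is_lam_e u -> seqB_sign p s u = false.
Proof.
move=> eu; rewrite /seqB_sign big1 // => i _; rewrite big1 // => j _.
by rewrite [X in (_ * X)%N]nth_lam_e_k ?muln0.
Qed.

Lemma all_pad (Q : pred lamB) N s : Q lamB_hat1 -> all Q s -> all Q (pad N s).
Proof. by move=> Q1 Qs; rewrite /pad all_cat all_nseq Q1 orbT. Qed.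

Lemma map_pad (f : lamB -> lamB) N s : f lamB_hat1 = lamB_hat1 ->
  map f (pad N s) = pad N (map f s).
Proof. by move=> f1; rewrite /pad map_cat map_nseq f1 size_map. Qed.

(** Relates the equality of B, tested after padding, to equality of normal forms. *)
Lemma pad_eq_strip N u s : (size u <= N)%N -> (size s <= N)%N -> 
  (pad N u == pad N s) = (strip u == strip s).
Proof.
move=> uN sN; apply/eqP/eqP => [us|us]; first by rewrite -(strip_pad N u) us strip_pad.
by rewrite -(pad_strip uN) us pad_strip.
Qed.

Lemma seq_deg_strip s : seq_deg (strip s) = seq_deg s.
Proof.
elim: s => //= a s IH; case: eqP => [->|//].
by rewrite /seq_deg big_cons /= muln0; apply: IH.
Qed.

Lemma seq_deg_pad N s : seq_deg (pad N s) = seq_deg s.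
Proof. by rewrite -seq_deg_strip strip_pad seq_deg_strip. Qed.

Lemma seq_deg_e s : all is_lam_e s -> seq_deg s = 0%N.
Proof. by move=> /allP es; rewrite /seq_deg big_seq big1 // => a /es/lam_e_k. Qed.

(** Vanishing propagates along the word: a letter of i- and k-degree 0 is an idempotent and has
    j-degree 0, which matching passes on as the i-degree of the next letter and, at the end, as the
    exponent [l]. *)
Lemma deg0_idempotent s l : all (in_BLambda p) s -> matched p s l -> word_i (s, l) = 0 ->
  seq_deg s = 0%N -> all is_lam_e s /\ l = 0%N.
Proof.
elim: s => [|a s IH] /=; first by move=> _ _ [->].
move=> /andP[Ba Bs] /andP[/eqP aj ms] a0; rewrite /seq_deg big_cons => /eqP.
rewrite addn_eq0 => /andP[/eqP ak /eqP sk].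
(* The i-degree [n + h] vanishes, so [n = h = 0]; what is left of the k-degree is the length
   [al + be]. *)
have ea : is_lam_e a.
  case: a a0 ak {aj Ba} => [[[[i al] be] n] h] [ni] /= k0.
  by apply/eqP; rewrite /lam_e /piB_e /lam_start /=; congr (_, _, _, _, _); nia.
rewrite lam_e_j // in aj.
by have [-> ->] := IH Bs ms (esym aj) sk; rewrite ea.
Qed.

Lemma lam_e_admissible u : all is_lam_e u -> all (in_BLambda p) u -> admissible p (u, 0%N).
Proof.
move=> eu Bu; rewrite /admissible /= Bu /=.
have u0 v : all is_lam_e v -> word_i (v, 0%N) = 0 by case: v => //= a v /andP[/eqP->].
rewrite u0 // eqxx andbT; elim: u eu {Bu} => //= a u IH /andP[ea eu].
by rewrite lam_e_j // u0 // IH.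
Qed.

Definition word_deg0 (x : KS) : bool := in_Bl p x && (seq_deg x.1 == 0%N).

Lemma word_deg0P x : word_deg0 x ->
  [/\ all is_lam_e x.1, x.2 = 0%N & strip x.1 = x.1].
Proof.
case: x => s l /andP[/andP[/eqP /= sE /and3P[/= Bs ms /eqP s0]] /eqP sd].
by have [es ->] := deg0_idempotent Bs ms s0 sd.
Qed.

Lemma word_deg0_intro u : all is_lam_e u -> all (in_BLambda p) u ->
  word_deg0 (strip u, 0%N).
Proof.
move=> eu Bu; rewrite /word_deg0 /in_Bl /= strip_id eqxx admissible_strip //.
by rewrite lam_e_admissible //= seq_deg_strip seq_deg_e.
Qed.

Lemma map_lam_e (f : lamB -> int) s : all is_lam_e [seq lam_e (f a) | a <- s].
Proof. by rewrite all_map; apply/allP => a _; apply/eqP. Qed.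

Lemma word_start_deg0 x : in_Bl p x -> word_deg0 (word_start x).
Proof.
case: x => s l /andP[_ /and3P[/= /allP Bs _ _]]; apply: word_deg0_intro.
  exact: map_lam_e.
rewrite all_map; apply/allP => a /Bs; rewrite in_BLambdaE => Ta.
exact/lam_e_BLambda/tB_start_bound.
Qed.

Lemma word_end_deg0 x : in_Bl p x -> word_deg0 (word_end x).
Proof.
case: x => s l /andP[_ /and3P[/= /allP Bs _ _]]; apply: word_deg0_intro.
  exact: map_lam_e.
rewrite all_map; apply/allP => a /Bs; rewrite in_BLambdaE => Ta.
exact/lam_e_BLambda/tB_end_bound.
Qed.

Lemma word_start_id x : word_deg0 x -> word_start x = x.
Proof.
case: x => s l /word_deg0P[/= es -> sE]; rewrite /word_start /=; congr (_, _).
rewrite -[RHS]sE; congr strip; elim: s es {sE} => //= a s IH /andP[/eqP ea es].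
by rewrite -ea IH.
Qed.

Lemma lam_end_hat1 : lam_e (lam_end lamB_hat1) = lamB_hat1.
Proof. by rewrite /lam_end /tB_end /= subr0 addr0. Qed.

Lemma struct_word_start (t x : KS) : word_deg0 t -> in_Bl p x ->
  lambda_struct F p t x = if t == word_start x then << x >> else 0.
Proof.
case: t x => u k [s l] /word_deg0P[/= eu -> uE] /andP[/eqP /= sE /and3P[/= Bs _ _]].
pose N := maxn (size u) (size s).
have uN : (size u <= N)%N := leq_maxl _ _; have sN : (size s <= N)%N := leq_maxr _ _.
have eU := all_pad N (isT : is_lam_e lamB_hat1) eu.
have BS := all_pad N (BLambda_hat1 p_gt0) Bs.
rewrite (@lambda_structE F p p_gt0 N (u, 0%N) (s, l)) // /B_struct /pad_word /=.
rewrite seqB_sign_el // expr0 scale1r seqB_e_mul ?size_pad //.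
rewrite (map_pad _ _ (erefl : (fun a => lam_e (lam_start a)) lamB_hat1 = lamB_hat1)).
rewrite pad_eq_strip ?size_map // uE.
have -> : ((u, 0%N) == word_start (s, l)) = (u == strip [seq lam_e (lam_start a) | a <- s]).
  by rewrite /word_start xpair_eqE eqxx andbT.
case: ifP => _; last exact: linear0.
by rewrite [LHS]malg_stripU /strip_word /= strip_pad sE.
Qed.

Lemma struct_word_end (t x : KS) : word_deg0 t -> in_Bl p x ->
  lambda_struct F p x t = if t == word_end x then << x >> else 0.
Proof.
case: t x => u k [s l] /word_deg0P[/= eu -> uE] /andP[/eqP /= sE /and3P[/= Bs _ _]].
pose N := maxn (size s) (size u).
have sN : (size s <= N)%N := leq_maxl _ _; have uN : (size u <= N)%N := leq_maxr _ _.
have eU := all_pad N (isT : is_lam_e lamB_hat1) eu.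
have BS := all_pad N (BLambda_hat1 p_gt0) Bs.
rewrite (@lambda_structE F p p_gt0 N (s, l) (u, 0%N)) // /B_struct /pad_word /=.
rewrite seqB_sign_er // expr0 scale1r seqB_mul_e ?size_pad // addn0.
rewrite (map_pad _ _ lam_end_hat1).
rewrite pad_eq_strip ?size_map // uE.
have -> : ((u, 0%N) == word_end (s, l)) = (u == strip [seq lam_e (lam_end a) | a <- s]).
  by rewrite /word_end xpair_eqE eqxx andbT.
case: ifP => _; last exact: linear0.
by rewrite [LHS]malg_stripU /strip_word /= strip_pad sE.
Qed.

Lemma lambda_struct_deg x y :
  supported (fun z => seq_deg z.1 = (seq_deg x.1 + seq_deg y.1)%N) (lambda_struct F p x y).
Proof.
rewrite /lambda_struct; set N := maxn _ _; apply: supported_lift => -[s l] xy.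
apply: (supportedU (P := fun z : KS => seq_deg z.1 = _)).
rewrite /strip_word /= seq_deg_strip.
move: xy; rewrite /B_struct /pad_word /=.
case st: (seqB_mul p (pad N x.1) (pad N y.1)) => [r|] /=; last first.
  by rewrite [malg_opt _ _]/malg_opt scaler0 msupp0 inE.
move=> /(fsubsetP (msuppZ_le _ _)); rewrite [malg_opt _ _]/malg_opt.
rewrite msuppU oner_eq0 inE => /eqP[-> _].
have [_] := seqB_mul_degree 0 0
  (etrans (size_pad (leq_maxl _ _)) (esym (size_pad (leq_maxr _ _)))) st.
by rewrite !seqB_kE -PoszD => -[]; rewrite -!/(seq_deg _) !seq_deg_pad.
Qed.

Lemma lambda_struct_monomial x y :
  exists (eps : bool) o, lambda_struct F p x y = (-1) ^+ eps *: malg_opt F o.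
Proof.
rewrite /lambda_struct /B_struct; set N := maxn _ _.
exists (seqB_sign p (pad N x.1) (pad N y.1)).
case: (seqB_mul p (pad N x.1) (pad N y.1)) => [r|]; last first.
  by exists None; rewrite linearZ; congr (_ *: _); apply: linear0.
exists (Some (strip r, (x.2 + y.2)%N)); rewrite linearZ; congr (_ *: _).
exact: malg_stripU.
Qed.

End LambdaIdempotents.

(** * The theorem *)

Section BasisOfLambda.
Variables (F : fieldType) (p : nat).
Hypothesis p_gt1 : (1 < p)%N.
Let p_gt0 : (0 < p)%N := ltnW p_gt1.
Local Notation KS := (seq lamB * nat)%type.
Implicit Types (x y : Bword p) (b c : B p).
Local Notation phi := (lambda_coord F p_gt0).

Lemma Beq_strip x y : Beq x y = (strip_word (val x) == strip_word (val y)).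
Proof.
by rewrite /Beq pad_eq_strip ?leq_maxl ?leq_maxr // /strip_word xpair_eqE.
Qed.

(** The normal form of a class, which embeds B into the symbols used for the coordinates of
    [lambda]. *)
Definition B_key b : KS := strip_word (val (repr b)).

Lemma B_key_class x : B_key (Bclass x) = strip_word (val x).
Proof.
by apply/eqP; rewrite /B_key -Beq_strip; apply/eqmodP; rewrite reprK.
Qed.

Lemma B_key_inj : injective B_key.
Proof.
move=> b c bc; rewrite -[b]reprK -[c]reprK; apply/eqmodP.
suff : Beq (repr b) (repr c) by [].
by rewrite Beq_strip; apply/eqP.
Qed.

Lemma height0_admissible x : all (eq_op^~ 0) (height x) = admissible p (val x).
Proof.
rewrite /height height_from_matched /admissible andbC (valP x) -surjective_pairing.
by [].
Qed.

Lemma admissible_strip_word (z : KS) : admissible p (strip_word z) = admissible p z.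
Proof. by case: z => s l; apply: admissible_strip. Qed.

Lemma in_BlambdaE b : in_Blambda b = admissible p (B_key b).
Proof. by rewrite /in_Blambda height0_admissible admissible_strip_word. Qed.

Lemma B_key_Bl b : in_Blambda b -> in_Bl p (B_key b).
Proof. by rewrite in_BlambdaE => adm; apply/andP; split=> //; apply/eqP/strip_id. Qed.

Lemma Bword_eltE x : admissible p (val x) ->
  Bword_elt F x = lambda_basis F p (strip_word (val x)).
Proof.
move=> adm; rewrite -[LHS]/(lambda_basis F p (val x)).
by move: adm; case: (val x) => s l adm; apply: lambda_basis_strip.
Qed.

Lemma B_eltE b : in_Blambda b -> B_elt F b = lambda_basis F p (B_key b).
Proof. by rewrite /in_Blambda height0_admissible => /Bword_eltE. Qed.

Lemma lambda_coord_B_elt b : in_Blambda b -> phi (B_elt F b) = << B_key b >>.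
Proof. by move=> Bb; rewrite B_eltE // ncoord_elt // B_key_Bl. Qed.

Lemma B_elt_class x : all (eq_op^~ 0) (height x) ->
  in_Blambda (Bclass x) /\ B_elt F (Bclass x) = Bword_elt F x.
Proof.
rewrite height0_admissible => adm.
have Bx : in_Blambda (Bclass x).
  by rewrite in_BlambdaE B_key_class admissible_strip_word.
split; first exact: Bx.
rewrite (B_eltE Bx) (Bword_eltE adm); exact: congr1 (B_key_class x).
Qed.

Lemma B_elt_inj : {in @in_Blambda p &, injective (@B_elt F p)}.
Proof.
move=> b c Bb Bc bc; apply: B_key_inj.
apply: (@ncoord_elt_inj _ _ _ _ _ _ phi); rewrite ?inE; try exact: B_key_Bl.
by rewrite -(B_eltE Bb) -(B_eltE Bc).
Qed.

Lemma B_eltM b c : in_Blambda b -> in_Blambda c ->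
  match B_mul b c with
  | Some (eps, d) => in_Blambda d /\
      (B_elt F b * B_elt F c)%A = (-1) ^+ eps *: B_elt F d
  | None => (B_elt F b * B_elt F c)%A = 0
  end.
Proof.
move=> Bb Bc.
have bcE : phi (B_elt F b * B_elt F c)%A = lambda_struct F p (B_key b) (B_key c).
  apply: etrans (ncoordM phi _ _) _.
  apply: etrans (congr2 (bilift _) (lambda_coord_B_elt Bb) (lambda_coord_B_elt Bc)) _.
  exact: biliftUU.
have allb := valP (repr b); have allc := valP (repr c).
rewrite /B_mul; move: bcE allb allc; rewrite /B_key.
case: (val (repr b)) => s l; case: (val (repr c)) => t k bcE allb allc.
set N := maxn (size s) (size t).
have sN : (size s <= N)%N := leq_maxl _ _; have tN : (size t <= N)%N := leq_maxr _ _.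
have {}bcE : phi (B_elt F b * B_elt F c)%A = malg_strip
    ((-1) ^+ seqB_sign p (pad N s) (pad N t) *: malg_opt F
      (omap (fun r => (r, (l + k)%N) : KS) (seqB_mul p (pad N s) (pad N t)))).
  apply: etrans bcE _.
  apply: etrans (@lambda_struct_strip F p p_gt0 N (s, l) (t, k) sN tN) _.
  by rewrite /B_struct /pad_word.
case st: (seqB_mul p (pad N s) (pad N t)) bcE => [r|] bcE; last first.
  apply: (@ncoord_inj _ _ _ _ _ _ phi); apply: etrans bcE _.
  by rewrite [malg_opt _ _]/malg_opt scaler0 !linear0.
have [_ allr] := seqB_mul_all (etrans (size_pad sN) (esym (size_pad tN))) st.
(* The insertion in [B_mul] succeeds, since the letters of a nonzero product again lie in
   B_Lambda. *)
rewrite (@insubT _ (fun z : KS => all (in_BLambda p) z.1) (Bword p) (r, (l + k)%N) allr).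
rewrite [omap _ _]/=.
set y := Sub _ _; have yE : val y = (r, (l + k)%N) by [].
have {}bcE : phi (B_elt F b * B_elt F c)%A =
    (-1) ^+ seqB_sign p (pad N s) (pad N t) *: << B_key (Bclass y) >>.
  apply: etrans bcE _; rewrite B_key_class yE linearZ; apply: congr1.
  exact: malg_stripU.
(* That the product has height 0 is not computed from degrees: its symbol occurs in the coordinates
   of an element of [lambda], and such symbols are admissible. *)
have Bd : in_Blambda (Bclass y).
  have : in_Bl p (B_key (Bclass y)).
    apply: (@ncoord_supported _ _ _ _ _ _ phi (B_elt F b * B_elt F c)%A).
    apply: etrans (congr1 (fun z => B_key (Bclass y) \in msupp z) bcE) _.
    by rewrite -mcoeff_neq0 mcoeffZ mcoeffUU mulr1 signr_eq0.
  by rewrite in_BlambdaE => /andP[].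
split=> //; apply: (@ncoord_inj _ _ _ _ _ _ phi).
apply: etrans bcE _; rewrite [RHS]linearZ; apply: congr1.
exact/esym/lambda_coord_B_elt.
Qed.

Lemma B_elt_span (u : lambda F p) :
  (exists2 b, in_Blambda b & u = B_elt F b) <->
  (exists2 z, in_Bl p z & u = lambda_basis F p z).
Proof.
split=> [[b Bb ->]|[z Bz ->]].
  by exists (B_key b); [apply: B_key_Bl | apply: B_eltE].
have /andP[/eqP zs adm] := Bz; have /and3P[allz _ _] := adm.
(* A normal form is itself a word over B_Lambda, so it determines a class whose key it is. *)
pose x : Bword p := Sub z allz.
have xz : strip_word (val x) = z by rewrite /= /strip_word zs -surjective_pairing.
have Bx : in_Blambda (Bclass x) by rewrite in_BlambdaE B_key_class xz.
exists (Bclass x); first exact: Bx.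
by rewrite (B_eltE Bx) B_key_class xz.
Qed.

Lemma B_elt_monomial_basis :
  monomial_basis (fun u : lambda F p => exists2 b, in_Blambda b & u = B_elt F b).
Proof.
apply: (@monomial_basis_ncoord F (lambda F p) _ _ _ _ phi (word_deg0 p) word_start
  (word_end p) (fun z => seq_deg p z.1)); last exact: B_elt_span.
- exact: lambda_struct_monomial.
- by [].
- exact: word_start_deg0.
- exact: word_end_deg0.
- exact: word_start_id.
- exact: struct_word_start.
- exact: struct_word_end.
- by move=> z w _ _; apply: lambda_struct_deg.
Qed.

End BasisOfLambda.

Theorem theorem2 (p : nat) (F : closedFieldType)
    (prime_p : prime p) (charF : p \in [pchar F]) :
  [/\ (* the image in lambda of an element of B_lambda does not depend on the
         B_q in which it is written *)
      forall x : Bword p, all (eq_op^~ 0) (height x) ->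
        in_Blambda (Bclass x) /\ B_elt F (Bclass x) = Bword_elt F x,
      {in @in_Blambda p &, injective (@B_elt F p)},
      (* the product of lambda restricts to the product of B *)
      forall b c : B p, in_Blambda b -> in_Blambda c ->
        match B_mul b c with
        | Some (eps, d) =>
            in_Blambda d /\
            (B_elt F b * B_elt F c)%A = (-1) ^+ eps *: B_elt F d
        | None => (B_elt F b * B_elt F c)%A = 0
        end
    & monomial_basis
        (fun u : lambda F p => exists2 b, in_Blambda b & u = B_elt F b)].
Proof.
have p_gt1 := prime_gt1 prime_p; split.
- by move=> x; apply: B_elt_class.
- exact: B_elt_inj.
- by move=> b c; apply: B_eltM.
- exact: B_elt_monomial_basis.
Qed.
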